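(* Let $C_\varphi$ be the composition operator on the Zen space $A^2_\nu$, where $\varphi(s)=\mu s$ with $\mu>1$ and $\nu$ determines the weight $w$ on $(0,\infty)$. Then $$\sigma(C_\varphi)\subseteq\{z\in\mathbb{C}: r\le|z|\le R\},$$ where $$r=\frac{1}{\sqrt{\mu}}\lim_{n\to\infty}\left(\inf_{t>0}\frac{w(\mu^nt)}{w(t)}\right)^{1/(2n)}\qquad\text{and}\qquad R=\frac{1}{\sqrt{\mu}}\lim_{n\to\infty}\left(\sup_{t>0}\frac{w(\mu^nt)}{w(t)}\right)^{1/(2n)}.$$
   Context: $\mathbb{C}_+=\{z\in\mathbb{C}:\operatorname{Re}z>0\}$ is the right half-plane. Let $\nu$ be a positive regular Borel measure on $[0,\infty)$ satisfying the doubling condition $\sup_{t>0}\nu[0,2t)/\nu[0,t)<\infty$. The Zen space $A^2_\nu$ consists of all analytic $F:\mathbb{C}_+\to\mathbb{C}$ such that $$\|F\|^2=\sup_{\epsilon>0}\int_{\overline{\mathbb{C}_+}}|F(s+\epsilon)|^2\,d\nu(x)\,dy<\infty ,\qquad s=x+iy .$$ The weight determined by $\nu$ is $w(t)=2\pi\int_0^\infty e^{-2rt}\,d\nu(r)$ for $t>0$ (the integral being over $[0,\infty)$, including any atom of $\nu$ at $0$). The Laplace transform is an isometric isomorphism from $L^2(0,\infty,w(t)\,dt)$ onto $A^2_\nu$. The composition operator is $C_\varphi f=f\circ\varphi$, and $\sigma$ denotes the spectrum. *)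

(* Defs.v *)
From mathcomp Require Import all_boot all_order all_algebra.
From mathcomp Require Import complex.
From mathcomp Require Import all_classical all_reals all_analysis.

Set Implicit Arguments.
Unset Strict Implicit.
Unset Printing Implicit Defensive.

Import Order.TTheory GRing.Theory Num.Theory.
Import numFieldNormedType.Exports.

Local Open Scope classical_set_scope.
Local Open Scope ring_scope.

Section Zen.
Variable R : realType.

(** The right half-plane as a type, so that two functions on it are equal as
    soon as they agree at every point of positive real part. *)
Definition right_half_plane := {s : R[i] | 0 < complex.Re s}.

(** Extension by zero to the whole plane. *)
Definition extend (F : right_half_plane -> R[i]) (z : R[i]) : R[i] :=
  oapp F 0 (insub z).

Definition analytic (F : right_half_plane -> R[i]) : Prop :=
  forall z : R[i], 0 < complex.Re z ->
    derivable (extend F : (R[i])^o -> (R[i])^o) z 1.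

(** A measure on [0, +oo[ is represented by a Borel measure on the line that
    vanishes on the negative half-line. *)
Notation borel_measure := {measure set (measurableTypeR R) -> \bar R}.

Definition regular_measure (nu : borel_measure) : Prop :=
  [/\ forall K : set R, compact K -> (nu K < +oo)%E,
      forall A : set (measurableTypeR R), measurable A ->
        nu A = ereal_inf [set nu U | U in [set U : set R | open U /\ A `<=` U]]
    & forall A : set (measurableTypeR R), measurable A ->
        nu A =
        ereal_sup [set nu K | K in [set K : set R | compact K /\ K `<=` A]]].

Definition initial_mass (nu : borel_measure) (t : R) : \bar R := nu [set` `[0, t[].

(** Positivity and finiteness of the masses are what makes every quotient in
    the supremum meaningful: in [\bar R], [0 / 0 = 0] and [+oo / +oo = 0]. *)
Definition doubling (nu : borel_measure) : Prop :=
  (forall t : R, 0 < t -> (0 < initial_mass nu t < +oo)%E) /\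
  (ereal_sup [set (initial_mass nu (2 * t) / initial_mass nu t)%E
             | t in [set t : R | (0 < t)%R]] < +oo)%E.

Definition zen_measure (nu : borel_measure) : Prop :=
  [/\ nu [set` `]-oo, 0[] = 0%E, regular_measure nu & doubling nu].

(** The square of the norm of the Zen space; the point [(x, y)] stands for
    [s = x + iy]. *)
Definition zen_sqnorm (nu : borel_measure) (F : right_half_plane -> R[i]) :
    \bar R :=
  ereal_sup
    [set (\int[(nu \x lebesgue_measure)%E]_(p in [set p : R * R | (0 <= p.1)%R])
            (Normc.normc (extend F ((p.1 + e)%R +i* p.2)%C) ^+ 2)%:E)%E
    | e in [set e : R | 0 < e]].

Definition zen_space (nu : borel_measure) : set (right_half_plane -> R[i]) :=
  [set F | analytic F /\ (zen_sqnorm nu F < +oo)%E].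

Definition zen_norm (nu : borel_measure) (F : right_half_plane -> R[i]) : R :=
  Num.sqrt (fine (zen_sqnorm nu F)).

Definition zen_weight (nu : borel_measure) (t : R) : R :=
  2 * pi * \int[nu]_(r in `[0, +oo[) expR (- 2 * r * t).

End Zen.

Section Spectrum.
Variables (R : realType) (V : lmodType R[i]).

(** [A] is the carrier of a normed space inside [V], with norm [N]; what an
    operator or the norm does outside of [A] is irrelevant. *)
Definition bounded_operator (A : set V) (N : V -> R) (T : V -> V) : Prop :=
  [/\ forall f, A f -> A (T f),
      forall (a : R[i]) f g, A f -> A g -> T (a *: f + g) = a *: T f + T g
    & exists M : R, forall f, A f -> N (T f) <= M * N f].

Definition invertible_operator (A : set V) (N : V -> R) (T : V -> V) : Prop :=
  bounded_operator A N T /\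
  exists S : V -> V,
    [/\ bounded_operator A N S, forall f, A f -> S (T f) = f
      & forall f, A f -> T (S f) = f].

Definition spectrum (A : set V) (N : V -> R) (T : V -> V) : set R[i] :=
  [set z | ~ invertible_operator A N (fun f => T f - z *: f)].

End Spectrum.

Section Dilation.
Variable R : realType.

Lemma dilation_subproof (mu : R) (mu_gt1 : 1 < mu) (s : right_half_plane R) :
  0 < complex.Re (mu%:C%C * val s).
Proof.
case: s => -[x y] /= x0; rewrite mul0r subr0.
by rewrite mulr_gt0// (lt_trans _ mu_gt1).
Qed.

Definition dilation (mu : R) (mu_gt1 : 1 < mu) (s : right_half_plane R) :
    right_half_plane R :=
  exist _ (mu%:C%C * val s) (dilation_subproof mu_gt1 s).

Definition composition (phi : right_half_plane R -> right_half_plane R)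
    (F : right_half_plane R -> (R[i])^o) : right_half_plane R -> (R[i])^o :=
  F \o phi.

Definition weight_ratios (w : R -> R) (mu : R) (n : nat) : set R :=
  [set w (mu ^+ n * t) / w t | t in [set t : R | 0 < t]].

Definition inner_seq (w : R -> R) (mu : R) (n : nat) : R :=
  inf (weight_ratios w mu n) `^ ((2 * n)%:R)^-1.

Definition outer_seq (w : R -> R) (mu : R) (n : nat) : R :=
  sup (weight_ratios w mu n) `^ ((2 * n)%:R)^-1.

End Dilation.

(* Main.v *)
Require Import Defs.
From HB Require Import structures.
From mathcomp Require Import all_boot all_order all_algebra.
From mathcomp Require Import complex.
From mathcomp Require Import all_classical all_reals all_analysis.
From mathcomp Require Import measurable_realfun ring lra.
Import Order.TTheory GRing.Theory Num.Theory.
Import numFieldNormedType.Exports.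
Local Open Scope classical_set_scope.
Local Open Scope ring_scope.
Set Implicit Arguments.
Unset Strict Implicit.
Unset Printing Implicit Defensive.

(** Let [C] be the composition operator. Its powers are the dilations [F(mu^n
    z)] of [F], so that the resolvent of [C] should be a Neumann series in
    dilations: in the powers of [C] when [|z| > R], and in those of its inverse,
    the dilation by [1/mu], when [|z| < r]. What has to be known is how fast the
    norms of these dilations grow.

    Let [M(x)] be the integral of [|F(x + iy)|^2] over [y]. The square of the
    norm is the supremum over [e > 0] of the [nu]-integrals of [M(x + e)], and
    the dilation by [l] turns [M(x)] into [M(l x) / l]. The point is that [M] is
    nonincreasing. The function [F(z) conj(F(2x - conj z))] is analytic, equals
    [|F|^2] on the line [Re z = x], and is at most
    [(|F(z)|^2 + |F(2x - conj z)|^2) / 2] everywhere; moving its integral from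
    the line of abscissa [x] to the line of abscissa [x - t] by Goursat's theorem
    makes [M] midpoint convex ([vint_mid]). Since the norm of [F] is finite,
    [M] is bounded at infinity, and a midpoint convex function bounded at
    infinity cannot increase ([mid_nonincreasing]). Therefore the sets where [M]
    exceeds a given level are initial intervals, and the layer cake formula
    bounds the integral of [M(l x)] by that of [M] times the supremum of
    [m(t/l) / m(t)], where [m(t)] is the [nu]-mass of the points [x] with
    [0 <= x < t] ([norm2_dilate]).

    The doubling condition makes [w(t)] comparable to [m(1/t)]
    ([weight_bounds]). So, up to a constant that does not depend on [n], the
    square of the norm of the [n]-th power of [C] is at most
    [mu^(-n) sup_t w(mu^n t)/w(t)], and for the [n]-th power of the inverse it is
    at most [mu^n / inf_t w(mu^n t)/w(t)] ([dilation_powers]). The [2n]-th roots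
    of both sequences converge by Fekete's lemma ([root_cvg]), and constants
    disappear in the limit.

    To sum the Neumann series, point evaluations are shown to be bounded, locally
    uniformly in the half-plane, by Cauchy's formula for [F^2] on long rectangles
    ([pointwise_le], [zen_pointwise]). The series then converges locally
    uniformly, so its sum is analytic ([weierstrass]), and the Cauchy-Schwarz
    inequality against a geometric weight bounds the norm of the sum
    ([norm2_neumann]). *)

Local Notation normc := (@Normc.normc _).
Local Notation Re := (@complex.Re _).
Local Notation Im := (@complex.Im _).
(** * Complex numbers and integrals along segments *)

Section ComplexPlane.
Variable R : realType.
Local Notation C := (R[i]^o).
Implicit Types (z w : R[i]) (f g : R[i] -> R[i]) (u v : R -> R[i]).

Lemma normcE z : `|z| = (normc z)%:C%C.
Proof. by []. Qed.

Lemma normc_ge0 z : 0 <= normc z.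
Proof. by rewrite -ler0c -normcE. Qed.

Lemma sqr_normcE z : normc z ^+ 2 = Re z ^+ 2 + Im z ^+ 2.
Proof. by case: z => x y /=; rewrite sqr_sqrtr// addr_ge0// sqr_ge0. Qed.

Lemma normcD z w : normc (z + w) <= normc z + normc w.
Proof. exact: (@le_normcD R z w). Qed.

Lemma normc_opp z : normc (- z) = normc z.
Proof. exact: (@normcN R z). Qed.

Lemma normcX z n : normc (z ^+ n) = normc z ^+ n.
Proof. by elim: n => [|n IH]; rewrite ?expr0 ?Normc.normc1// !exprS Normc.normcM IH. Qed.

Lemma normcB z w : normc (z - w) = normc (w - z).
Proof. by rewrite -normc_opp opprB. Qed.

Lemma normc_dist3 x z w : normc (z - w) <= normc (z - x) + normc (x - w).
Proof. by rewrite -[z - w](subrKA x) normcD. Qed.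

Lemma normcR (x : R) : normc x%:C%C = `|x|.
Proof. by rewrite /= expr0n /= addr0 sqrtr_sqr. Qed.

Lemma normc_eq0 z : (normc z == 0) = (z == 0).
Proof.
by apply/eqP/eqP => [/Normc.eq0_normc//|->]; rewrite Normc.normc0.
Qed.

Lemma normc_gt0 z : (0 < normc z) = (z != 0).
Proof. by rewrite lt_def normc_ge0 andbT normc_eq0. Qed.

Lemma Re_le_normc z : `|Re z| <= normc z.
Proof.
by rewrite -ler_sqr ?nnegrE ?normc_ge0// sqr_normcE real_normK ?num_real// lerDl sqr_ge0.
Qed.

Lemma Im_le_normc z : `|Im z| <= normc z.
Proof.
by rewrite -ler_sqr ?nnegrE ?normc_ge0// sqr_normcE real_normK ?num_real// lerDr sqr_ge0.
Qed.

Lemma normc_le z : normc z <= `|Re z| + `|Im z|.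
Proof.
rewrite -ler_sqr ?nnegrE ?normc_ge0 ?addr_ge0// sqr_normcE sqrrD !real_normK ?num_real//.
by rewrite addrAC lerDl mulrn_wge0// mulr_ge0.
Qed.

Lemma nbhsCP z (A : set C) :
  nbhs (z : C) A <-> exists2 e : R, 0 < e & forall w, normc (w - z) < e -> A w.
Proof.
split.
- case/nbhs_ballP => e /= e0 H.
  have := e0; rewrite ltcE /= => /andP[/eqP ei er].
  exists (Re e) => // w wz; apply: H; rewrite /ball /= distrC normcE.
  by rewrite ltcE /= -ei eqxx.
- case=> e e0 H; apply/nbhs_ballP; exists (e%:C%C); first by rewrite /= ltcR.
  by move=> w; rewrite /ball /= distrC normcE ltcR; apply: H.
Qed.

Lemma Re_continuous : continuous (Re : C -> R).
Proof.
move=> z; apply/(@cvgrPdist_lt _ R _ (nbhs (z : C)) _) => e e0; apply/nbhsCP; exists e => // w wz.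
rewrite distrC; apply: le_lt_trans wz; apply: le_trans (Re_le_normc _).
by case: w z => [a b] [c d].
Qed.

Lemma Im_continuous : continuous (Im : C -> R).
Proof.
move=> z; apply/(@cvgrPdist_lt _ R _ (nbhs (z : C)) _) => e e0; apply/nbhsCP; exists e => // w wz.
rewrite distrC; apply: le_lt_trans wz; apply: le_trans (Im_le_normc _).
by case: w z => [a b] [c d].
Qed.

Lemma normc_continuous : continuous (normc : C -> R).
Proof.
move=> z; apply/(@cvgrPdist_lt _ R _ (nbhs (z : C)) _) => e e0; apply/nbhsCP; exists e => // w wz.
apply: le_lt_trans wz; rewrite ler_norml; apply/andP; split.
- by rewrite lerNl opprB lerBlDr -{1}(subrK z w) normcD.
- by rewrite lerBlDr normcB -{1}(subrK w z) normcD.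
Qed.

Lemma hline_continuous (y : R) : continuous ((fun x => x +i* y)%C : R -> C).
Proof.
move=> x; apply/cvgrPdist_lt => e.
rewrite ltcE /= => /andP[/eqP ei er]; near=> t.
rewrite normcE ltcE /= -ei eqxx /= subrr expr0n addr0 sqrtr_sqr.
by near: t; apply: cvgr_dist_lt.
Unshelve. all: by end_near. Qed.

Lemma vline_continuous (x : R) : continuous ((fun y => x +i* y)%C : R -> C).
Proof.
move=> y; apply/cvgrPdist_lt => e.
rewrite ltcE /= => /andP[/eqP ei er]; near=> t.
rewrite normcE ltcE /= -ei eqxx /= subrr expr0n add0r sqrtr_sqr.
by near: t; apply: cvgr_dist_lt.
Unshelve. all: by end_near. Qed.

(** Continuity as a function on the whole line, at each point of the closed
    segment: it passes to subsegments without subspace topologies. *)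
Definition segc (a b : R) u := forall t, a <= t <= b -> {for t, continuous (u : R -> C)}.

(** Componentwise, so that the bounds below cost a factor [2] ([cint_le],
    [cint_norm_le]); no constant matters in what follows. *)
Definition cint (a b : R) u : R[i] :=
  Complex (\int[lebesgue_measure]_(t in `[a, b]) Re (u t))
          (\int[lebesgue_measure]_(t in `[a, b]) Im (u t)).

Lemma within_segc (a b : R) (h : R -> R) :
  (forall t, a <= t <= b -> {for t, continuous h}) -> {within `[a, b], continuous h}.
Proof.
move=> H; apply: continuous_in_subspaceT => t; rewrite inE /= in_itv /=; exact: H.
Qed.

Lemma itv_integrable (a b : R) (h : R -> R) :
  (forall t, a <= t <= b -> {for t, continuous h}) ->
  lebesgue_measure.-integrable `[a, b] (EFin \o h).
Proof.
move=> H; apply: continuous_compact_integrable; first exact: segment_compact.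
exact: within_segc.
Qed.

Lemma ReD z w : Re (z + w) = Re z + Re w. Proof. by case: z w => [? ?] []. Qed.
Lemma ImD z w : Im (z + w) = Im z + Im w. Proof. by case: z w => [? ?] []. Qed.
Lemma ReN z : Re (- z) = - Re z. Proof. by case: z. Qed.
Lemma ImN z : Im (- z) = - Im z. Proof. by case: z. Qed.
Lemma ReM z w : Re (z * w) = Re z * Re w - Im z * Im w. Proof. by case: z w => [? ?] []. Qed.
Lemma ImM z w : Im (z * w) = Re z * Im w + Im z * Re w. Proof. by case: z w => [? ?] []. Qed.
Lemma ceqP z w : Re z = Re w -> Im z = Im w -> z = w.
Proof. by case: z w => [? ?] [? ?] /= -> ->. Qed.

Lemma continuous_Re u t : {for t, continuous (u : R -> C)} -> {for t, continuous (fun t => Re (u t))}.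
Proof. by move=> H; apply: (@continuous_comp R C R u Re t); [exact: H|exact: Re_continuous]. Qed.

Lemma continuous_Im u t : {for t, continuous (u : R -> C)} -> {for t, continuous (fun t => Im (u t))}.
Proof. by move=> H; apply: (@continuous_comp R C R u Im t); [exact: H|exact: Im_continuous]. Qed.

Definition rint (a b : R) (h : R -> R) : R := \int[lebesgue_measure]_(t in `[a, b]) h t.

Definition rsegc (a b : R) (h : R -> R) := forall t, a <= t <= b -> {for t, continuous h}.

Lemma segc_Re a b u : segc a b u -> rsegc a b (fun t => Re (u t)).
Proof. by move=> H t tab; apply: continuous_Re; apply: H. Qed.

Lemma segc_Im a b u : segc a b u -> rsegc a b (fun t => Im (u t)).
Proof. by move=> H t tab; apply: continuous_Im; apply: H. Qed.

Lemma rintD a b (h k : R -> R) : rsegc a b h -> rsegc a b k ->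
  rint a b (fun t => h t + k t) = rint a b h + rint a b k.
Proof. by move=> hc kc; apply: RintegralD => //; apply: itv_integrable. Qed.

Lemma rintB a b (h k : R -> R) : rsegc a b h -> rsegc a b k ->
  rint a b (fun t => h t - k t) = rint a b h - rint a b k.
Proof. by move=> hc kc; apply: RintegralB => //; apply: itv_integrable. Qed.

Lemma rintZ a b c (h : R -> R) : rsegc a b h ->
  rint a b (fun t => c * h t) = c * rint a b h.
Proof. by move=> hc; apply: RintegralZl => //; apply: itv_integrable. Qed.

Lemma eq_rint a b (h k : R -> R) : (forall t, a <= t <= b -> h t = k t) ->
  rint a b h = rint a b k.
Proof. by move=> H; apply: eq_Rintegral => t; rewrite inE /= in_itv /= => /H ->. Qed.

Lemma rsegcZ a b c (h : R -> R) : rsegc a b h -> rsegc a b (fun t => c * h t).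
Proof. by move=> H t tab; apply: cvgM; [exact: cvg_cst|exact: H]. Qed.

Lemma cintD a b u v : segc a b u -> segc a b v ->
  cint a b (fun t => u t + v t) = cint a b u + cint a b v.
Proof.
move=> hu hv; apply: ceqP; rewrite ?ReD ?ImD.
- have := rintD (segc_Re hu) (segc_Re hv); rewrite /rint => <-.
  by apply: eq_rint => t _; rewrite ReD.
- have := rintD (segc_Im hu) (segc_Im hv); rewrite /rint => <-.
  by apply: eq_rint => t _; rewrite ImD.
Qed.

Lemma cintZ a b u (c : R[i]) : segc a b u ->
  cint a b (fun t => c * u t) = c * cint a b u.
Proof.
move=> /[dup] /segc_Re hr /segc_Im hi.
apply: ceqP; rewrite ?ReM ?ImM -/(rint _ _ _) -/(rint _ _ _).
- have := rintB (rsegcZ (c := Re c) hr) (rsegcZ (c := Im c) hi); rewrite !rintZ// => <-.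
  by apply: eq_rint => t _; rewrite ReM.
- have := rintD (rsegcZ (c := Re c) hi) (rsegcZ (c := Im c) hr); rewrite !rintZ// => <-.
  by apply: eq_rint => t _; rewrite ImM.
Qed.

Lemma eq_cint a b u v : (forall t, a <= t <= b -> u t = v t) -> cint a b u = cint a b v.
Proof.
move=> H; apply: ceqP => /=; apply: eq_Rintegral => t; rewrite inE /= in_itv /= => /H ->//.
Qed.

Lemma cint_cst a b (c : R[i]) : a <= b -> cint a b (fun=> c) = (b - a)%:C%C * c.
Proof.
move=> ab; apply: ceqP; rewrite ?ReM ?ImM /= Rintegral_cst//= lebesgue_measure_itv /= lte_fin;
  case: ltgtP ab => // [ab|->] _; rewrite -?EFinB/= ?mul0r ?subrr ?mulr0 ?subr0 ?addr0 ?mul0r//;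
  by rewrite mulrC.
Qed.

Lemma cint_split a m b u : a <= m <= b -> segc a b u ->
  cint a b u = cint a m u + cint m b u.
Proof.
move=> /andP[am mb] hu.
have key (h : R -> R) : (forall t, a <= t <= b -> {for t, continuous h}) ->
    \int[lebesgue_measure]_(t in `[a, b]) h t =
    \int[lebesgue_measure]_(t in `[a, m]) h t + \int[lebesgue_measure]_(t in `[m, b]) h t.
  move=> hh; have hi := itv_integrable hh.
  have := @Rintegral_itvB R h (BLeft a) (BRight b) m hi.
  rewrite !bnd_simp => /(_ am mb) /eqP; rewrite subr_eq addrC => /eqP ->; congr (_ + _).
  rewrite Rintegral_itv_obnd_cbnd//; apply: integrableS hi => //.
  by apply: subset_itvr; rewrite bnd_simp.
by apply: ceqP; rewrite ?ReD ?ImD /=; apply: key => t tab;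
  [apply: continuous_Re|apply: continuous_Im]; auto.
Qed.

Lemma norm_Rintegral_le a b (h : R -> R) B : a <= b ->
  (forall t, a <= t <= b -> {for t, continuous h}) ->
  (forall t, a <= t <= b -> `|h t| <= B) ->
  `| \int[lebesgue_measure]_(t in `[a, b]) h t | <= (b - a) * B.
Proof.
move=> ab hc hB.
have hi := itv_integrable hc.
apply: le_trans (le_normr_Rintegral _ hi) _ => //.
have -> : (b - a) * B = \int[lebesgue_measure]_(t in `[a, b]) B.
  rewrite Rintegral_cst//= lebesgue_measure_itv /= lte_fin.
  by case: ltgtP ab => // [ab|->] _; rewrite -?EFinB/= ?subrr ?mul0r ?mulr0// mulrC.
apply: le_Rintegral => //.
- by apply: itv_integrable => t tab; apply: continuous_comp; [exact: hc|exact: norm_continuous].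
- by apply: itv_integrable => t tab; exact: cst_continuous.
Qed.

Lemma cint_le a b u B : a <= b -> segc a b u ->
  (forall t, a <= t <= b -> normc (u t) <= B) -> normc (cint a b u) <= 2 * ((b - a) * B).
Proof.
move=> ab hu hB; apply: le_trans (normc_le _) _ => /=.
rewrite mulr2n mulrDl mul1r lerD//; apply: norm_Rintegral_le => // t tab.
- by apply: continuous_Re; auto.
- by apply: le_trans (Re_le_normc _) (hB _ tab).
- by apply: continuous_Im; auto.
- by apply: le_trans (Im_le_normc _) (hB _ tab).
Qed.

End ComplexPlane.
(** * Goursat's theorem on rectangles *)

Section Cauchy.
Variable R : realType.
Local Notation C := (R[i]^o).
Implicit Types (z w : R[i]) (f g : R[i] -> R[i]) (u v : R -> R[i]).

(** The cast keeps the arithmetic of [f] in the ring [R[i]]; only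
    differentiability speaks of the normed space. *)
Definition cdiff f z : Prop := derivable (f : C -> C) (z : C) 1.

Lemma cdiffP f z : cdiff f z <-> exists D : R[i],
  forall e : R, 0 < e -> exists2 r : R, 0 < r & forall w, normc (w - z) < r ->
    normc (f w - f z - D * (w - z)) <= e * normc (w - z).
Proof.
split.
- case/cvg_ex => /= D /cvgrPdist_le HD; exists D => e e0.
  have := HD e%:C%C; rewrite ltcR => /(_ e0).
  rewrite near_withinE /= => /nbhsCP [r r0 H]; exists r => // w wr.
  have [->|wz] := eqVneq w z; first by rewrite !subrr mulr0 subrr Normc.normc0 mulr0.
  have hn0 : w - z != 0 by rewrite subr_eq0.
  have := H (w - z); rewrite subr0 => /(_ wr hn0).
  have -> : (w - z)%:A = w - z :> C by exact: mulr1.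
  rewrite subrK normcE lecR => K.
  rewrite -ler_pdivrMr ?normc_gt0// -Normc.normcV -Normc.normcM.
  rewrite mulrBl mulfK// normcB; apply: le_trans K; rewrite le_eqVlt; apply/orP; left; apply/eqP.
  by congr (normc (_ - _)); rewrite /GRing.scale /= mulrC.
- case=> D HD; apply/cvg_ex; exists (D : C); apply/cvgrPdist_le => e.
  rewrite ltcE /= => /andP[/eqP ei er].
  have [r r0 H] := HD _ er.
  rewrite near_withinE; apply/nbhsCP; exists r => // h; rewrite subr0 => hr hn0.
  have := H (h + z); rewrite addrK => /(_ hr) K.
  have -> : h%:A = h :> C by exact: mulr1.
  rewrite normcE lecE /= -ei eqxx /=.
  rewrite -(ler_pM2r (_ : 0 < normc h)) ?normc_gt0// -Normc.normcM.
  apply: le_trans K; rewrite le_eqVlt; apply/orP; left; apply/eqP.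
  rewrite [RHS]normcB; congr (normc _).
  by rewrite /GRing.scale /= mulrBl [_ * _ * h]mulrAC mulVf// mul1r.
Qed.

Lemma cdiff_continuous f z : cdiff f z -> {for (z : C), continuous (f : C -> C)}.
Proof. by move=> /derivable1_diffP /differentiable_continuous. Qed.

Lemma segcD a b u v : segc a b u -> segc a b v -> segc a b (fun t => u t + v t).
Proof. by move=> hu hv t tab; apply: (@continuousD R[i] C R u v t); [exact: hu|exact: hv]. Qed.

Lemma segcN a b u : segc a b u -> segc a b (fun t => - u t).
Proof. by move=> hu t tab; apply: (@continuousN R[i] C R u t); exact: hu. Qed.

Lemma segcB a b u v : segc a b u -> segc a b v -> segc a b (fun t => u t - v t).
Proof. move=> hu hv; exact: (@segcD a b u (fun t => - v t) hu (segcN hv)). Qed.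

Definition rect (a b c d : R) : set R[i] := [set z | a <= Re z <= b /\ c <= Im z <= d].

Definition bdry (a b c d : R) : set R[i] :=
  [set z | rect a b c d z /\ [\/ Re z = a, Re z = b, Im z = c | Im z = d]].

(** The contour integral along the positively oriented boundary. Opposite sides
    are paired, so that the constant part of an integrand cancels pointwise and
    only two integrals along segments remain. *)
Definition bint (a b c d : R) f : R[i] :=
  cint a b (fun x => f (x +i* c)%C - f (x +i* d)%C) +
  'i%C * cint c d (fun y => f (b +i* y)%C - f (a +i* y)%C).

Definition bcont a b c d f := forall z, bdry a b c d z -> {for (z : C), continuous (f : C -> C)}.

Lemma hseg a b y f : (forall x, a <= x <= b -> {for (x +i* y)%C : C, continuous (f : C -> C)}) ->
  segc a b (fun x => f (x +i* y)%C).
Proof.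
move=> H x xab; apply: (@continuous_comp R C C (fun x => (x +i* y)%C) f x).
- exact: hline_continuous.
- exact: H.
Qed.

Lemma vseg c d x f : (forall y, c <= y <= d -> {for (x +i* y)%C : C, continuous (f : C -> C)}) ->
  segc c d (fun y => f (x +i* y)%C).
Proof.
move=> H y ycd; apply: (@continuous_comp R C C (fun y => (x +i* y)%C) f y).
- exact: vline_continuous.
- exact: H.
Qed.

Section Rect.
Variables (a b c d : R).
Hypotheses (ab : a <= b) (cd : c <= d).

Lemma bcont_h1 f : bcont a b c d f -> segc a b (fun x => f (x +i* c)%C).
Proof.
move=> H; apply: hseg => x xab; apply: H; split; first by split=> //=; rewrite lexx.
by apply: Or43.
Qed.

Lemma bcont_h2 f : bcont a b c d f -> segc a b (fun x => f (x +i* d)%C).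
Proof.
move=> H; apply: hseg => x xab; apply: H; split; first by split=> //=; rewrite lexx andbT.
by apply: Or44.
Qed.

Lemma bcont_v1 f : bcont a b c d f -> segc c d (fun y => f (a +i* y)%C).
Proof.
move=> H; apply: vseg => x xab; apply: H; split; first by split=> //=; rewrite lexx.
by apply: Or41.
Qed.

Lemma bcont_v2 f : bcont a b c d f -> segc c d (fun y => f (b +i* y)%C).
Proof.
move=> H; apply: vseg => x xab; apply: H; split; first by split=> //=; rewrite lexx andbT.
by apply: Or42.
Qed.

Lemma bcont_h f : bcont a b c d f -> segc a b (fun x => f (x +i* c)%C - f (x +i* d)%C).
Proof. by move=> H; apply: segcB; [exact: bcont_h1|exact: bcont_h2]. Qed.

Lemma bcont_v f : bcont a b c d f -> segc c d (fun y => f (b +i* y)%C - f (a +i* y)%C).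
Proof. by move=> H; apply: segcB; [exact: bcont_v2|exact: bcont_v1]. Qed.

Lemma bintD f g : bcont a b c d f -> bcont a b c d g ->
  bint a b c d (fun z => f z + g z) = bint a b c d f + bint a b c d g.
Proof.
move=> hf hg; rewrite /bint addrACA -mulrDr.
rewrite -(cintD (bcont_h hf) (bcont_h hg)) -(cintD (bcont_v hf) (bcont_v hg)).
by congr (_ + 'i%C * _); apply: eq_cint => t _; rewrite opprD addrACA.
Qed.

Lemma bintZ k f : bcont a b c d f ->
  bint a b c d (fun z => k * f z) = k * bint a b c d f.
Proof.
move=> hf; rewrite /bint mulrDr (mulrCA k 'i%C).
rewrite -(cintZ k (bcont_h hf)) -(cintZ k (bcont_v hf)).
by congr (_ + 'i%C * _); apply: eq_cint => t _; rewrite mulrBr.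
Qed.

Lemma eq_bint f g : (forall z, bdry a b c d z -> f z = g z) ->
  bint a b c d f = bint a b c d g.
Proof.
move=> H; rewrite /bint; congr (_ + 'i%C * _); apply: eq_cint => t tab; congr (_ - _); apply: H;
  (split; first by split; rewrite /= ?tab ?lexx ?ab ?cd).
- exact: Or43.
- exact: Or44.
- exact: Or42.
- exact: Or41.
Qed.

(** The constant part cancels within each pair of opposite sides, and the linear
    part contributes [q (b - a) i (c - d)] and its opposite. *)
Lemma bint_affine p q : bint a b c d (fun z => p + q * z) = 0.
Proof.
rewrite /bint; under eq_cint do rewrite addrAC opprD addrA subrr sub0r addrC -mulrBr.
rewrite (@eq_cint _ a b _ (fun=> q * (0 +i* (c - d))%C)); last first.
  by move=> t _; congr (_ * _); apply: ceqP => /=; rewrite ?subrr.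
rewrite (@eq_cint _ c d _ (fun=> q * ((b - a) +i* 0)%C)); last first.
  move=> t _; rewrite opprD addrACA subrr add0r -mulrBr.
  by congr (_ * _); apply: ceqP => /=; rewrite ?subrr.
rewrite !cint_cst//; case: q => q1 q2; apply: ceqP => /=; ring.
Qed.

Lemma bint_le f B : bcont a b c d f -> (forall z, bdry a b c d z -> normc (f z) <= B) ->
  normc (bint a b c d f) <= 4 * ((b - a) + (d - c)) * B.
Proof.
move=> hf hB.
have b1 : normc (cint a b (fun x => f (x +i* c)%C - f (x +i* d)%C)) <= 2 * ((b - a) * (2 * B)).
  apply: cint_le => //; first exact: bcont_h.
  move=> t tab; apply: le_trans (normcD _ _) _; rewrite normc_opp mulr2n mulrDl mul1r.
  apply: lerD; apply: hB; (split; first by split; rewrite /= ?tab ?lexx ?ab ?cd).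
  - exact: Or43.
  - exact: Or44.
have b2 : normc (cint c d (fun x => f (b +i* x)%C - f (a +i* x)%C)) <= 2 * ((d - c) * (2 * B)).
  apply: cint_le => //; first exact: bcont_v.
  move=> t tab; apply: le_trans (normcD _ _) _; rewrite normc_opp mulr2n mulrDl mul1r.
  apply: lerD; apply: hB; (split; first by split; rewrite /= ?tab ?lexx ?ab ?cd).
  - exact: Or42.
  - exact: Or41.
apply: le_trans (normcD _ _) _; rewrite Normc.normcM.
have -> : normc ('i%C : R[i]) = 1 by rewrite /= expr0n expr1n add0r sqrtr1.
lra.
Qed.

End Rect.

Lemma bint_splitx a m b c d f : c <= d -> a <= m <= b ->
  bcont a m c d f -> bcont m b c d f ->
  bint a b c d f = bint a m c d f + bint m b c d f.
Proof.
move=> cd /andP[am mb] h1 h2; rewrite /bint addrACA -mulrDr.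
have am' := bcont_h cd h1; have mb' := bcont_h cd h2.
rewrite -(cintD (bcont_v am h1) (bcont_v mb h2)); congr (_ + 'i%C * _).
- apply: cint_split; first by rewrite am.
  move=> t /andP[ta tb]; have [tm|/ltW tm] := leP t m; [apply: am'|apply: mb']; exact/andP.
- by apply: eq_cint => t _; rewrite [RHS]addrC subrKA.
Qed.

Lemma bint_splity a b c m d f : a <= b -> c <= m <= d ->
  bcont a b c m f -> bcont a b m d f ->
  bint a b c d f = bint a b c m f + bint a b m d f.
Proof.
move=> ab /andP[am mb] h1 h2; rewrite /bint addrACA -mulrDr.
have am' := bcont_v ab h1; have mb' := bcont_v ab h2.
rewrite -(cintD (bcont_h am h1) (bcont_h mb h2)); congr (_ + 'i%C * _).
- by apply: eq_cint => t _; rewrite subrKA.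
- apply: cint_split; first by rewrite am.
  move=> t /andP[ta tb]; have [tm|/ltW tm] := leP t m; [apply: am'|apply: mb']; exact/andP.
Qed.

(** Subtracting the tangent affine function does not change the integral
    ([bint_affine]), and what is left is at most [e] times the size of the
    rectangle, on a boundary whose length is of that size. *)
Lemma bint_small a b c d f z D e : a <= b -> c <= d -> rect a b c d z ->
  0 <= e -> bcont a b c d f ->
  (forall w, bdry a b c d w -> normc (f w - f z - D * (w - z)) <= e * normc (w - z)) ->
  normc (bint a b c d f) <= 4 * e * ((b - a) + (d - c)) ^+ 2.
Proof.
move=> ab cd [/andP[za zb] /andP[zc zd]] e0 hf H.
have haff : bcont a b c d (fun w => - (f z - D * z) + - D * w).
  move=> w _.
  apply: (@continuousD R[i] C C (fun=> - (f z - D * z)) (fun w => - D * w) w).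
    exact: cst_continuous.
  by apply: (@continuousM R[i] C (fun=> - D) (fun w => w) w) => //; exact: cst_continuous.
have -> : bint a b c d f =
    bint a b c d (fun w => f w + (- (f z - D * z) + - D * w)).
  by rewrite (bintD ab cd hf haff) bint_affine// addr0.
have -> : 4 * e * ((b - a) + (d - c)) ^+ 2 =
    4 * ((b - a) + (d - c)) * (e * ((b - a) + (d - c))) by ring.
apply: bint_le; [exact: ab|exact: cd| |].
  move=> w wb; apply: (@continuousD R[i] C C f (fun w => - (f z - D * z) + - D * w) w);
  [exact: hf|exact: haff].
move=> w wb.
have -> : f w + (- (f z - D * z) + - D * w) = f w - f z - D * (w - z) by ring.
apply: le_trans (H _ wb) _; rewrite ler_wpM2l//.
apply: le_trans (normc_le _) _; rewrite !ReD !ImD !ReN !ImN.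
case: wb => -[/andP[wa wb] /andP[wc wd]] _.
by apply: lerD; rewrite ler_norml; apply/andP; split; lra.
Qed.

(** Successive bisections of a rectangle that fails [P] give nested rectangles
    that fail it, shrinking to a point. [P n x y] speaks of the rectangle of
    generation [n] with lower left corner [(x, y)]. *)
Lemma rect_bisection (u v x0 y0 : R) (P : nat -> R -> R -> Prop) : 0 <= u -> 0 <= v ->
  (forall n x y, let u' := u / 2 ^+ n.+1 in let v' := v / 2 ^+ n.+1 in
     P n.+1 x y -> P n.+1 (x + u') y -> P n.+1 x (y + v') -> P n.+1 (x + u') (y + v') ->
     P n x y) ->
  ~ P 0%N x0 y0 ->
  exists X Y, forall n, exists x y,
    [/\ ~ P n x y, x <= X <= x + u / 2 ^+ n, y <= Y <= y + v / 2 ^+ n,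
        x0 <= x /\ x + u / 2 ^+ n <= x0 + u & y0 <= y /\ y + v / 2 ^+ n <= y0 + v].
Proof.
move=> u0 v0 H P0.
have step n (p : R * R) : {q : R * R | ~ P n p.1 p.2 ->
   [/\ ~ P n.+1 q.1 q.2, p.1 <= q.1 <= p.1 + u / 2 ^+ n.+1 & p.2 <= q.2 <= p.2 + v / 2 ^+ n.+1]}.
  apply: cid; have [Pn|nPn] := pselect (P n p.1 p.2); first by exists p => /(_ Pn).
  have hu : 0 <= u / 2 ^+ n.+1 by rewrite divr_ge0// exprn_ge0.
  have hv : 0 <= v / 2 ^+ n.+1 by rewrite divr_ge0// exprn_ge0.
  have : exists q : R * R, [/\ ~ P n.+1 q.1 q.2,
      (q.1 = p.1 \/ q.1 = p.1 + u / 2 ^+ n.+1) & (q.2 = p.2 \/ q.2 = p.2 + v / 2 ^+ n.+1)].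
    apply: contrapT => /forallNP K; apply: nPn; apply: H; apply: contrapT => N.
    - by apply: (K (p.1, p.2)); split=> //=; auto.
    - by apply: (K (p.1 + u / 2 ^+ n.+1, p.2)); split=> //=; auto.
    - by apply: (K (p.1, p.2 + v / 2 ^+ n.+1)); split=> //=; auto.
    - by apply: (K (p.1 + u / 2 ^+ n.+1, p.2 + v / 2 ^+ n.+1)); split=> //=; auto.
  case=> q [nq q1 q2]; exists q => _; split=> //.
  - by case: q1 => ->; rewrite ?lexx ?lerDl hu.
  - by case: q2 => ->; rewrite ?lexx ?lerDl hv.
pose s := fix s n := if n is m.+1 then sval (step m (s m)) else (x0, y0).
have sP n : ~ P n (s n).1 (s n).2.
  by elim: n => [//|n IH] /=; case: (step n (s n)) => q /= /(_ IH)[].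
have half n (t : R) : t / 2 ^+ n = t / 2 ^+ n.+1 + t / 2 ^+ n.+1.
  by rewrite exprS invfM; lra.
have s1 n : (s n).1 <= (s n.+1).1 <= (s n).1 + u / 2 ^+ n.+1.
  by rewrite /=; case: (step n (s n)) => q /= /(_ (sP n))[].
have s2 n : (s n).2 <= (s n.+1).2 <= (s n).2 + v / 2 ^+ n.+1.
  by rewrite /=; case: (step n (s n)) => q /= /(_ (sP n))[].
have key (a : nat -> R) t : 0 <= t -> (forall n, a n <= a n.+1 <= a n + t / 2 ^+ n.+1) ->
    exists A, forall n, [/\ a n <= A <= a n + t / 2 ^+ n,
      a 0%N <= a n & a n + t / 2 ^+ n <= a 0%N + t].
  move=> t0 ha.
  have mono n m : (n <= m)%N -> a n <= a m /\ a m + t / 2 ^+ m <= a n + t / 2 ^+ n.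
    elim: m => [|m IH]; first by rewrite leqn0 => /eqP ->.
    rewrite leq_eqVlt ltnS => /orP[/eqP ->//|/IH [h1 h2]].
    have /andP[h3 h4] := ha m; split; first exact: le_trans h3.
    by apply: le_trans h2; rewrite (half m); lra.
  have tn n : 0 <= t / 2 ^+ n by rewrite divr_ge0// exprn_ge0.
  have ub n m : a m <= a n + t / 2 ^+ n.
    have [/mono[_ h]|/ltnW /mono[h _]] := leqP n m.
    - by apply: le_trans h; rewrite lerDl.
    - by apply: le_trans h _; rewrite lerDl.
  exists (sup (range a)) => n; have [h1 h2] := mono 0%N n (leq0n n).
  split; [apply/andP; split| |].
  - apply: ub_le_sup; last by exists n.
    by exists (a 0%N + t / 2 ^+ 0) => _ [m _ <-]; exact: ub.
  - apply: ge_sup; first by exists (a 0%N), 0%N.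
    by move=> _ [m _ <-]; exact: ub.
  - exact: h1.
  - by rewrite expr0 divr1 in h2.
have [X HX] := key (fun n => (s n).1) u u0 s1.
have [Y HY] := key (fun n => (s n).2) v v0 s2.
exists X, Y => n; exists (s n).1, (s n).2; have [? ? ?] := HX n; have [? ? ?] := HY n.
by split.
Qed.

(** If the integral were not small, one of the four quarters of each bad
    rectangle would be bad, where the threshold is proportional to the square of
    the perimeter because that quantity is divided by [4] at each step;
    differentiability at the common point of the bad rectangles contradicts
    this through [bint_small]. *)
Theorem goursat a b c d f : a <= b -> c <= d ->
  (forall z, rect a b c d z -> cdiff f z) ->
  bint a b c d f = 0.
Proof.
move=> ab cd df.
have cf a' b' c' d' : a <= a' -> b' <= b -> c <= c' -> d' <= d -> bcont a' b' c' d' f.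
  move=> h1 h2 h3 h4 z [[/andP[z1 z2] /andP[z3 z4]] _].
  apply: cdiff_continuous; apply: df; split; apply/andP; split.
  - exact: le_trans z1.
  - exact: le_trans h2.
  - exact: le_trans z3.
  - exact: le_trans h4.
apply: Normc.eq0_normc; apply/eqP; rewrite eq_le normc_ge0 andbT.
set u := b - a; set v := d - c.
have u0 : 0 <= u by rewrite subr_ge0.
have v0 : 0 <= v by rewrite subr_ge0.
apply/ler_addgt0Pr => e0 e0_gt0; rewrite add0r.
set e := e0 / (4 * (u + v) ^+ 2 + 1).
have Kp : 0 < 4 * (u + v) ^+ 2 + 1 by rewrite ltr_wpDl// mulr_ge0// sqr_ge0.
have ep : 0 < e by rewrite divr_gt0.
(* The guards keep the subrectangle inside the domain where [f] is
   differentiable; bisection respects them. *)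
pose P n x y := (a <= x /\ x + u / 2 ^+ n <= b) -> (c <= y /\ y + v / 2 ^+ n <= d) ->
   normc (bint x (x + u / 2 ^+ n) y (y + v / 2 ^+ n) f) <= 4 * e * (u / 2 ^+ n + v / 2 ^+ n) ^+ 2.
suff : P 0%N a c.
  rewrite /P !expr0 !divr1 /u /v !subrKC !lexx => /(_ (conj isT isT) (conj isT isT)) h.
  apply: le_trans h _; rewrite -/u -/v.
  have -> : 4 * e * (u + v) ^+ 2 = e0 * (4 * (u + v) ^+ 2) / (4 * (u + v) ^+ 2 + 1).
    by rewrite /e; ring.
  by rewrite ler_pdivrMr// ler_pM2l// lerDl.
apply: contrapT => nP.
have [n x y /=|X [Y H]] := rect_bisection u0 v0 _ nP.
  set u' := u / 2 ^+ n.+1; set v' := v / 2 ^+ n.+1.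
  have hu : u / 2 ^+ n = u' + u' by rewrite /u' exprS invfM; lra.
  have hv : v / 2 ^+ n = v' + v' by rewrite /v' exprS invfM; lra.
  have u'0 : 0 <= u' by rewrite divr_ge0// exprn_ge0.
  have v'0 : 0 <= v' by rewrite divr_ge0// exprn_ge0.
  rewrite /P -/u' -/v' hu hv !addrA => P1 P2 P3 P4 [ax xb] [cy yd].
  have x1 : x <= x + u' by rewrite lerDl.
  have x2 : x + u' <= x + u' + u' by rewrite lerDl.
  have y1 : y <= y + v' by rewrite lerDl.
  have y2 : y + v' <= y + v' + v' by rewrite lerDl.
  have ax2 := le_trans ax x1; have cy2 := le_trans cy y1.
  have x2b := le_trans x2 xb; have y2d := le_trans y2 yd.
  rewrite (@bint_splitx _ (x + u')); first last.
  - exact: cf.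
  - exact: cf.
  - by rewrite x1.
  - exact: le_trans y2.
  rewrite (@bint_splity x (x + u') y (y + v')); first last.
  - exact: cf.
  - exact: cf.
  - by rewrite y1.
  - exact: x1.
  rewrite (@bint_splity (x + u') _ y (y + v')); first last.
  - exact: cf.
  - exact: cf.
  - by rewrite y1.
  - exact: x2.
  apply: le_trans (normcD _ _) _.
  apply: le_trans (lerD (normcD _ _) (normcD _ _)) _.
  apply: le_trans (lerD
    (lerD (P1 (conj ax x2b) (conj cy y2d)) (P3 (conj ax x2b) (conj cy2 yd)))
    (lerD (P2 (conj ax2 xb) (conj cy y2d)) (P4 (conj ax2 xb) (conj cy2 yd)))) _.
  rewrite le_eqVlt; apply/orP; left; apply/eqP; ring.
have Xr : rect a b c d (X +i* Y)%C.
  have [x [y [_ /andP[x1 x2] /andP[y1 y2] [x3 x4] [y3 y4]]]] := H 0%N.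
  split; apply/andP; split=> /=.
  - exact: le_trans x1.
  - by apply: le_trans x2 (le_trans x4 _); rewrite subrKC.
  - exact: le_trans y1.
  - by apply: le_trans y2 (le_trans y4 _); rewrite subrKC.
have /cdiffP[D /(_ _ ep)[r r0 hr]] := df _ Xr.
have [n hn] : exists n, (u + v) / 2 ^+ n < r.
  have := @cvg_geometric R (u + v) 2^-1; rewrite ger0_norm// => /(_ ltac:(lra)) /cvgrPdist_lt /(_ r r0)[n _ /(_ n (leqnn n))] /=; rewrite sub0r normrN => K; exists n.
  by apply: le_lt_trans K; rewrite /geometric /= exprVn; exact: ler_norm.
have [x [y [nPn /andP[x1 x2] /andP[y1 y2] [x3 x4] [y3 y4]]]] := H n.
have un : 0 <= u / 2 ^+ n by rewrite divr_ge0// exprn_ge0.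
have vn : 0 <= v / 2 ^+ n by rewrite divr_ge0// exprn_ge0.
have xb : x + u / 2 ^+ n <= b by apply: le_trans x4 _; rewrite subrKC.
have yd : y + v / 2 ^+ n <= d by apply: le_trans y4 _; rewrite subrKC.
apply: nPn => _ _.
have -> : u / 2 ^+ n + v / 2 ^+ n = ((x + u / 2 ^+ n) - x) + ((y + v / 2 ^+ n) - y) by ring.
apply: (@bint_small _ _ _ _ _ (X +i* Y)%C D); [by rewrite lerDl|by rewrite lerDl| |exact: ltW|exact: cf|].
- by split; apply/andP; split=> /=; lra.
- move=> w [[/andP[w1 w2] /andP[w3 w4]] _]; apply: hr.
  apply: le_lt_trans (normc_le _) _; rewrite !ReD !ImD !ReN !ImN /=.
  apply: le_lt_trans hn; rewrite mulrDl.
  by apply: lerD; rewrite ler_norml; apply/andP; split; lra.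
Qed.

End Cauchy.
(** * Cauchy's integral formula on rectangles *)

Section CauchyFormula.
Variable R : realType.
Local Notation C := (R[i]^o).
Implicit Types (z w s : R[i]) (f g : R[i] -> R[i]) (u v : R -> R[i]).

Lemma cdiffM f g z : cdiff f z -> cdiff g z ->
  cdiff (fun w : R[i] => f w * g w) z.
Proof. exact: (@derivableM R[i] C f g z 1). Qed.

Lemma cdiffV f z : f z != 0 -> cdiff f z ->
  cdiff (fun w : R[i] => (f w)^-1) z.
Proof. exact: (@derivableV R[i] C f z 1). Qed.

Lemma cdiffB f (c : R[i]) z : cdiff f z ->
  cdiff (fun w : R[i] => f w - c) z.
Proof. by move=> h; apply: (@derivableB R[i] C C f (fun=> c) z 1 h); exact: derivable_cst. Qed.

Lemma cdiff_subc s z : cdiff (fun w : R[i] => w - s) z.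
Proof. by exact: (@cdiffB (fun w => w) s z (@derivable_id R[i] C z 1)). Qed.

(** Differentiability is local. *)
Lemma near_cdiff f g z (r : R) : 0 < r -> (forall w, normc (w - z) < r -> f w = g w) ->
  cdiff f z -> cdiff g z.
Proof.
move=> r0 fg /cdiffP[D H]; apply/cdiffP; exists D => e e0.
have [r' r'0 K] := H e e0.
exists (Num.min r r'); first by rewrite lt_min r0.
move=> w; rewrite lt_min => /andP[w1 w2]; rewrite -!fg ?K//.
by rewrite subrr Normc.normc0.
Qed.

(** A bounded isolated singularity does not contribute: two vertical and two
    horizontal cuts isolate [s] in a small square, Goursat's theorem disposes of
    the other pieces, and the integral around the square is at most a multiple
    of its side. *)
Lemma bint_puncture a b c d s g B r :
  a < Re s < b -> c < Im s < d -> 0 < r ->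
  (forall z, rect a b c d z -> z != s -> cdiff g z) ->
  (forall z, normc (z - s) < r -> z != s -> normc (g z) <= B) ->
  bint a b c d g = 0.
Proof.
case: s => x y /= /andP[ax xb] /andP[cy yd] r0 dg gB.
apply: Normc.eq0_normc; apply/eqP; rewrite eq_le normc_ge0 andbT.
apply/ler_addgt0Pr => e e0; rewrite add0r.
pose B' := Num.max B 1.
have B'0 : 0 < B' by rewrite lt_max ltr01 orbT.
(* Half the side of the small square: it has to fit in the rectangle and in
   the disc where [g] is bounded, and [16 t B'] bounds the integral around it. *)
pose t := Num.min (Num.min (Num.min (x - a) (b - x)) (Num.min (y - c) (d - y)))
   (Num.min (r / 4) (e / (16 * B'))).
have t0 : 0 < t.
  by rewrite !lt_min !subr_gt0 ax xb cy yd divr_gt0//= divr_gt0// mulr_gt0.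
have : t <= t by [].
rewrite {2}/t !le_min -!andbA => /and5P[t1 t2 t3 t4 /andP[t5 t6]].
have tt : 0 < t + t by rewrite addr_gt0.
rewrite lerBrDr in t1; rewrite lerBrDl in t2; rewrite lerBrDr in t3; rewrite lerBrDl in t4.
rewrite addrC -lerBrDr in t1; rewrite addrC -lerBrDr in t3; rewrite addrC in t2; rewrite addrC in t4.
rewrite addrC in t2; rewrite addrC in t4.
have cg a' b' c' d' : a <= a' -> b' <= b -> c <= c' -> d' <= d ->
    ~ bdry a' b' c' d' (x +i* y)%C -> bcont a' b' c' d' g.
  move=> h1 h2 h3 h4 ns z zb; have [[/andP[z1 z2] /andP[z3 z4]] _] := zb.
  apply: cdiff_continuous; apply: dg; first (split; apply/andP; split).
  - exact: le_trans z1.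
  - exact: le_trans h2.
  - exact: le_trans z3.
  - exact: le_trans h4.
  - by apply: contra_notN ns => /eqP <-.
have gz a' b' c' d' : a' <= b' -> c' <= d' -> a <= a' -> b' <= b -> c <= c' -> d' <= d ->
    ~ rect a' b' c' d' (x +i* y)%C -> bint a' b' c' d' g = 0.
  move=> ab cd h1 h2 h3 h4 ns; apply: goursat => // z zb; have [/andP[z1 z2] /andP[z3 z4]] := zb.
  apply: dg; first (split; apply/andP; split).
  - exact: le_trans z1.
  - exact: le_trans h2.
  - exact: le_trans z3.
  - exact: le_trans h4.
  - by apply: contra_notN ns => /eqP <-.
have xl : x - t < x by rewrite ltrBlDr ltrDl.
have xr : x < x + t by rewrite ltrDl.
have yl : y - t < y by rewrite ltrBlDr ltrDl.
have yr : y < y + t by rewrite ltrDl.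
have nb a' b' c' d' : x != a' -> x != b' -> y != c' -> y != d' -> ~ bdry a' b' c' d' (x +i* y)%C.
  by move=> /eqP h1 /eqP h2 /eqP h3 /eqP h4 [_ [|||]].
have xxr := lt_trans xl xr; have yyr := lt_trans yl yr.
have cyd := lt_trans cy yd.
have xlb := lt_trans xl xb; have axr := lt_trans ax xr.
have ylb := lt_trans yl yd; have cyr := lt_trans cy yr.
rewrite (@bint_splitx _ a (x - t)); first last.
- by apply: cg => //; apply: nb; rewrite ?(gt_eqF xl) ?(lt_eqF xb) ?(gt_eqF cy) ?(lt_eqF yd).
- by apply: cg => //; [exact: ltW|]; apply: nb; rewrite ?(gt_eqF ax) ?(gt_eqF xl) ?(gt_eqF cy) ?(lt_eqF yd).
- by rewrite t1 ltW.
- exact: ltW.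
rewrite (@bint_splitx _ (x - t) (x + t)); first last.
- by apply: cg => //; [exact/ltW|]; apply: nb; rewrite ?(lt_eqF xr) ?(lt_eqF xb) ?(gt_eqF cy) ?(lt_eqF yd).
- by apply: cg => //; apply: nb; rewrite ?(gt_eqF xl) ?(lt_eqF xr) ?(gt_eqF cy) ?(lt_eqF yd).
- by rewrite t2 ltW.
- exact: ltW.
rewrite (gz a) ?(ltW xlb) ?(ltW cyd)//; last by case=> /= /andP[_]; rewrite leNgt xl.
rewrite (gz (x + t)) ?(ltW axr) ?(ltW cyd)//; last by case=> /= /andP[]; rewrite leNgt xr.
rewrite (@bint_splity _ _ _ c (y - t)); first last.
- by apply: cg => //; apply: nb; rewrite ?(gt_eqF xl) ?(lt_eqF xr) ?(gt_eqF yl) ?(lt_eqF yd).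
- by apply: cg => //; [exact: ltW|]; apply: nb; rewrite ?(gt_eqF xl) ?(lt_eqF xr) ?(gt_eqF cy) ?(gt_eqF yl).
- by rewrite t3 ltW.
- exact: ltW.
rewrite (@bint_splity _ _ _ (y - t) (y + t)); first last.
- by apply: cg => //; [exact: ltW|]; apply: nb; rewrite ?(gt_eqF xl) ?(lt_eqF xr) ?(lt_eqF yr) ?(lt_eqF yd).
- by apply: cg => //; apply: nb; rewrite ?(gt_eqF xl) ?(lt_eqF xr) ?(gt_eqF yl) ?(lt_eqF yr).
- by rewrite t4 ltW.
- exact: ltW.
rewrite (gz _ _ c) ?(ltW xxr) ?(ltW ylb)//; last by case=> /= _ /andP[_]; rewrite leNgt yl.
rewrite (gz _ _ (y + t)) ?(ltW xxr) ?(ltW cyr)//; last by case=> /= _ /andP[]; rewrite leNgt yr.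
rewrite !add0r !addr0.
apply: le_trans (@bint_le _ _ _ _ _ (ltW xxr) (ltW yyr) g B' _ _) _.
- by apply: cg => //; apply: nb; rewrite ?(gt_eqF xl) ?(lt_eqF xr) ?(gt_eqF yl) ?(lt_eqF yr).
- move=> z zb; rewrite le_max; apply/orP; left; apply: gB.
    have [[/andP[z1 z2] /andP[z3 z4]] _] := zb.
    apply: le_lt_trans (normc_le _) _; rewrite !ReD !ImD !ReN !ImN /=.
    have h1 : `|Re z - x| <= t by rewrite ler_norml; apply/andP; split; lra.
    have h2 : `|Im z - y| <= t by rewrite ler_norml; apply/andP; split; lra.
    by apply: le_lt_trans (lerD h1 h2) _; lra.
  apply/eqP => zE; move: zb; rewrite zE; apply: nb;
  by rewrite ?(gt_eqF xl) ?(lt_eqF xr) ?(gt_eqF yl) ?(lt_eqF yr).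
- move: t6; rewrite ler_pdivlMr ?mulr_gt0// => t6; apply: le_trans t6.
  by rewrite le_eqVlt; apply/orP; left; apply/eqP; ring.
Qed.

Lemma cdiff_quotient f s z : z != s -> cdiff f z ->
  cdiff (fun w : R[i] => f w * (w - s)^-1) z.
Proof.
move=> zs df; apply: (@cdiffM f (fun w => (w - s)^-1) z df).
have h : z - s != 0 by rewrite subr_eq0.
exact: (@cdiffV (fun w => w - s) z h (@cdiff_subc s z)).
Qed.

(** Equal to [2 pi i] when [s] is inside, but left as it is: every use of
    Cauchy's formula divides by it, and a lower bound on its norm is enough. *)
Definition ckernel a b c d s : R[i] := bint a b c d (fun z => (z - s)^-1).

Lemma bdry_interior a b c d s z : a < Re s < b -> c < Im s < d -> bdry a b c d z -> z != s.
Proof.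
move=> /andP[h1 h2] /andP[h3 h4] [_ H]; apply/eqP => zs; move: H; rewrite zs.
by case=> h; move: h1 h2 h3 h4; rewrite h ltxx.
Qed.

(** The difference quotient [(f z - f s) / (z - s)] is analytic off [s] and
    bounded near [s], so its integral vanishes ([bint_puncture]). *)
Theorem cauchy_formula a b c d f s : a < Re s < b -> c < Im s < d ->
  (forall z, rect a b c d z -> cdiff f z) ->
  bint a b c d (fun z => f z * (z - s)^-1) = f s * ckernel a b c d s.
Proof.
move=> hs1 hs2 df.
have /andP[s1 s2] := hs1; have /andP[s3 s4] := hs2.
have ab := ltW (lt_trans s1 s2); have cd := ltW (lt_trans s3 s4).
have rs : rect a b c d s by split; rewrite !ltW.
have [D /(_ 1 ltr01)[r r0 H]] := (cdiffP f s).1 (df _ rs).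
have c1 : bcont a b c d (fun z => f z * (z - s)^-1).
  move=> z zb; apply: cdiff_continuous.
  have h : z != s by exact: bdry_interior zb.
  exact: (@cdiff_quotient f s z h (df _ zb.1)).
have c2 : bcont a b c d (fun z => (z - s)^-1).
  move=> z zb; apply: cdiff_continuous.
  have h : z - s != 0 by rewrite subr_eq0; exact: bdry_interior zb.
  exact: (@cdiffV (fun w => w - s) z h (@cdiff_subc s z)).
have c3 : bcont a b c d (fun z => - f s * (z - s)^-1).
  move=> z zb; apply: (@continuousM R[i] C (fun=> - f s) (fun z => (z - s)^-1) z).
    exact: cst_continuous.
  exact: (c2 _ zb).
apply/eqP; rewrite -subr_eq0 -mulNr -(bintZ ab cd _ c2) -(bintD ab cd c1 c3); apply/eqP.
rewrite (@eq_bint _ _ _ _ _ ab cd _ (fun z => (f z - f s) * (z - s)^-1)); last first.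
  by move=> z _; rewrite mulrBl mulNr.
apply: (@bint_puncture _ _ _ _ s _ (normc D + 1) r) => //.
- move=> z rz zs; apply: (@cdiff_quotient (fun w => f w - f s) s z zs).
  exact: (@cdiffB f (f s) z (df _ rz)).
- move=> z zr zs; have n0 : 0 < normc (z - s) by rewrite normc_gt0 subr_eq0.
  rewrite Normc.normcM Normc.normcV ler_pdivrMr// mulrDl mul1r -Normc.normcM.
  rewrite -{1}[f z - f s](subrK (D * (z - s))).
  apply: le_trans (normcD _ _) _; rewrite addrC lerD2l.
  by have := H z zr; rewrite mul1r.
Qed.

End CauchyFormula.
(** * Locally uniform limits of analytic functions *)

Section Weierstrass.
Variable R : realType.
Local Notation C := (R[i]^o).
Implicit Types (z w s : R[i]) (f g : R[i] -> R[i]) (u v : R -> R[i]).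

Lemma rint_cst (a b k : R) : a <= b -> rint a b (fun=> k) = (b - a) * k.
Proof.
move=> ab; rewrite /rint Rintegral_cst//= lebesgue_measure_itv /= lte_fin.
by case: ltgtP ab => // [ab|->] _; rewrite -?EFinB/= ?subrr ?mul0r ?mulr0// mulrC.
Qed.

Lemma rint_le (a b : R) (h k : R -> R) : rsegc a b h -> rsegc a b k ->
  (forall t, a <= t <= b -> h t <= k t) -> rint a b h <= rint a b k.
Proof.
move=> hc kc hk; apply: le_Rintegral => //; exact: itv_integrable.
Qed.

Lemma rint_ge (a b : R) (h : R -> R) k : a <= b -> rsegc a b h ->
  (forall t, a <= t <= b -> k <= h t) -> (b - a) * k <= rint a b h.
Proof.
move=> ab hc hk; rewrite -rint_cst//; apply: rint_le => // t _; exact: cst_continuous.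
Qed.

Lemma Re_invc (x y : R) : Re ((x +i* y)%C^-1) = x / (x ^+ 2 + y ^+ 2).
Proof. by []. Qed.

Lemma Im_invc (x y : R) : Im ((x +i* y)%C^-1) = - (y / (x ^+ 2 + y ^+ 2)).
Proof. by []. Qed.

Section Kernel.
Variables (a b c d : R) (s : R[i]).
Hypotheses (hs1 : a < Re s < b) (hs2 : c < Im s < d).

Let ab : a <= b. Proof. by case/andP: hs1 => h1 h2; exact: ltW (lt_trans h1 h2). Qed.
Let cd : c <= d. Proof. by case/andP: hs2 => h1 h2; exact: ltW (lt_trans h1 h2). Qed.

Lemma bcont_inv : bcont a b c d (fun z => (z - s)^-1).
Proof.
move=> z zb; apply: cdiff_continuous.
have h : z - s != 0 by rewrite subr_eq0; exact: bdry_interior zb.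
exact: (@cdiffV R (fun w => w - s) z h (@cdiff_subc R s z)).
Qed.

(** The imaginary part is an integral of nonnegative functions on each of the four
    sides. Only the right side between heights [Im s - t] and [Im s + t] is kept,
    where the integrand [(b - Re s) / |z - s|^2] is smallest at the ends. *)
Lemma ckernel_ge (t : R) : 0 < t -> c <= Im s - t -> Im s + t <= d ->
  2 * t * ((b - Re s) / ((b - Re s) ^+ 2 + t ^+ 2)) <= normc (ckernel a b c d s).
Proof.
move=> t0 ct td; apply: le_trans (Im_le_normc _); apply: le_trans (ler_norm _).
have H1 := hs1; have H2 := hs2; move: ct td.
set x := Re s in H1 *; set y := Im s in H2 * => ct td.
have sE : s = (x +i* y)%C by apply: ceqP.
have bc := bcont_inv; rewrite sE in bc *; clearbody x y.
move: H1 H2 => /andP[ax xb] /andP[cy yd].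
have hc := bcont_h cd bc; have vc := bcont_v ab bc.
rewrite /ckernel /bint ImD ImM.
have -> : Re ('i%C : R[i]) = 0 by [].
have -> : Im ('i%C : R[i]) = 1 by [].
rewrite mul0r mul1r add0r -[leLHS]add0r.
apply: lerD.
  rewrite -(mulr0 (b - a)); apply: (rint_ge ab (segc_Im hc)) => r _.
  have h0 (e : R) : 0 <= (r + - x) ^+ 2 + e ^+ 2 by rewrite addr_ge0// sqr_ge0.
  rewrite ImD ImN !Im_invc opprK; apply: addr_ge0.
    by rewrite oppr_ge0 mulr_le0_ge0 ?invr_ge0//; lra.
  by rewrite divr_ge0//; lra.
have pos r : 0 <= Re (((b +i* r)%C - (x +i* y)%C)^-1 - ((a +i* r)%C - (x +i* y)%C)^-1).
  rewrite ReD ReN !Re_invc.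
  have h0 (e : R) : 0 <= e ^+ 2 + (r + - y) ^+ 2 by rewrite addr_ge0// sqr_ge0.
  apply: addr_ge0; first by rewrite divr_ge0//; lra.
  by rewrite oppr_ge0 mulr_le0_ge0 ?invr_ge0//; lra.
have c1 : c <= y - t by [].
rewrite (@cint_split _ c (y - t) d); [|by rewrite ct/=; lra|exact: vc].
have vc2 : segc (y - t) d (fun y0 => ((b +i* y0)%C - (x +i* y)%C)^-1 - ((a +i* y0)%C - (x +i* y)%C)^-1).
  by move=> r /andP[r1 r2]; apply: vc; rewrite r2 (le_trans ct r1).
rewrite (@cint_split _ (y - t) (y + t) d); [|by rewrite td andbT; lra|exact: vc2].
rewrite !ReD -[leLHS]add0r; apply: lerD.
  rewrite -(mulr0 (y - t - c)); apply: (rint_ge ct); last by move=> r _; exact: pos.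
  by apply: segc_Re => r /andP[r1 r2]; apply: vc; rewrite r1 /=; lra.
rewrite -[leLHS]addr0; apply: lerD; last first.
  rewrite -(mulr0 (d - (y + t))); apply: (rint_ge td); last by move=> r _; exact: pos.
  by apply: segc_Re => r /andP[r1 r2]; apply: vc2; rewrite r2 andbT; lra.
have -> : 2 * t = (y + t) - (y - t) by ring.
apply: rint_ge; first lra.
  by apply: segc_Re => r /andP[r1 r2]; apply: vc; lra.
move=> r /andP[r1 r2]; rewrite ReD ReN !Re_invc -[leLHS]addr0; apply: lerD; last first.
  by rewrite oppr_ge0 mulr_le0_ge0 ?invr_ge0 ?addr_ge0 ?sqr_ge0//; lra.
rewrite ler_pM2l ?subr_gt0// lef_pV2 ?posrE ?ltr_wpDr ?sqr_ge0 ?exprn_gt0 ?subr_gt0//.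
rewrite lerD2l; have : `|r - y| <= t by rewrite ler_norml; apply/andP; split; lra.
by move=> h; rewrite -[leLHS]real_normK ?num_real// ler_pXn2r// nnegrE// ltW.
Qed.

Lemma ckernel_neq0 : ckernel a b c d s != 0.
Proof.
have /andP[ax xb] := hs1; have /andP[cy yd] := hs2.
pose t := Num.min (Im s - c) (d - Im s).
have t0 : 0 < t by rewrite lt_min !subr_gt0 cy yd.
have : t <= t by []. rewrite {2}/t le_min => /andP[t1 t2].
rewrite -normc_gt0; apply: lt_le_trans (@ckernel_ge t t0 _ _); [|lra|lra].
by rewrite !(mulr_gt0, invr_gt0)// ?subr_gt0// ltr_wpDl ?sqr_ge0// exprn_gt0.
Qed.

Lemma bdry_dist : exists2 r : R, 0 < r & forall z, bdry a b c d z -> r <= normc (z - s).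
Proof.
have /andP[ax xb] := hs1; have /andP[cy yd] := hs2.
exists (Num.min (Num.min (Re s - a) (b - Re s)) (Num.min (Im s - c) (d - Im s))).
  by rewrite !lt_min !subr_gt0 ax xb cy yd.
move=> z [_]; rewrite !ge_min -!orbA => -[] zE; apply/or4P.
- apply: Or41; rewrite -zE -opprB -ReN -ReD (le_trans _ (Re_le_normc _))//.
  by rewrite -normrN ler_norm.
- by apply: Or42; rewrite -zE -ReN -ReD (le_trans _ (Re_le_normc _))// ler_norm.
- apply: Or43; rewrite -zE -opprB -ImN -ImD (le_trans _ (Im_le_normc _))//.
  by rewrite -normrN ler_norm.
- by apply: Or44; rewrite -zE -ImN -ImD (le_trans _ (Im_le_normc _))// ler_norm.
Qed.

Lemma bcontM f g : bcont a b c d f -> bcont a b c d g -> bcont a b c d (fun z => f z * g z).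
Proof. by move=> hf hg z zb; exact: (@continuousM R[i] C f g z (hf z zb) (hg z zb)). Qed.

Lemma bcontB f g : bcont a b c d f -> bcont a b c d g -> bcont a b c d (fun z => f z - g z).
Proof. by move=> hf hg z zb; exact: (@continuousB R[i] C C f g z (hf z zb) (hg z zb)). Qed.

Lemma bcontZ k f : bcont a b c d f -> bcont a b c d (fun z => k * f z).
Proof. by move=> hf; apply: (@bcontM (fun=> k) f _ hf) => z _; exact: cst_continuous. Qed.

End Kernel.

Lemma bintB a b c d f g : a <= b -> c <= d -> bcont a b c d f -> bcont a b c d g ->
  bint a b c d (fun z => f z - g z) = bint a b c d f - bint a b c d g.
Proof.
move=> ab cd hf hg; rewrite -mulN1r -(bintZ ab cd (-1) hg).
rewrite -(bintD ab cd hf (bcontZ (k := -1) hg)).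
by apply: eq_bint => // z _; rewrite mulN1r.
Qed.

Lemma seg_bounded (a b : R) u : a <= b -> segc a b u ->
  exists B : R, forall t, a <= t <= b -> normc (u t) <= B.
Proof.
move=> ab hu.
have [|t0 _ H] := @EVT_max R (fun t => normc (u t)) a b ab.
  apply: within_segc => t tab; apply: (@continuous_comp R C R u normc t); first exact: hu.
  exact: normc_continuous.
by exists (normc (u t0)) => t tab; apply: H; rewrite in_itv.
Qed.

Lemma bdry_bounded a b c d f : a <= b -> c <= d -> bcont a b c d f ->
  exists2 B : R, 0 <= B & forall z, bdry a b c d z -> normc (f z) <= B.
Proof.
move=> ab cd hf.
have [B1 h1] := seg_bounded ab (bcont_h1 cd hf).
have [B2 h2] := seg_bounded ab (bcont_h2 cd hf).
have [B3 h3] := seg_bounded cd (bcont_v1 ab hf).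
have [B4 h4] := seg_bounded cd (bcont_v2 ab hf).
exists (Num.max (Num.max 0 (Num.max B1 B2)) (Num.max B3 B4)); first by rewrite !le_max lexx.
move=> [x y] [[/= hx hy] H]; rewrite !le_max.
case: H => E; rewrite E in hx hy *.
- by rewrite h3// !orbT.
- by rewrite h4// !orbT.
- by rewrite h1// !orbT.
- by rewrite h2// !orbT.
Qed.

(** The candidate for the derivative is the integral of [f z / (z - s)^2], and the
    remainder is [(w - s)^2] times the integral of
    [f z / ((z - s)^2 (z - w))], whose kernel is bounded as long as [w] stays away
    from the boundary. *)
Lemma cauchy_integral_cdiff a b c d f s : a < Re s < b -> c < Im s < d ->
  bcont a b c d f -> cdiff (fun w => bint a b c d (fun z => f z * (z - w)^-1)) s.
Proof.
move=> hs1 hs2 hf.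
have /andP[ax xb] := hs1; have /andP[cy yd] := hs2.
have ab := ltW (lt_trans ax xb); have cd := ltW (lt_trans cy yd).
have [B B0 hB] := bdry_bounded ab cd hf.
have [r r0 hr] := bdry_dist hs1 hs2.
have i1 := bcont_inv hs1 hs2.
have c0 := bcontM hf i1; have c1 := bcontM c0 i1.
apply/cdiffP; exists (bint a b c d (fun z => f z * (z - s)^-1 * (z - s)^-1)) => e e0.
pose L := 4 * ((b - a) + (d - c)).
have L0 : 0 <= L by rewrite mulr_ge0// addr_ge0// subr_ge0.
pose K := L * (B * (2 * r ^- 3)).
have K0 : 0 <= K.
  by do 3 apply: mulr_ge0 => //; rewrite invr_ge0 exprn_ge0// ltW.
have K1 : 0 < K + 1 by rewrite ltr_wpDl.
(* Closer to [s] than [t], the point [w] is still inside, and at distance at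
   least [r / 2] from the boundary. *)
pose t := Num.min (Num.min (Num.min (Re s - a) (b - Re s)) (Num.min (Im s - c) (d - Im s)))
   (Num.min (r / 2) (e / (K + 1))).
have t0 : 0 < t by rewrite !lt_min !subr_gt0 ax xb cy yd !divr_gt0.
exists t => // w; rewrite !lt_min -!andbA => /and5P[w1 w2 w3 w4 /andP[w5 w6]].
have dr := Re_le_normc (w - s); have di := Im_le_normc (w - s).
rewrite ReD ReN in dr; rewrite ImD ImN in di.
have hw1 : a < Re w < b.
  have := le_lt_trans dr w1; have := le_lt_trans dr w2.
  by rewrite !ltr_norml => /andP[? ?] /andP[? ?]; apply/andP; split; lra.
have hw2 : c < Im w < d.
  have := le_lt_trans di w3; have := le_lt_trans di w4.
  by rewrite !ltr_norml => /andP[? ?] /andP[? ?]; apply/andP; split; lra.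
have i2 := bcont_inv hw1 hw2.
have c2 := bcontM hf i2.
have E : bint a b c d (fun z => f z * (z - w)^-1) - bint a b c d (fun z => f z * (z - s)^-1) -
   bint a b c d (fun z => f z * (z - s)^-1 * (z - s)^-1) * (w - s) =
   bint a b c d (fun z => f z * ((w - s) ^+ 2 * ((z - s) ^- 2 * (z - w)^-1))).
  rewrite -(bintB ab cd c2 c0) [_ * (w - s)]mulrC -(bintZ ab cd (w - s) c1).
  rewrite -(bintB ab cd (bcontB c2 c0) (bcontZ (k := w - s) c1)).
  apply: eq_bint => // z zb.
  have n1 : z - s != 0 by rewrite subr_eq0; exact: bdry_interior zb.
  have n2 : z - w != 0 by rewrite subr_eq0; exact: bdry_interior zb.
  by field; rewrite n1 n2.
rewrite E.
apply: le_trans (@bint_le _ _ _ _ _ ab cd _ (B * (normc (w - s) ^+ 2 * (2 * r ^- 3))) _ _) _.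
- apply: (bcontM hf); apply: bcontZ.
  have -> : (fun z => (z - s) ^- 2 * (z - w)^-1) = (fun z => (z - s)^-1 * (z - s)^-1 * (z - w)^-1).
    by apply/funext => z; rewrite expr2 invfM.
  exact: (bcontM (bcontM i1 i1) i2).
- move=> z zb; rewrite Normc.normcM ler_pM ?normc_ge0//; first exact: hB.
  rewrite (Normc.normcM ((w - s) ^+ 2)) (Normc.normcM ((z - s) ^- 2)) normcX ler_wpM2l ?exprn_ge0 ?normc_ge0// !Normc.normcV normcX.
  have h1 := hr z zb.
  have h2 : r / 2 <= normc (z - w).
    have := normc_dist3 w z s; lra.
  have -> : 2 * r ^- 3 = r ^- 2 * (r / 2)^-1.
    by rewrite invf_div (exprSr r 2) invfM; ring.
  apply: ler_pM; rewrite ?invr_ge0 ?exprn_ge0 ?normc_ge0//.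
    by rewrite lef_pV2 ?posrE ?exprn_gt0// ?ler_pXn2r ?nnegrE ?normc_ge0 ?(ltW r0)// (lt_le_trans r0).
  by rewrite lef_pV2 ?posrE ?divr_gt0// (lt_le_trans _ h2)// divr_gt0.
- have -> : 4 * (b - a + (d - c)) * (B * (normc (w - s) ^+ 2 * (2 * r ^- 3))) =
    (K * normc (w - s)) * normc (w - s) by rewrite /K /L; ring.
  rewrite ler_wpM2r ?normc_ge0//; move: w6; rewrite ltr_pdivlMr// => /ltW; apply: le_trans.
  by rewrite mulrC ler_wpM2l ?normc_ge0// lerDl.
Qed.

Lemma cdiffD f g z : cdiff f z -> cdiff g z -> cdiff (fun w => f w + g w) z.
Proof. exact: (@derivableD R[i] C C f g z 1). Qed.

Lemma cdiff_cst k z : cdiff (fun=> k) z.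
Proof. exact: (@derivable_cst R[i] C C k z 1). Qed.

Lemma ccontP f z : {for (z : C), continuous (f : C -> C)} <->
  forall e : R, 0 < e -> exists2 r : R, 0 < r &
    forall w, normc (w - z) < r -> normc (f z - f w) <= e.
Proof.
split.
- move=> /(@cvgrPdist_le _ C _ (nbhs (z : C)) _) H e e0.
  have := H e%:C%C; rewrite ltcR => /(_ e0) /nbhsCP [r r0 K]; exists r => // w wr.
  by have := K w wr; rewrite /= normcE lecR.
- move=> H; apply/(@cvgrPdist_le _ C _ (nbhs (z : C)) _) => e.
  rewrite ltcE /= => /andP[/eqP ei er].
  have [r r0 K] := H _ er; apply/nbhsCP; exists r => // w wr.
  by rewrite /= normcE lecE /= -ei eqxx /=; exact: K.
Qed.

(** Cauchy's formula passes to the limit, so near [z0] the limit is the quotient of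
    two Cauchy integrals, each differentiable by [cauchy_integral_cdiff]. One index
    [n] per rectangle and per [e] is enough for both steps. *)
Theorem weierstrass (F : nat -> R[i] -> R[i]) f :
  (forall n z, 0 < Re z -> cdiff (F n) z) ->
  (forall a b c d, 0 < a -> forall e, 0 < e ->
     exists n, forall z, rect a b c d z -> normc (F n z - f z) <= e) ->
  forall z, 0 < Re z -> cdiff f z.
Proof.
move=> dF cF.
have cf z : 0 < Re z -> {for (z : C), continuous (f : C -> C)}.
  move=> z0; apply/ccontP => e e0.
  have e3 : 0 < e / 3 by rewrite divr_gt0.
  have z2 : 0 < Re z / 2 by rewrite divr_gt0.
  have [n hn] := cF (Re z / 2) (Re z + 1) (Im z - 1) (Im z + 1) z2 _ e3.
  have [r r0 H] := (ccontP (F n) z).1 (cdiff_continuous (dF n z z0)) _ e3.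
  exists (Num.min r (Num.min (Re z / 2) 1)); first by rewrite !lt_min r0 z2 ltr01.
  move=> w; rewrite !lt_min => /and3P[w1 w2 w3].
  have dr := Re_le_normc (w - z); have di := Im_le_normc (w - z).
  rewrite ReD ReN in dr; rewrite ImD ImN in di.
  have rw : rect (Re z / 2) (Re z + 1) (Im z - 1) (Im z + 1) w.
    have := le_lt_trans dr w2; have := le_lt_trans dr w3; have := le_lt_trans di w3.
    by rewrite !ltr_norml => /andP[? ?] /andP[? ?] /andP[? ?]; split; apply/andP; split; lra.
  have rz : rect (Re z / 2) (Re z + 1) (Im z - 1) (Im z + 1) z.
    by split; apply/andP; split; lra.
  have h1 := H w w1; have := hn _ rw; have := hn _ rz; rewrite normcB => h2 h3.
  apply: le_trans (normc_dist3 (F n z) _ _) _.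
  have := normc_dist3 (F n w) (F n z) (f w); lra.
move=> z0 z0p.
set a := Re z0 / 2; set b := Re z0 + 1; set c := Im z0 - 1; set d := Im z0 + 1.
have a0 : 0 < a by rewrite /a divr_gt0.
have h1 : a < Re z0 < b by rewrite /a /b; apply/andP; split; lra.
have h2 : c < Im z0 < d by rewrite /c /d; apply/andP; split; lra.
have ab : a <= b by case/andP: h1 => [? ?]; lra.
have cd : c <= d by case/andP: h2 => [? ?]; lra.
have pos z : rect a b c d z -> 0 < Re z by case=> /andP[h _] _; exact: lt_le_trans h.
have bf : bcont a b c d f by move=> z zb; apply: cf; exact: pos zb.1.
have key s : a < Re s < b -> c < Im s < d ->
    bint a b c d (fun z => f z * (z - s)^-1) = f s * ckernel a b c d s.
  move=> s1 s2; have i1 := bcont_inv s1 s2.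
  have [r r0 hr] := bdry_dist s1 s2.
  have rs : rect a b c d s by case/andP: s1 => ? ?; case/andP: s2 => ? ?; split; rewrite !ltW.
  apply/eqP; rewrite -subr_eq0 -normc_eq0 eq_le normc_ge0 andbT.
  apply/ler_addgt0Pr => e e0; rewrite add0r.
  pose L := 4 * ((b - a) + (d - c)).
  have L0 : 0 <= L by rewrite mulr_ge0// addr_ge0// subr_ge0.
  pose K := L / r + normc (ckernel a b c d s).
  have K0 : 0 <= K by rewrite addr_ge0 ?normc_ge0// divr_ge0// ltW.
  have K1 : 0 < K + 1 by rewrite ltr_wpDl.
  have [n hn] := cF a b c d a0 _ (divr_gt0 e0 K1).
  have bF : bcont a b c d (F n).
    by move=> z zb; apply: cdiff_continuous; apply: dF; exact: pos zb.1.
  have CF := cauchy_formula s1 s2 (fun z rz => dF n z (pos z rz)).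
  have -> : bint a b c d (fun z => f z * (z - s)^-1) - f s * ckernel a b c d s =
     (F n s - f s) * ckernel a b c d s - bint a b c d (fun z => (F n z - f z) * (z - s)^-1).
    have -> : bint a b c d (fun z => (F n z - f z) * (z - s)^-1) =
       bint a b c d (fun z => F n z * (z - s)^-1) - bint a b c d (fun z => f z * (z - s)^-1).
      rewrite -(bintB ab cd (bcontM bF i1) (bcontM bf i1)).
      by apply: eq_bint => // z _; rewrite mulrBl.
    by rewrite CF; ring.
  apply: le_trans (normcD _ _) _; rewrite normc_opp Normc.normcM.
  have b1 : normc (bint a b c d (fun z => (F n z - f z) * (z - s)^-1)) <= L * (e / (K + 1) * r^-1).
    apply: (bint_le ab cd (bcontM (bcontB bF bf) i1)).
    move=> z zb; rewrite Normc.normcM Normc.normcV ler_pM ?normc_ge0 ?invr_ge0 ?normc_ge0//.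
      exact: hn zb.1.
    by rewrite lef_pV2 ?posrE ?hr// (lt_le_trans r0 (hr _ zb)).
  apply: le_trans (lerD (ler_wpM2r (normc_ge0 _) (hn _ rs)) b1) _.
  have -> : e / (K + 1) * normc (ckernel a b c d s) + L * (e / (K + 1) / r) = e * K / (K + 1).
    by rewrite /K; ring.
  by rewrite ler_pdivrMr// ler_pM2l// lerDl.
pose t := Num.min (Num.min (Num.min (Re z0 - a) (b - Re z0)) (Num.min (Im z0 - c) (d - Im z0))) 1.
have t0 : 0 < t.
  by case/andP: h1 => ? ?; case/andP: h2 => ? ?; rewrite !lt_min !subr_gt0; do ?[apply/andP; split].
(* Near [z0], [f = A / K]. *)
pose A w := bint a b c d (fun z => f z * (z - w)^-1).
pose K w := bint a b c d (fun z => 1 * (z - w)^-1).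
have dA : cdiff A z0 by exact: (cauchy_integral_cdiff h1 h2 bf).
have dK : cdiff K z0.
  by apply: (cauchy_integral_cdiff h1 h2) => z _; exact: cst_continuous.
have EK w : K w = ckernel a b c d w by apply: (eq_bint ab cd) => z _; rewrite mul1r.
have n0 : K z0 != 0 by rewrite EK; exact: ckernel_neq0.
have dKV : cdiff (fun w => (K w)^-1) z0 by exact: (@cdiffV R K z0 n0 dK).
apply: (@near_cdiff R (fun w => A w * (K w)^-1) f z0 t t0 _ (@cdiffM R A _ z0 dA dKV)) => w.
rewrite !lt_min => /andP[/andP[/andP[w1 w2] /andP[w3 w4]] _].
have dr := Re_le_normc (w - z0); have di := Im_le_normc (w - z0).
rewrite ReD ReN in dr; rewrite ImD ImN in di.
have hw1 : a < Re w < b.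
  have := le_lt_trans dr w1; have := le_lt_trans dr w2.
  by rewrite !ltr_norml => /andP[? ?] /andP[? ?]; apply/andP; split; lra.
have hw2 : c < Im w < d.
  have := le_lt_trans di w3; have := le_lt_trans di w4.
  by rewrite !ltr_norml => /andP[? ?] /andP[? ?]; apply/andP; split; lra.
by rewrite /A key// EK mulfK// ckernel_neq0.
Qed.

End Weierstrass.
(** * Affine changes of variable and lower semicontinuous functions *)

Section LebesgueAffine.
Variable R : realType.
Local Notation leb := (@lebesgue_measure R).
Local Notation mR := (measurableTypeR R).
Local Open Scope ereal_scope.

Lemma measurable_affine (a b : R) : measurable_fun [set: mR] ((fun x => a * x + b)%R : mR -> mR).
Proof. by apply: measurable_funD => //; exact: measurable_funM. Qed.

Lemma affine_preimage (a b c d : R) : (0 < a)%R ->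
  ((fun x => a * x + b) @^-1` `]c, d]%classic = `](c - b) / a, (d - b) / a]%classic)%R.
Proof.
move=> a0; apply/seteqP; split => x /=; rewrite !in_itv /= => /andP[h1 h2]; apply/andP; split.
- by rewrite ltr_pdivrMr// ltrBlDr mulrC.
- by rewrite ler_pdivlMr// lerBrDr mulrC.
- by move: h1; rewrite ltr_pdivrMr// ltrBlDr mulrC.
- by move: h2; rewrite ler_pdivlMr// lerBrDr mulrC.
Qed.

(** The scaled image measure agrees with Lebesgue measure on half-open intervals. *)
Lemma lebesgue_affine (a b : R) (a0 : (0 < a)%R) (A : set mR) : measurable A ->
  a%:E * pushforward leb ((fun x => a * x + b)%R : mR -> mR) A = leb A.
Proof.
move=> mA; have ma := measurable_affine a b.
pose k : {nonneg R} := NngNum (ltW a0).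
pose m0 : {measure set mR -> \bar R} :=
  mscale k (pushforward leb ((fun x => a * x + b)%R : mR -> mR)).
pose m := m0 ma.
have mE X : m X = a%:E * leb ((fun x => a * x + b)%R @^-1` X)%classic by [].
rewrite -[LHS]/(m A); apply/esym; apply: (lebesgue_measure_unique (mu := m)) => // X.
move=> [[c d]] _ <-; rewrite mE (affine_preimage _ _ _ a0) !lebesgue_measure_itv/=.
rewrite !lte_fin ltr_pM2r ?invr_gt0// ltrD2r; case: ifPn => cd; last by rewrite mule0.
by rewrite -!EFinB -EFinM -mulrBl opprB addrA subrK mulrC mulfVK// gt_eqF.
Qed.

Lemma ge0_integral_affine (a b : R) (f : R -> \bar R) : (0 < a)%R ->
  measurable_fun [set: mR] f -> (forall x, 0 <= f x) ->
  a%:E * \int[leb]_x f (a * x + b)%R = \int[leb]_x f x.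
Proof.
move=> a0 mf f0; have ma := measurable_affine a b.
have -> : \int[leb]_x f (a * x + b)%R =
   \int[pushforward leb ((fun x => a * x + b)%R : mR -> mR)]_x f x.
  by rewrite ge0_integral_pushforward.
pose k : {nonneg R} := NngNum (ltW a0).
rewrite -[X in X * _]/(k%:num%:E) -ge0_integral_mscale//.
apply: eq_measure_integral => A mA _; exact: lebesgue_affine.
Qed.

Lemma ge0_integral_opp (f : R -> \bar R) :
  measurable_fun [set: mR] f -> (forall x, 0 <= f x) ->
  \int[leb]_x f (- x)%R = \int[leb]_x f x.
Proof.
move=> mf f0.
have -> : \int[leb]_x f (- x)%R = \int[pushforward leb (-%R : mR -> mR)]_x f x.
  by rewrite ge0_integral_pushforward.
by apply: eq_measure_integral => A mA _; exact: lebesgue_measureN.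
Qed.

Lemma ge0_integral_reflect (b : R) (f : R -> \bar R) :
  measurable_fun [set: mR] f -> (forall x, 0 <= f x) ->
  \int[leb]_x f (b - x)%R = \int[leb]_x f x.
Proof.
move=> mf f0; rewrite -[RHS](ge0_integral_affine b ltr01 mf f0) mul1e.
rewrite -(ge0_integral_opp (f := fun x => f (1 * x + b)%R))//.
- by apply: eq_integral => x _; rewrite mul1r addrC.
- by apply: measurableT_comp mf _; exact: measurable_affine.
Qed.

End LebesgueAffine.

Section OpenProduct.
Variable R : realType.
Local Notation mR := (measurableTypeR R).

(** An open subset of the plane is a countable union of rational boxes, and boxes
    are measurable for the product structure. *)
Lemma open_prod_measurable (U : set (mR * mR)) :
  (forall p, U p -> exists2 r : R, 0 < r &
     forall q, `|q.1 - p.1| < r -> `|q.2 - p.2| < r -> U q) -> measurable U.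
Proof.
move=> oU.
pose B (k : (rat * rat) * (rat * rat)) : set (mR * mR) :=
  `]ratr k.1.1, ratr k.1.2[%classic `*` `]ratr k.2.1, ratr k.2.2[%classic.
pose D k := if `[< B k `<=` U >] then B k else set0.
have -> : U = \bigcup_k D k.
  apply/seteqP; split => [p /[dup] Up /oU[r r0 H]|p [k _]]; last first.
    by rewrite /D; case: asboolP => // BU; exact: BU.
  have h1 : p.1 - r < p.1 by rewrite ltrBlDr ltrDl.
  have h2 : p.1 < p.1 + r by rewrite ltrDl.
  have h3 : p.2 - r < p.2 by rewrite ltrBlDr ltrDl.
  have h4 : p.2 < p.2 + r by rewrite ltrDl.
  have [a1 +] := rat_in_itvoo h1; have [b1 +] := rat_in_itvoo h2.
  have [a2 +] := rat_in_itvoo h3; have [b2 +] := rat_in_itvoo h4.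
  rewrite !in_itv /= => /andP[b21 b22] /andP[a21 a22] /andP[b11 b12] /andP[a11 a12].
  exists ((a1, b1), (a2, b2)) => //; rewrite /D; case: asboolP; last first.
    case=> q [/=]; rewrite !in_itv /= => /andP[q1 q2] /andP[q3 q4]; apply: H.
    - by rewrite ltr_norml; apply/andP; split; lra.
    - by rewrite ltr_norml; apply/andP; split; lra.
  by move=> _; split; rewrite /= in_itv /=; apply/andP.
apply: countable_bigcupT_measurable => // k; rewrite /D; case: ifP => // _.
exact: measurableX.
Qed.

(** The form that suits functions extended by zero: lower semicontinuity is
    asked on the right half-plane only, since the sets [c < h] with [c < 0] are
    everything and those with [c >= 0] lie in it. *)
Lemma open_prod_measurable_fun (h : mR * mR -> R) :
  (forall p, 0 <= h p) -> (forall p, p.1 <= 0 -> h p = 0) ->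
  (forall p c, 0 < p.1 -> c < h p -> exists2 r : R, 0 < r &
     forall q, `|q.1 - p.1| < r -> `|q.2 - p.2| < r -> c < h q) ->
  measurable_fun setT h.
Proof.
move=> h0 hn hc; apply: (measurability _ (RGenOInfty.measurableE R)) => //.
move=> /= _ [_ [c ->] <-]; rewrite preimage_itvoy setTI.
have [c0|c0] := ltP c 0.
  rewrite [X in measurable X](_ : _ = setT)//; apply/seteqP; split => // p _ /=.
  exact: lt_le_trans (h0 p).
apply: open_prod_measurable => p /= ch; apply: hc => //.
by rewrite ltNge; apply/negP => /hn E; move: ch; rewrite E ltNge c0.
Qed.

End OpenProduct.
(** * The Zen norm through square means on vertical lines *)

Section ZenNorm.
Variable R : realType.
Local Notation leb := (@lebesgue_measure R).
Local Notation mR := (measurableTypeR R).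
Local Notation C := (R[i]^o).
Implicit Types (f g : R[i] -> R[i]) (e : R).
Local Open Scope ereal_scope.

(** The sets [x < n] exhaust the line and have finite mass. The measure is
    repackaged as a sigma-finite one, on which Tonelli's theorem can be applied. *)
Lemma zen_sigma_finite (nu : {measure set mR -> \bar R}) : zen_measure nu ->
  exists m : {sigma_finite_measure set mR -> \bar R}, (m : {measure set mR -> \bar R}) = nu.
Proof.
case=> nu0 _ [numass _].
have sf : sigma_finite setT nu.
  exists (fun n => `]-oo, n.+1%:R[%classic).
    apply/seteqP; split => // x _; exists (Num.bound `|x|%R) => //=; rewrite in_itv /=.
    apply: le_lt_trans (ler_norm _) (lt_trans (archi_boundP (normr_ge0 x)) _).
    by rewrite ltr_nat.
  move=> n; split => //.
  have -> : `]-oo, n.+1%:R[%classic = `]-oo, 0%R[%classic `|` `[0%R, n.+1%:R[%classic :> set R.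
    apply/seteqP; split => x /=; rewrite !in_itv /=.
      by move=> xn; have [x0|x0] := ltP x 0%R; [left|right; rewrite xn].
    by case=> [x0|/andP[]//]; exact: lt_le_trans x0 _.
  apply: (@le_lt_trans _ _ (nu `]-oo, 0%R[%classic + nu `[0%R, n.+1%:R[%classic)).
    exact: measureU2.
  by rewrite nu0 add0e; have /andP[] := numass n.+1%:R (ltr0Sn _ _).
case: nu nu0 numass sf => nu cnu nu0 numass sf.
pose nu' : {measure set mR -> \bar R} := Measure.Pack cnu.
pose m : {sigma_finite_measure set mR -> \bar R} :=
  HB.pack (Measure.sort nu') (Measure.class nu') (Measure_isSigmaFinite.Build _ _ _ nu' sf).
by exists m.
Qed.

(** Analytic functions on the half-plane in extended form: with the value zero
    prescribed elsewhere, two of them are equal as soon as they agree on the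
    half-plane, and they can be integrated over the whole plane. *)
Definition hol f : Prop :=
  (forall z, (0 < Re z)%R -> cdiff f z) /\ (forall z, (Re z <= 0)%R -> f z = 0%R).

Definition sqmod f (p : mR * mR) : R := (normc (f (p.1 +i* p.2)%C) ^+ 2)%R.

Lemma sqmod_ge0 f p : (0 <= sqmod f p)%R.
Proof. exact: sqr_ge0. Qed.

Lemma sqmod_continuous f z : cdiff f z ->
  {for (z : C), continuous ((fun w => normc (f w) ^+ 2)%R : C -> R)}.
Proof.
move=> /cdiff_continuous cf.
apply: (@continuous_comp C R R (fun w => normc (f w)) (fun x => x ^+ 2)%R); last exact: exprn_continuous.
apply: (@continuous_comp C C R f normc); [exact: cf|exact: normc_continuous].
Qed.

Lemma measurable_sqmod f : hol f -> measurable_fun setT (sqmod f).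
Proof.
move=> [df f0]; apply: open_prod_measurable_fun.
- exact: sqmod_ge0.
- by move=> p p0; rewrite /sqmod f0// Normc.normc0 expr0n.
- move=> p c p0 cp.
  have := sqmod_continuous (df (p.1 +i* p.2)%C p0).
  move=> /(@cvgrPdist_lt _ R _ (nbhs ((p.1 +i* p.2)%C : C)) _) /(_ (sqmod f p - c)%R).
  rewrite subr_gt0 => /(_ cp) /nbhsCP [r r0 H].
  exists (r / 2)%R; first by rewrite divr_gt0.
  move=> q q1 q2; have := H (q.1 +i* q.2)%C.
  have qr : (normc ((q.1 +i* q.2)%C - (p.1 +i* p.2)%C) < r)%R.
    apply: le_lt_trans (normc_le _) _; rewrite /=.
    by rewrite [r]splitr ltrD.
  move=> /(_ qr) /=; rewrite -/(sqmod f p) -/(sqmod f q) => K.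
  have := le_lt_trans (ler_norm _) K; rewrite ltrD2l ltrN2//.
Qed.

(** The square mean on the vertical line of abscissa [x], the profile on which the
    Zen norm depends. *)
Definition vint f (x : R) : \bar R := \int[leb]_y (sqmod f (x, y))%:E.

Lemma vint_ge0 f x : 0 <= vint f x.
Proof. by apply: integral_ge0 => y _; rewrite lee_fin sqmod_ge0. Qed.

Lemma measurable_vint f : hol f -> measurable_fun [set: mR] (vint f).
Proof.
move=> hf.
apply: (@measurable_fun_fubini_tonelli_F _ _ mR mR R leb (fun p => (sqmod f p)%:E)).
- by apply/measurable_EFinP; exact: measurable_sqmod.
- by move=> p; rewrite lee_fin sqmod_ge0.
Qed.

Variable nu : {sigma_finite_measure set mR -> \bar R}.

Definition shifted (M : R -> \bar R) e := \int[nu]_(x in `[0%R, +oo[) M (x + e)%R.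

(** Tonelli's theorem. *)
Lemma zen_sqnormE (F : right_half_plane R -> R[i]) : hol (extend F) ->
  zen_sqnorm nu F = ereal_sup [set shifted (vint (extend F)) e | e in [set e | (0 < e)%R]].
Proof.
move=> hF; congr ereal_sup; apply: eq_imagel => e /= _.
rewrite integral_mkcond.
have mD : measurable [set p : mR * mR | (0 <= p.1)%R].
  rewrite [X in measurable X](_ : _ = `[0%R, +oo[%classic `*` setT); first exact: measurableX.
  by apply/seteqP; split => p /=; rewrite in_itv /= andbT; tauto.
have mg : measurable_fun setT (fun p : mR * mR => (sqmod (extend F) ((p.1 + e)%R, p.2))%:E).
  apply/measurable_EFinP.
  apply: (measurableT_comp (measurable_sqmod hF)).
  apply: measurable_fun_pair; last exact: measurable_snd.
  by apply: measurable_funD => //; exact: measurable_fst.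
rewrite [LHS](@fubini_tonelli1 _ _ mR mR R nu leb); last 2 first.
- exact: ((@measurable_restrictT _ _ _ _ _ _ mD).1 (@measurable_funTS _ _ _ _ _ _ mg)).
- by move=> p; rewrite patchE; case: ifP => // _; rewrite lee_fin sqr_ge0.
rewrite /shifted [RHS]integral_mkcond; apply: eq_integral => x _.
rewrite /fubini_F patchE; case: ifPn => x0.
- apply: eq_integral => y _; rewrite patchE ifT// inE /=.
  by move: x0; rewrite inE /= in_itv /= andbT.
- rewrite integral0_eq// => y _; rewrite patchE ifF//; apply/negP; rewrite inE /= => x0'.
  by move/negP: x0; apply; rewrite inE /= in_itv /= andbT.
Qed.

End ZenNorm.
(** * Midpoint convex profiles *)

Section Profile.
Variable R : realType.
Local Notation leb := (@lebesgue_measure R).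
Local Notation mR := (measurableTypeR R).
Implicit Types (e : R).
Local Open Scope ereal_scope.

Lemma measurable_comp_add d (T : measurableType d) (f : R -> \bar R) (u v : T -> R) :
  measurable_fun [set: mR] f -> measurable_fun [set: T] (u : T -> mR) ->
  measurable_fun [set: T] (v : T -> mR) ->
  measurable_fun [set: T] (fun x => f (u x + v x)%R).
Proof.
move=> mf mu mv.
have H : measurable_fun [set: T] ((fun x => u x + v x)%R : T -> mR) by exact: measurable_funD.
exact: (measurableT_comp mf H).
Qed.

Lemma measurable_comp_sub d (T : measurableType d) (f : R -> \bar R) (u v : T -> R) :
  measurable_fun [set: mR] f -> measurable_fun [set: T] (u : T -> mR) ->
  measurable_fun [set: T] (v : T -> mR) ->
  measurable_fun [set: T] (fun x => f (u x - v x)%R).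
Proof.
move=> mf mu mv.
have H : measurable_fun [set: T] ((fun x => u x - v x)%R : T -> mR) by exact: measurable_funB.
exact: (measurableT_comp mf H).
Qed.

Variable nu : {sigma_finite_measure set mR -> \bar R}.
Hypothesis hnu : forall t : R, (0 < t)%R -> 0 < initial_mass nu t < +oo.

Variable M : R -> \bar R.
Hypothesis mM : measurable_fun [set: mR] M.
Hypothesis M0 : forall x, 0 <= M x.

Let measurable_ind (A : set mR) : measurable A ->
  measurable_fun [set: mR] (fun x => (\1_A x : R)%:E).
Proof. by move=> mA; apply/measurable_EFinP; exact: measurable_indic. Qed.

Let ind_ge0 (A : set mR) x : 0 <= (\1_A x : R)%:E.
Proof. by rewrite lee_fin. Qed.

Lemma integral_ind_mul d (T : measurableType d) (mu : {measure set T -> \bar R}) (A : set T) (f : T -> \bar R) :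
  \int[mu]_(x in A) f x = \int[mu]_x ((\1_A x : R)%:E * f x).
Proof.
rewrite integral_mkcond; apply: eq_integral => x _; rewrite patchE indicE.
by case: ifP => _; rewrite ?mul1e ?mul0e.
Qed.

(** The bound [N] is averaged over the shifts [y] between [a - h] and [b]: when
    [0 <= x < h] these shifts move [x] over all of [[a, b]], so Tonelli's theorem
    leaves the mass [initial_mass nu h] in front of the integral of [M]. *)
Lemma strip_bound (N : \bar R) (h a b : R) :
  (forall e, (0 < e)%R -> shifted nu M e <= N) -> (0 < h < a)%R -> (a <= b)%R ->
  initial_mass nu h * \int[leb]_(x in `[a, b]) M x <= (b - a + h)%:E * N.
Proof.
move=> MN /andP[h0 ha] ab.
set I := \int[leb]_(x in _) M x.
set A : set mR := `[0%R, h[%classic; set B : set mR := `[(a - h)%R, b]%classic.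
have mA : measurable A by exact: measurable_itv.
have mB : measurable B by exact: measurable_itv.
(* [p.1] is the variable of [nu] and [p.2] the shift. *)
pose k (p : mR * mR) := (\1_A p.1 : R)%:E * ((\1_B p.2 : R)%:E * M (p.1 + p.2)%R).
have k0 p : 0 <= k p by rewrite !mule_ge0.
have mk : measurable_fun setT k.
  apply: emeasurable_funM.
    exact: (measurableT_comp (measurable_ind mA) (@measurable_fst _ _ mR mR)).
  apply: emeasurable_funM.
    exact: (measurableT_comp (measurable_ind mB) (@measurable_snd _ _ mR mR)).
  apply: measurable_comp_add => //.
have I0 : 0 <= I by exact: integral_ge0.
have N0 : 0 <= N by apply: le_trans (MN 1%R ltr01); apply: integral_ge0 => x _.
have -> : initial_mass nu h * I = \int[nu]_x ((\1_A x : R)%:E * I).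
  by rewrite ge0_integralZr//; [rewrite integral_indic// setIT|exact: measurable_ind].
apply: (@le_trans _ _ (\int[nu]_x \int[leb]_y k (x, y))).
  apply: ge0_le_integral => //.
  - by move=> x _; rewrite mule_ge0.
  - by apply: emeasurable_funM => //; exact: measurable_ind.
  - exact: (@measurable_fun_fubini_tonelli_F _ _ mR mR R leb k mk k0).
  move=> x _; rewrite /k /= indicE; case: (boolP (x \in A)) => xA; last first.
    by rewrite mul0e; apply: integral_ge0 => y _; rewrite mul0e.
  rewrite mul1e; under eq_integral do rewrite mul1e.
  rewrite /I [leLHS]integral_ind_mul.
  pose g (y : R) := (\1_B (y - x)%R : R)%:E * M y.
  have mg : measurable_fun [set: mR] g.
    apply: emeasurable_funM => //.
    by apply: (@measurable_comp_sub _ _ _ id (fun=> x) (measurable_ind mB)).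
  have g0 y : 0 <= g y by rewrite mule_ge0.
  rewrite [leRHS](_ : _ = \int[leb]_y g (1 * y + x)%R); last first.
    by apply: eq_integral => y _; rewrite /g mul1r addrK [(y + x)%R]addrC.
  rewrite -[leRHS]mul1e (ge0_integral_affine x ltr01 mg g0).
  apply: ge0_le_integral => //.
  - by move=> y _; rewrite mule_ge0.
  - by apply: emeasurable_funM => //; apply: measurable_ind; exact: measurable_itv.
  move=> y _; rewrite /g lee_wpmul2r// lee_fin !indicE ler_nat.
  case: (boolP (y \in _)) => //; rewrite !inE /= !in_itv /= => /andP[y1 y2].
  move: xA; rewrite inE /A /= in_itv /= => /andP[x1 x2].
  have yB : (y - x)%R \in B by rewrite inE /B /= in_itv /=; apply/andP; split; lra.
  by rewrite yB.
rewrite (@fubini_tonelli _ _ mR mR R nu leb k mk k0).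
have -> : (b - a + h)%:E * N = \int[leb]_x ((\1_B x : R)%:E * N).
  rewrite ge0_integralZr//; last exact: measurable_ind.
  have lB : leb B = (b - a + h)%:E.
    rewrite /B lebesgue_measure_itv /= lte_fin.
    have -> : (a - h < b)%R by lra.
    by rewrite -EFinB; congr (_%:E); ring.
  by rewrite integral_indic// setIT; congr (_ * _); exact: esym lB.
apply: ge0_le_integral => //.
- by move=> x _; apply: integral_ge0 => y _.
- exact: (@measurable_fun_fubini_tonelli_G _ _ mR mR R nu k mk k0).
- by apply: emeasurable_funM => //; exact: measurable_ind.
move=> y _; rewrite /k /= indicE; case: (boolP (y \in B)) => yB; last first.
  by rewrite mul0e integral0_eq// => x _; rewrite mul0e mule0.
rewrite mul1e; under eq_integral do rewrite mul1e.
move: yB; rewrite inE /B /= in_itv /= => /andP[y1 y2].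
have y0 : (0 < y)%R by lra.
apply: le_trans (MN y y0); rewrite /shifted [leRHS]integral_ind_mul.
apply: ge0_le_integral => //.
- by move=> x _; rewrite mule_ge0.
- by apply: emeasurable_funM => //; [exact: measurable_ind|exact: measurable_comp_add].
- apply: emeasurable_funM; first by apply: measurable_ind; exact: measurable_itv.
  exact: measurable_comp_add.
move=> x _; rewrite lee_wpmul2r// lee_fin !indicE ler_nat.
case: (boolP (x \in A)) => //; rewrite inE /A /= in_itv /= => /andP[x1 x2].
have -> : x \in (`[0%R, +oo[%classic : set mR) by rewrite inE /= in_itv /= x1.
by [].
Qed.

Hypothesis mid : forall x t : R, (0 < t < x)%R -> 2%:E * M x <= M (x - t)%R + M (x + t)%R.

(** Midpoint convexity averaged over the shifts between [- h] and [h]. *)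
Lemma mid_average (p h : R) : (0 < h < p)%R ->
  (2 * h)%:E * M p <= \int[leb]_(x in `[(p - h)%R, (p + h)%R]) M x.
Proof.
move=> /andP[h0 hp].
set A : set mR := `[(- h)%R, h]%classic.
have mA : measurable A by exact: measurable_itv.
set I := \int[leb]_(x in _) M x.
have I0 : 0 <= I by exact: integral_ge0.
have mMr : measurable_fun [set: mR] (fun x => M (p - x)%R).
  by apply: (@measurable_comp_sub _ _ _ (fun=> p) id mM).
have mMs : measurable_fun [set: mR] (fun x => M (p + x)%R).
  by apply: (@measurable_comp_add _ _ _ (fun=> p) id mM).
have e1 : \int[leb]_x ((\1_A x : R)%:E * M (p + x)%R) = I.
  pose g (y : R) := (\1_A (y - p)%R : R)%:E * M y.
  have mg : measurable_fun [set: mR] g.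
    apply: emeasurable_funM => //.
    by apply: (@measurable_comp_sub _ _ _ id (fun=> p) (measurable_ind mA)).
  have g0 y : 0 <= g y by rewrite mule_ge0.
  transitivity (\int[leb]_y g (1 * y + p)%R).
    by apply: eq_integral => y _; rewrite /g mul1r addrK [(y + p)%R]addrC.
  rewrite -[LHS]mul1e (ge0_integral_affine p ltr01 mg g0) /I [RHS]integral_ind_mul.
  apply: eq_integral => y _; rewrite /g !indicE; congr ((_%:R)%:E * _); congr nat_of_bool.
  by apply/idP/idP; rewrite !inE /A /= !in_itv /= => /andP[? ?]; apply/andP; split; lra.
have e2 : \int[leb]_x ((\1_A x : R)%:E * M (p - x)%R) = I.
  pose g (y : R) := (\1_A (p - y)%R : R)%:E * M y.
  have mg : measurable_fun [set: mR] g.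
    apply: emeasurable_funM => //.
    by apply: (@measurable_comp_sub _ _ _ (fun=> p) id (measurable_ind mA)).
  have g0 y : 0 <= g y by rewrite mule_ge0.
  transitivity (\int[leb]_y g (p - y)%R).
    by apply: eq_integral => y _; rewrite /g subKr.
  rewrite (ge0_integral_reflect p mg g0) /I [RHS]integral_ind_mul.
  apply: eq_integral => y _; rewrite /g !indicE; congr ((_%:R)%:E * _); congr nat_of_bool.
  by apply/idP/idP; rewrite !inE /A /= !in_itv /= => /andP[? ?]; apply/andP; split; lra.
rewrite -(@lee_pmul2l _ 2%:E)//.
have -> : 2%:E * I = I + I by rewrite mule_natl mule2n.
rewrite -{1}e2 -e1 -ge0_integralD//; first last.
- by apply: emeasurable_funM => //; exact: measurable_ind.
- by move=> x _; rewrite mule_ge0.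
- by apply: emeasurable_funM => //; exact: measurable_ind.
- by move=> x _; rewrite mule_ge0.
have -> : 2%:E * ((2 * h)%:E * M p) = \int[leb]_x ((\1_A x : R)%:E * (2%:E * M p)).
  rewrite ge0_integralZr//; last 2 first.
  - exact: measurable_ind.
  - by rewrite mule_ge0.
  have lA : leb A = (2 * h)%:E.
    rewrite /A lebesgue_measure_itv /= lte_fin.
    have -> : (- h < h)%R by lra.
    by rewrite -EFinB; congr (_%:E); ring.
  by rewrite muleCA integral_indic// setIT; congr (_ * _); exact: esym lA.
apply: ge0_le_integral => //.
- by move=> x _; rewrite !mule_ge0.
- by apply: emeasurable_funM => //; exact: measurable_ind.
- by apply: emeasurable_funD; apply: emeasurable_funM => //; exact: measurable_ind.
move=> x _; rewrite -ge0_muleDr// indicE.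
case: (boolP (x \in A)) => [|_]; last by rewrite !mul0e.
rewrite inE /A /= in_itv /= !mul1e => /andP[x1 x2].
have [x0|x0|->] := ltgtP x 0%R.
- by have := @mid p (- x)%R; rewrite opprK addeC; apply; apply/andP; split; lra.
- by apply: mid; apply/andP; split; lra.
- by rewrite subr0 addr0 mule_natl mule2n.
Qed.

Variable N : R.
Hypothesis MN : forall e, (0 < e)%R -> shifted nu M e <= N%:E.

Definition mass (h : R) : R := fine (initial_mass nu h).

Lemma massE h : (0 < h)%R -> initial_mass nu h = (mass h)%:E.
Proof. by move=> /hnu /andP[h1 h2]; rewrite fineK// ge0_fin_numE// ltW. Qed.

Lemma mass_gt0 h : (0 < h)%R -> (0 < mass h)%R.
Proof. by move=> /[dup] /massE E /hnu; rewrite E !lte_fin => /andP[]. Qed.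

(** The value at a point is at most the mean over an interval around it
    ([mid_average]), and [mass h] is positive, so [strip_bound] controls this
    mean. The interval has length [2 h] and the shifts range over [3 h], whence
    the constant. *)
Lemma mid_bound (p h : R) : (0 < h)%R -> (h < p - h)%R ->
  M p <= (3 / (2 * mass h) * N)%:E.
Proof.
move=> h0 hp; have m0 := mass_gt0 h0.
have hp' : (0 < h < p)%R by apply/andP; split; lra.
have h1 := mid_average hp'.
have h2 : initial_mass nu h * \int[leb]_(x in `[(p - h)%R, (p + h)%R]) M x <=
   ((p + h) - (p - h) + h)%:E * N%:E.
  by apply: strip_bound => //; [rewrite h0|lra].
rewrite massE// in h2.
have : (mass h)%:E * ((2 * h)%:E * M p) <= (3 * h * N)%:E.
  apply: le_trans (lee_wpmul2l _ h1) _; first by rewrite lee_fin ltW.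
  by apply: le_trans h2 _; rewrite -EFinM lee_fin le_eqVlt; apply/orP; left; apply/eqP; ring.
have c0 : (0 < mass h * (2 * h))%R by rewrite mulr_gt0// mulr_gt0.
rewrite muleA -EFinM -lee_pdivlMl// -EFinM => /le_trans; apply.
rewrite lee_fin le_eqVlt; apply/orP; left; apply/eqP; field.
by rewrite !gt_eqF.
Qed.

Lemma mid_fin x : (0 < x)%R -> M x \is a fin_num.
Proof.
move=> x0; rewrite ge0_fin_numE//.
by apply: le_lt_trans (@mid_bound x (x / 4) _ _) _; [lra|lra|exact: ltry].
Qed.

(** A strict increase from [x] to [y] would be repeated, by midpoint convexity,
    over each following step of length [y - x]; the growth would be at least
    linear, against the bound of [mid_bound] for all large abscissas. *)
Lemma mid_nonincreasing (x y : R) : (0 < x)%R -> (x <= y)%R -> M y <= M x.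
Proof.
move=> x0 xy; rewrite leNgt; apply/negP => Mxy.
pose m t := fine (M t).
have mE t : (0 < t)%R -> M t = (m t)%:E by move=> t0; rewrite fineK// mid_fin.
have y0 : (0 < y)%R by exact: lt_le_trans xy.
rewrite !mE// lte_fin in Mxy.
have xy' : (0 < y - x)%R.
  rewrite subr_gt0 lt_neqAle xy andbT; apply/eqP => E.
  by rewrite E ltxx in Mxy.
pose s k := m (x + k%:R * (y - x))%R.
have pos (k : nat) : (0 < x + k%:R * (y - x))%R by rewrite ltr_wpDr// mulr_ge0// ltW.
have inc k : (s k.+1 - s k >= m y - m x)%R.
  elim: k => [|k IH].
    by rewrite /s mul1r mul0r addr0 subrKC.
  apply: le_trans IH _.
  have := @mid (x + k.+1%:R * (y - x))%R (y - x)%R.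
  have -> : (x + k.+1%:R * (y - x) - (y - x) = x + k%:R * (y - x))%R by rewrite -natr1; ring.
  have -> : (x + k.+1%:R * (y - x) + (y - x) = x + k.+2%:R * (y - x))%R by rewrite -(natr1 k.+1); ring.
  rewrite !mE// -EFinM -EFinD lee_fin => /(_ _).
  have -> : (0 < y - x < x + k.+1%:R * (y - x))%R.
    by rewrite xy' /= -natr1 mulrDl mul1r addrA ltrDr.
  by move=> /(_ isT); rewrite /s; lra.
have lin k : (m x + k%:R * (m y - m x) <= s k)%R.
  elim: k => [|k IH]; first by rewrite /s !mul0r !addr0.
  by have := inc k; rewrite -natr1 mulrDl mul1r; lra.
pose B : R := (3 / (2 * mass (x / 4)) * N)%R.
have sB k : (s k <= B)%R.
  rewrite -lee_fin -mE//; apply: mid_bound; first lra.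
  have : (0 <= k%:R * (y - x))%R by rewrite mulr_ge0// ltW.
  by lra.
have d0 : (0 < m y - m x)%R by rewrite subr_gt0.
have := archi_boundP (normr_ge0 ((B - m x) / (m y - m x))%R).
set k := Num.bound _ => hk.
have := le_trans (lin k) (sB k); apply/negP; rewrite -ltNge.
rewrite addrC -ltrBlDr -ltr_pdivrMr//; apply: le_lt_trans hk; exact: ler_norm.
Qed.

End Profile.
(** * The layer cake formula under dilation *)

Section LayerCake.
Variable R : realType.
Local Notation leb := (@lebesgue_measure R).
Local Notation mR := (measurableTypeR R).
Local Open Scope ereal_scope.

Variable nu : {sigma_finite_measure set mR -> \bar R}.
Hypothesis hnu : forall t : R, (0 < t)%R -> 0 < initial_mass nu t < +oo.
Variables (l k : R).
Hypotheses (l0 : (0 < l)%R) (k0 : (0 <= k)%R).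
Hypothesis lk : forall t : R, (0 < t)%R -> initial_mass nu (t / l) <= k%:E * initial_mass nu t.

Let scaled (I : set R) : set mR := [set x | (0 <= x)%R /\ I (l * x)%R].

(** An initial interval of the half-line is everything, or open or closed on the
    right. The hypothesis [lk] is the case of a half-open interval; the other two
    follow by increasing and by decreasing limits. *)
Lemma initial_segment_le (I : set mR) : measurable I ->
  (forall x, I x -> (0 <= x)%R) ->
  (forall x y, I x -> (0 <= y <= x)%R -> I y) ->
  nu (scaled I) <= k%:E * nu I.
Proof.
move=> mI I0 Id.
have small (A B : set mR) : measurable A -> measurable B -> A `<=` B -> nu A <= nu B.
  by move=> mA mB AB; apply: le_measure => //; rewrite inE.
have [->|/set0P[x0 Ix0]] := eqVneq I set0.
  by rewrite (_ : scaled set0 = set0) ?measure0 ?mule0//; apply/seteqP; split => x // [].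
have [ub|nub] := pselect (has_ubound (I : set R)); last first.
  have IE : I = \bigcup_n `[0%R, n.+1%:R[%classic.
    apply/seteqP; split => [x Ix|x [n _ /=]].
      exists (Num.bound x) => //=; rewrite in_itv /= I0//=.
      by apply: lt_trans (archi_boundP (I0 _ Ix)) _; rewrite ltr_nat.
    rewrite in_itv /= => /andP[x1 x2].
    have : exists2 y, I y & (n.+1%:R < y)%R.
      apply: contrapT => H; apply: nub; exists n.+1%:R => y Iy; rewrite leNgt; apply/negP => yn.
      by apply: H; exists y.
    by case=> y Iy yn; apply: (Id _ _ Iy); rewrite x1 ltW// (lt_trans x2).
  have sE : scaled I = \bigcup_n `[0%R, (n.+1%:R / l)%R[%classic.
    apply/seteqP; split => [x [x1]|x [n _ /=]].
      rewrite IE => -[n _ /=]; rewrite in_itv /= => /andP[_ xn]; exists n => //=.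
      by rewrite in_itv /= x1 ltr_pdivlMr// mulrC.
    rewrite in_itv /= => /andP[x1 x2]; split => //; rewrite IE; exists n => //=.
    by rewrite in_itv /= mulr_ge0// ?ltW//= mulrC -ltr_pdivlMr.
  have cv : nu (`[0%R, (n.+1%:R / l)%R[%classic) @[n --> \oo] --> nu (scaled I).
    rewrite sE; apply: nondecreasing_cvg_mu => //.
    - by apply: bigcup_measurable => n _; exact: measurable_itv.
    - move=> m n mn; apply/subsetPset => x /=; rewrite !in_itv /= => /andP[-> /lt_le_trans]; apply.
      by rewrite ler_pM2r ?invr_gt0// ler_nat ltnS.
  rewrite -(cvg_lim _ cv)//; apply: lime_le; first by apply/cvg_ex; eexists; exact: cv.
  apply: nearW => n; apply: le_trans (@lk n.+1%:R _) _ => //.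
  rewrite lee_wpmul2l ?lee_fin//; apply: small => //.
  by move=> x xn; rewrite IE; exists n.
have hs : has_sup (I : set R) by split => //; exists x0.
set b := sup (I : set R).
have Ib x : I x -> (x <= b)%R by move=> Ix; apply: (ub_le_sup ub).
have bI x : (0 <= x)%R -> (x < b)%R -> I x.
  by move=> x1 /(sup_gt hs.1)[y Iy xy]; apply: (Id _ _ Iy); rewrite x1 ltW.
have [Ibb|nIb] := pselect (I b); last first.
  have b0 : (0 < b)%R.
    rewrite lt_neqAle (le_trans (I0 _ Ix0) (Ib _ Ix0)) andbT; apply/eqP => E; apply: nIb.
    have := Ib _ Ix0; rewrite -E => x00.
    by rewrite (_ : 0%R = x0)//; apply/eqP; rewrite eq_le x00 I0.
  have IE : I = `[0%R, b[%classic.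
    apply/seteqP; split => x /=; rewrite in_itv /=.
      move=> Ix; rewrite I0//= lt_neqAle Ib// andbT; apply/eqP => xb.
      by apply: nIb; rewrite -xb.
    by move=> /andP[]; exact: bI.
  have sE : scaled I = `[0%R, (b / l)%R[%classic.
    apply/seteqP; split => x /=; rewrite IE /= !in_itv /=.
      by move=> [-> /andP[_]]; rewrite ltr_pdivlMr// mulrC.
    move=> /andP[x1]; rewrite ltr_pdivlMr// mulrC => H; split => //.
    by rewrite /= in_itv /= H mulr_ge0// ltW.
  by rewrite sE IE; exact: lk.
have b0 : (0 <= b)%R by exact: I0.
pose J n : set mR := `[0%R, (b + n.+1%:R^-1)%R[%classic.
have bn n : (0 < b + n.+1%:R^-1 :> R)%R by rewrite ltr_wpDl.
have IE : I = \bigcap_n J n.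
  apply/seteqP; split => [x Ix n _ /=|x H].
    by rewrite /J /= in_itv /= I0//= (le_lt_trans (Ib _ Ix))// ltrDl invr_gt0.
  have := H 0%N Logic.I; rewrite /J /= in_itv /= => /andP[x1 _].
  apply: (Id _ _ Ibb); rewrite x1 /=; apply/ler_addgt0Pr => e e0.
  have [n hn] : exists n : nat, (n.+1%:R^-1 < e)%R.
    have := archi_boundP (normr_ge0 e^-1%R); set n := Num.bound _ => hn; exists n.
    rewrite invf_plt ?posrE//; apply: lt_trans (_ : n%:R < _)%R; last by rewrite ltr_nat.
    by apply: le_lt_trans hn; exact: ler_norm.
  have := H n Logic.I; rewrite /J /= in_itv /= => /andP[_ xn].
  by apply: ltW; apply: lt_trans xn _; rewrite ltrD2l.
have cv : nu (J n) @[n --> \oo] --> nu I.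
  rewrite IE; apply: nonincreasing_cvg_mu => //.
  - by have /andP[_] := hnu (bn 0%N).
  - by move=> n; exact: measurable_itv.
  - by apply: bigcapT_measurable => n; exact: measurable_itv.
  - move=> m n mn; apply/subsetPset => x; rewrite /J /= !in_itv /= => /andP[-> /lt_le_trans]; apply.
    by rewrite lerD2l lef_pV2 ?posrE// ler_nat ltnS.
have cv2 : (fun n => k%:E * nu (J n)) @ \oo --> k%:E * nu I by exact: cvgeZl.
rewrite -(cvg_lim _ cv2)//; apply: lime_ge; first by apply/cvg_ex; eexists; exact: cv2.
apply: nearW => n; apply: le_trans _ (lk (bn n)).
apply: small => //.
  have -> : scaled I = `[0%R, (b / l)%R]%classic.
    apply/seteqP; split => x /=; rewrite !in_itv /=.
      by move=> [-> /Ib]; rewrite ler_pdivlMr// mulrC.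
    move=> /andP[x1]; rewrite ler_pdivlMr// mulrC => xb; split=> //.
    by apply: (Id _ _ Ibb); rewrite xb mulr_ge0// ltW.
  exact: measurable_itv.
move=> x [x1 /Ib xb]; rewrite /J /= in_itv /= x1 /= ltr_pdivlMr// mulrC.
by apply: le_lt_trans xb _; rewrite ltrDl invr_gt0.
Qed.

Definition layer (q : R -> R) (h : R) : \bar R := nu [set x : mR | (0 <= x)%R /\ (h < q x)%R].

(** Tonelli's theorem for the region under the graph of [q]. *)
Lemma integral_layer (q : R -> R) : measurable_fun [set: mR] (q : mR -> R) ->
  (forall x, 0 <= q x)%R ->
  measurable_fun (`[0%R, +oo[%classic : set mR) (layer q) /\
  \int[nu]_(x in `[0%R, +oo[) (q x)%:E = \int[leb]_(h in `[0%R, +oo[) layer q h.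
Proof.
move=> mq q0.
pose S : set (mR * mR) := [set p | [/\ 0 <= p.1, 0 <= p.2 & p.2 < q p.1]%R].
have mS : measurable S.
  have -> : S = (`[0%R, +oo[%classic `*` `[0%R, +oo[%classic) `&` [set p : mR * mR | (p.2 < q p.1)%R].
    apply/seteqP; split => p /=; rewrite !in_itv /= !andbT; first by case.
    by case=> -[].
  apply: measurableI; first by apply: measurableX; exact: measurable_itv.
  have mq1 : measurable_fun setT (fun p : mR * mR => q p.1).
    exact: (measurableT_comp mq (@measurable_fst _ _ mR mR)).
  have := @measurable_fun_ltr _ _ R setT (fun p : mR * mR => p.2) (fun p => q p.1)
    (@measurable_snd _ _ mR mR) mq1 measurableT [set true] Logic.I.
  by rewrite setTI; congr measurable; apply/seteqP; split.
pose f (p : mR * mR) := (\1_S p : R)%:E.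
have f0 p : 0 <= f p by rewrite lee_fin.
have mf : measurable_fun setT f by apply/measurable_EFinP; exact: measurable_indic.
have key (y : R) : (0 <= y)%R -> \int[nu]_x f (x, y) = layer q y.
  move=> y0; have mY : measurable (ysection S y) by exact: measurable_ysection.
  have -> : layer q y = nu (ysection S y).
    by congr (nu _); apply/seteqP; split => x; rewrite ysectionE /=; case.
  have := @integral_indic _ mR R nu setT measurableT (ysection S y) mY.
  rewrite setIT => <-; apply: eq_integral => x _; rewrite /f !indicE; congr ((_%:R)%:E); congr nat_of_bool.
  by apply/idP/idP; rewrite !inE ysectionE.
split.
  apply: (eq_measurable_fun (fubini_G nu f)).
    by move=> y; rewrite inE /= in_itv /= andbT => y0; exact: key.
  apply: measurable_funTS.
  exact: (@measurable_fun_fubini_tonelli_G _ _ mR mR R nu f mf f0).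
have := @fubini_tonelli _ _ mR mR R nu leb f mf f0.
have -> : \int[nu]_x \int[leb]_y f (x, y) = \int[nu]_(x in `[0%R, +oo[) (q x)%:E.
  rewrite [RHS]integral_mkcond; apply: eq_integral => x _; rewrite patchE.
  case: ifPn => x0.
    have lq : leb `[0%R, q x[%classic = (q x)%:E.
      rewrite lebesgue_measure_itv /= lte_fin.
      by case: ltgtP (q0 x) => // [_|<-] _; rewrite ?oppr0 ?adde0.
    have := @integral_indic _ mR R leb setT measurableT `[0%R, q x[%classic (measurable_itv _).
    rewrite setIT => H; apply: etrans (etrans H lq).
    apply: eq_integral => y _; rewrite /f !indicE; congr ((_%:R)%:E); congr nat_of_bool.
    move: x0; rewrite inE /= in_itv /= andbT => x0.
    by apply/idP/idP; rewrite !inE /S /= !in_itv /=; [case=> _ -> ->|move=> /andP[]].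
  rewrite integral0_eq// => y _; rewrite /f indicE; case: (boolP (_ \in S)) => //.
  rewrite inE => -[/= x1 _ _]; move/negP: x0; case; by rewrite inE /= in_itv /= x1.
move=> ->; rewrite [RHS]integral_mkcond; apply: eq_integral => y _; rewrite patchE.
case: ifPn => y0.
  by apply: key; move: y0; rewrite inE /= in_itv /= andbT.
rewrite integral0_eq// => x _; rewrite /f indicE; case: (boolP (_ \in S)) => //.
rewrite inE => -[/= _ y1 _]; move/negP: y0; case; by rewrite inE /= in_itv /= y1.
Qed.

Variable M : R -> \bar R.
Hypothesis mM : measurable_fun [set: mR] M.
Hypothesis M0 : forall x, 0 <= M x.
Hypothesis Mfin : forall x, (0 < x)%R -> M x \is a fin_num.
Hypothesis Mdec : forall x y, (0 < x)%R -> (x <= y)%R -> M y <= M x.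

(** As [M] is nonincreasing, the sets where [M (x + e)] exceeds a level are initial
    intervals, and each layer for the dilated function is such an interval scaled
    by [1 / l]. *)
Lemma dilation_integral_le (e : R) : (0 < e)%R ->
  \int[nu]_(x in `[0%R, +oo[) M (l * x + e)%R <= k%:E * shifted nu M e.
Proof.
move=> e0.
pose q (x : R) := fine (M (x + e)%R).
have q0 x : (0 <= q x)%R by exact: fine_ge0.
have mq : measurable_fun [set: mR] (q : mR -> R).
  have H : measurable_fun [set: mR] (fun x : mR => M (x + e)%R) by exact: measurable_comp_add.
  exact: (measurableT_comp (@fine_measurable R setT measurableT) H).
pose ql (x : R) := q (l * x)%R.
have mql : measurable_fun [set: mR] (ql : mR -> R).
  have H : measurable_fun [set: mR] ((fun x => l * x)%R : mR -> mR) by exact: measurable_funM.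
  exact: (measurableT_comp mq H).
have qE x : (0 <= x)%R -> (q x)%:E = M (x + e)%R.
  by move=> x0; rewrite fineK// Mfin// ltr_wpDl.
have [m1 L1] := integral_layer mq q0.
have [m2 L2] := integral_layer mql (fun x => q0 _).
have -> : shifted nu M e = \int[nu]_(x in `[0%R, +oo[) (q x)%:E.
  by apply: eq_integral => x; rewrite inE /= in_itv /= andbT => x0; rewrite qE.
have -> : \int[nu]_(x in `[0%R, +oo[) M (l * x + e)%R = \int[nu]_(x in `[0%R, +oo[) (ql x)%:E.
  by apply: eq_integral => x; rewrite inE /= in_itv /= andbT => x0; rewrite qE// mulr_ge0// ltW.
rewrite L1 L2 -ge0_integralZl//.
apply: ge0_le_integral => //.
  exact: measurable_funeM.
move=> h _; rewrite /layer.
pose I : set mR := [set x | (0 <= x)%R /\ (h < q x)%R].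
have -> : [set x : mR | (0 <= x)%R /\ (h < ql x)%R] = scaled I.
  apply/seteqP; split => x [x0 hx]; split => //; last by case: hx.
  by split => //; rewrite mulr_ge0// ltW.
apply: initial_segment_le => //.
- rewrite /I (_ : [set x | _] = `[0%R, +oo[%classic `&` (q @^-1` `]h, +oo[%classic)).
    apply: measurableI; first exact: measurable_itv.
    by rewrite -[X in measurable X]setTI; apply: mq => //; exact: measurable_itv.
  by apply/seteqP; split => x /=; rewrite !in_itv /= !andbT.
- by move=> x [].
- move=> x y [x0 hx] /andP[y0 yx]; split => //; apply: lt_le_trans hx _.
  rewrite -lee_fin !qE//; apply: Mdec; last by rewrite lerD2r.
  by rewrite ltr_wpDl.
Qed.

End LayerCake.
(** * Integrals of the square modulus along lines *)

Section Lines.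
Variable R : realType.
Local Notation leb := (@lebesgue_measure R).
Local Notation mR := (measurableTypeR R).
Local Notation C := (R[i]^o).
Local Open Scope ereal_scope.

(** Otherwise [H y + H (- y)] would stay above [e] on a half-line, and [H] would
    not be integrable. Heights of opposite signs are taken together because both
    horizontal sides of a rectangle have to be controlled at once. *)
Lemma exists_small_height (H : R -> \bar R) (T0 e : R) :
  measurable_fun [set: mR] H -> (forall y, 0 <= H y) -> \int[leb]_y H y < +oo ->
  (0 < e)%R -> exists2 T : R, (T0 < T)%R & H T + H (- T)%R <= e%:E.
Proof.
move=> mH H0 fH e0; apply: contrapT => N.
have big y : (T0 < y)%R -> e%:E <= H y + H (- y)%R.
  move=> Ty; rewrite leNgt; apply/negP => /ltW K; apply: N; by exists y.
have mHN : measurable_fun [set: mR] (fun y => H (- y)%R).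
  have mN : measurable_fun [set: mR] (-%R : mR -> mR) by exact: oppr_measurable.
  exact: (measurableT_comp mH mN).
have : \int[leb]_(y in `]T0, +oo[) e%:E <= \int[leb]_y (H y + H (- y)%R).
  rewrite integral_ind_mul; apply: ge0_le_integral => //.
  - by move=> y _; rewrite mule_ge0 ?lee_fin// ltW.
  - apply: emeasurable_funM => //; apply/measurable_EFinP; apply: measurable_indic.
    exact: measurable_itv.
  - exact: emeasurable_funD.
  move=> y _; rewrite indicE; case: (boolP (y \in _)) => [|_]; last by rewrite mul0e adde_ge0.
  by rewrite inE /= in_itv /= andbT mul1e; exact: big.
rewrite ge0_integralD// (ge0_integral_opp mH H0) leNgt => /negP; apply.
have lT : leb `]T0, +oo[%classic = +oo by rewrite lebesgue_measure_itv /= ltry.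
have := @integral_cst _ mR R leb `]T0, +oo[%classic (measurable_itv _) e%:E.
rewrite [X in _ = _ * X]lT gt0_muley ?lte_fin// => ->; exact: lte_add_pinfty.
Qed.

Lemma rintE (a b : R) (h : R -> R) : rsegc a b h ->
  (rint a b h)%:E = \int[leb]_(t in `[a, b]) (h t)%:E.
Proof.
move=> hc; rewrite /rint /Rintegral fineK//.
by apply: integrable_fin_num => //; exact: itv_integrable.
Qed.

Lemma cint_norm_le (a b : R) (u : R -> R[i]) : segc a b u ->
  (normc (cint a b u) <= 2 * rint a b (fun t => normc (u t)))%R.
Proof.
move=> hu.
have nc : rsegc a b (fun t => normc (u t)).
  move=> t tab; apply: (@continuous_comp R C R u normc t); [exact: hu|exact: normc_continuous].
have key (h : R -> R) : rsegc a b h -> (forall t, `|h t| <= normc (u t))%R ->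
    (`|rint a b h| <= rint a b (fun t => normc (u t)))%R.
  move=> hc hl; apply: le_trans (le_normr_Rintegral _ (itv_integrable hc)) _ => //.
  apply: (@rint_le R a b (fun t => `|h t|)%R _ _ nc); last by move=> t _; exact: hl.
  by move=> t tab; apply: continuous_comp; [exact: hc|exact: norm_continuous].
apply: le_trans (normc_le _) _; rewrite mulr2n mulrDl mul1r; apply: lerD.
- by apply: key => [|t]; [exact: segc_Re|exact: Re_le_normc].
- by apply: key => [|t]; [exact: segc_Im|exact: Im_le_normc].
Qed.

Variable f : R[i] -> R[i].
Hypothesis hf : hol f.

Let mq : measurable_fun setT (fun p : mR * mR => (sqmod f p)%:E).
Proof. by apply/measurable_EFinP; exact: measurable_sqmod. Qed.

Lemma sqmod_vcont (x c d : R) : (0 < x)%R -> rsegc c d (fun y => sqmod f (x, y)).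
Proof.
move=> x0 y _.
apply: (@continuous_comp R C R (fun y => (x +i* y)%C) (fun w => normc (f w) ^+ 2)%R y).
  exact: vline_continuous.
by apply: sqmod_continuous; apply: hf.1.
Qed.

Lemma sqmod_hcont (y a b : R) : (0 < a)%R -> rsegc a b (fun x => sqmod f (x, y)).
Proof.
move=> a0 x /andP[ax xb].
apply: (@continuous_comp R C R (fun x => (x +i* y)%C) (fun w => normc (f w) ^+ 2)%R x).
  exact: hline_continuous.
by apply: sqmod_continuous; apply: hf.1; exact: lt_le_trans ax.
Qed.

Hypothesis ffin : forall a b : R, (0 < a)%R -> \int[leb]_(x in `[a, b]) vint f x < +oo.

Definition hint (a b y : R) : \bar R := \int[leb]_(x in `[a, b]) (sqmod f (x, y))%:E.

(** The means over the horizontal segments are integrable with respect to the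
    height, by Tonelli's theorem, so there are arbitrarily large heights where
    they are small ([exists_small_height]). *)
Lemma small_hint (a b T0 e : R) : (0 < a)%R -> (0 < e)%R ->
  exists2 T : R, (T0 < T)%R & hint a b T + hint a b (- T)%R <= e%:E.
Proof.
move=> a0 e0.
pose k (p : mR * mR) := (\1_(`[a, b]%classic : set mR) p.1 : R)%:E * (sqmod f p)%:E.
have k0 p : 0 <= k p by rewrite mule_ge0// lee_fin sqmod_ge0.
have mk : measurable_fun setT k.
  apply: emeasurable_funM => //.
  have mI : measurable_fun [set: mR] (fun x => (\1_(`[a, b]%classic : set mR) x : R)%:E).
    by apply/measurable_EFinP; apply: measurable_indic; exact: measurable_itv.
  exact: (measurableT_comp mI (@measurable_fst _ _ mR mR)).
have hE y : hint a b y = \int[leb]_x k (x, y) by rewrite /hint integral_ind_mul.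
apply: exists_small_height => //.
- have := @measurable_fun_fubini_tonelli_G _ _ mR mR R leb k mk k0.
  by rewrite (_ : fubini_G leb k = hint a b)//; apply/funext => y; rewrite hE.
- by move=> y; apply: integral_ge0 => x _; rewrite lee_fin sqmod_ge0.
under eq_integral do rewrite hE.
rewrite -(@fubini_tonelli _ _ mR mR R leb leb k mk k0).
rewrite (_ : \int[leb]_x _ = \int[leb]_(x in `[a, b]) vint f x); first exact: ffin.
rewrite [RHS]integral_ind_mul; apply: eq_integral => x _.
rewrite /k /= ge0_integralZl//.
- have := @measurable_pair1 _ _ mR mR x.
  move=> mp; exact: (measurableT_comp mq mp).
- by move=> y _; rewrite lee_fin sqmod_ge0.
Qed.

End Lines.
(** * Convexity of the square means, and point evaluations *)

Section Midpoint.
Variable R : realType.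
Local Notation leb := (@lebesgue_measure R).
Local Notation mR := (measurableTypeR R).
Local Notation C := (R[i]^o).
Local Open Scope ereal_scope.

Lemma normc_conj (z : R[i]) : normc (z^*)%C = normc z.
Proof. by case: z => x y /=; rewrite sqrrN. Qed.

(** The reflection in the vertical line of abscissa [x]. *)
Definition vreflect (x : R) (z : R[i]) : R[i] := ((2 * x - Re z)%R +i* Im z)%C.

(** Two orientation reversing symmetries, reflection and conjugation, compose to a
    holomorphic operation; the derivative is minus the conjugate one. *)
Lemma cdiff_reflect (x : R) (f : R[i] -> R[i]) z : cdiff f (vreflect x z) ->
  cdiff (fun w => (f (vreflect x w))^*%C) z.
Proof.
move=> /cdiffP[D H]; apply/cdiffP; exists (- D^*%C)%R => e e0.
have [r r0 K] := H e e0; exists r => // w wz.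
have rE : (vreflect x w - vreflect x z = - (w - z)^*%C)%R.
  by case: w {wz} => w1 w2; case: z {H K} => z1 z2; apply: ceqP; rewrite /vreflect /=; ring.
have nE : normc (vreflect x w - vreflect x z)%R = normc (w - z)%R.
  by rewrite rE normc_opp normc_conj.
have := K (vreflect x w); rewrite nE => /(_ wz).
set u := f _; set v := f _; rewrite rE -(normc_conj (_ - _)%R).
apply: le_trans; rewrite le_eqVlt; apply/orP; left; apply/eqP; congr (normc _).
move: u v => [u1 u2] [v1 v2]; case: D {H K} => d1 d2.
case: w {wz rE nE} => w1 w2; case: z => z1 z2; apply: ceqP; rewrite /=; ring.
Qed.

Variable f : R[i] -> R[i].
Hypothesis hf : hol f.
Hypothesis ffin : forall a b : R, (0 < a)%R -> \int[leb]_(x in `[a, b]) vint f x < +oo.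

Let sq_ge0 p : 0 <= (sqmod f p)%:E. Proof. by rewrite lee_fin sqmod_ge0. Qed.

Let mq : measurable_fun setT (fun p : mR * mR => (sqmod f p)%:E).
Proof. by apply/measurable_EFinP; exact: measurable_sqmod. Qed.

Lemma measurable_vline (x : R) : measurable_fun [set: mR] (fun y : mR => (sqmod f (x, y))%:E).
Proof. have mp := @measurable_pair1 _ _ mR mR x; exact: (measurableT_comp mq mp). Qed.

Lemma measurable_hline (y : R) : measurable_fun [set: mR] (fun x : mR => (sqmod f (x, y))%:E).
Proof. have mp := @measurable_pair2 _ _ mR mR y; exact: (measurableT_comp mq mp). Qed.

Lemma vint_le (x B : R) : (0 < x)%R ->
  (forall T0 e : R, (0 < e)%R ->
     exists2 T, (T0 < T)%R & (rint (- T) T (fun y => sqmod f (x, y)) <= B + e)%R) ->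
  vint f x <= B%:E.
Proof.
move=> x0 H.
pose F n : set mR := `[(- n%:R)%R, n%:R]%classic.
have cv : \int[leb]_(y in F n) (sqmod f (x, y))%:E @[n --> \oo] --> vint f x.
  have -> : vint f x = \int[leb]_(y in \bigcup_n F n) (sqmod f (x, y))%:E.
    congr (integral _ _ _); apply/esym/seteqP; split => // y _.
    exists (Num.bound `|y|%R) => //; rewrite /F /= in_itv /= -ler_norml.
    exact: ltW (archi_boundP (normr_ge0 y)).
  apply: ge0_nondecreasing_set_cvg_integral => //.
  - move=> m n mn; apply/subsetPset => y; rewrite /F /= !in_itv /= => /andP[y1 y2].
    have mn' : (m%:R <= n%:R :> R)%R by rewrite ler_nat.
    by apply/andP; split; lra.
  - by move=> n; exact: measurable_itv.
  - by move=> n; apply: measurable_funTS; exact: measurable_vline.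
rewrite -(cvg_lim _ cv)//; apply: lime_le; first by apply/cvg_ex; eexists; exact: cv.
apply: nearW => n; apply/lee_addgt0Pr => e e0.
have [T nT hT] := H n%:R e e0.
rewrite -EFinD; apply: le_trans (_ : (rint (- T) T (fun y => sqmod f (x, y)))%:E <= _); last first.
  by rewrite lee_fin.
rewrite rintE; last exact: sqmod_vcont.
apply: ge0_subset_integral => //.
- exact: measurable_itv.
- by apply: measurable_funTS; exact: measurable_vline.
- by move=> y; rewrite /F /= !in_itv /= => /andP[y1 y2]; apply/andP; split; lra.
Qed.

Lemma rint_le_vint (x T : R) : (0 < x)%R ->
  (rint (- T) T (fun y => sqmod f (x, y)))%:E <= vint f x.
Proof.
move=> x0; rewrite rintE; last exact: sqmod_vcont.
by apply: ge0_subset_integral => //; exact: measurable_vline.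
Qed.

Lemma hintE (a b y : R) : (0 < a)%R -> hint f a b y = (rint a b (fun x => sqmod f (x, y)))%:E.
Proof. by move=> a0; rewrite rintE//; exact: sqmod_hcont. Qed.

Lemma hcont_refl (x y a b : R) : (b < 2 * x)%R -> rsegc a b (fun s => sqmod f ((2 * x - s)%R, y)).
Proof.
move=> bx s /andP[a1 sb].
have -> : (fun s => sqmod f ((2 * x - s)%R, y)) = (fun z : R => sqmod f (z, y)) \o (fun s => 2 * x - s)%R by [].
apply: continuous_comp.
  by apply: continuousB => //; exact: cst_continuous.
have := @sqmod_hcont _ _ hf y (2 * x - s)%R (2 * x - s)%R; apply; first lra.
by rewrite lexx.
Qed.

Lemma rint_refl_le (x t y : R) : (0 < t < x)%R ->
  (rint (x - t) x (fun s => sqmod f ((2 * x - s)%R, y)) <= rint (x - t) (x + t) (fun s => sqmod f (s, y)))%R.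
Proof.
move=> /andP[t0 tx]; rewrite -lee_fin rintE; last by apply: hcont_refl; lra.
rewrite rintE; last by apply: (sqmod_hcont hf); lra.
pose A : set mR := `[(x - t)%R, x]%classic.
have mA : measurable A by exact: measurable_itv.
have mIA : measurable_fun [set: mR] (fun x => (\1_A x : R)%:E).
  by apply/measurable_EFinP; exact: measurable_indic.
pose G (s : R) := (\1_A (2 * x - s)%R : R)%:E * (sqmod f (s, y))%:E.
have mG : measurable_fun [set: mR] G.
  apply: emeasurable_funM; last exact: measurable_hline.
  by apply: (@measurable_comp_sub _ _ _ _ (fun=> 2 * x)%R id mIA).
have G0 s : 0 <= G s by rewrite mule_ge0// lee_fin.
rewrite [leLHS]integral_ind_mul [leLHS](_ : _ = \int[leb]_s G (2 * x - s)%R); last first.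
  by apply: eq_integral => s _; rewrite /G subKr.
rewrite (ge0_integral_reflect _ mG G0) [leRHS]integral_ind_mul.
apply: ge0_le_integral => //.
- apply: emeasurable_funM; last exact: measurable_hline.
  by apply/measurable_EFinP; apply: measurable_indic; exact: measurable_itv.
move=> s _; rewrite /G lee_wpmul2r// lee_fin !indicE ler_nat.
case: (boolP (_ \in A)) => //; rewrite inE /A /= in_itv /= => /andP[s1 s2].
have -> : s \in (`[(x - t)%R, (x + t)%R]%classic : set mR).
  by rewrite inE /= in_itv /=; apply/andP; split; lra.
by [].
Qed.

(** Goursat's theorem for [g z = f z * conj (f (vreflect x z))] on the rectangle
    between the abscissas [x - t] and [x], at heights between [- T] and [T]. On the
    right side [g] is [|f|^2]; on the left side its norm is at most half the sum of
    [|f|^2] at the abscissas [x - t] and [x + t]; the horizontal sides are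
    negligible for a sequence of heights ([small_hint]). *)
Lemma vint_mid (x t : R) : (0 < t < x)%R ->
  2%:E * vint f x <= vint f (x - t)%R + vint f (x + t)%R.
Proof.
move=> /[dup] tx' /andP[t0 tx]; set a := (x - t)%R.
have a0 : (0 < a)%R by rewrite subr_gt0.
have xt0 : (0 < x + t)%R by lra.
have x0 : (0 < x)%R by lra.
have ax : (a <= x)%R by rewrite /a; lra.
have [fa|] := ltP (vint f a) +oo; last first.
  by rewrite leye_eq => /eqP ->; rewrite addye ?leey// gt_eqF// (lt_le_trans (ltNy0)) ?vint_ge0.
have [fb|] := ltP (vint f (x + t)%R) +oo; last first.
  by rewrite leye_eq => /eqP ->; rewrite addey ?leey// gt_eqF// (lt_le_trans (ltNy0)) ?vint_ge0.
have fin y : vint f y < +oo -> vint f y = (fine (vint f y))%:E.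
  by move=> h; rewrite fineK// ge0_fin_numE// vint_ge0.
rewrite (fin _ fa) (fin _ fb); set A := fine _; set B := fine _.
rewrite -EFinD -lee_pdivlMl// -EFinM; apply: vint_le => // T0 e e0.
have e4 : (0 < e / 2)%R by rewrite divr_gt0.
(* The reflection of the segment between the abscissas [x - t] and [x] ends at
   [x + t], so the smallness of [f] on the horizontal sides is asked up to there. *)
have [T] := small_hint hf ffin (x + t) (Num.max T0 0)%R a0 e4.
rewrite gt_max => /andP[T0T Tp] hT; exists T => //.
rewrite !hintE// -EFinD lee_fin in hT.
have TT : (- T <= T)%R by lra.
pose g z := (f z * (f (vreflect x z))^*%C)%R.
have dg z : (0 < Re z < 2 * x)%R -> cdiff g z.
  move=> /andP[z1 z2].
  have d1 : cdiff f z by exact: hf.1.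
  have d2 : cdiff (fun w => (f (vreflect x w))^*%C) z.
    by apply: cdiff_reflect; apply: hf.1; rewrite /vreflect /= subr_gt0.
  exact: (@cdiffM R f (fun w => (f (vreflect x w))^*%C) z d1 d2).
have dr z : rect a x (- T) T z -> cdiff g z.
  by case=> /andP[z1 z2] _; apply: dg; apply/andP; split; lra.
have bg : bcont a x (- T) T g by move=> z zb; exact: (cdiff_continuous (dr z zb.1)).
have := goursat ax TT dr; rewrite /bint.
set ch := cint _ _ _; set cv := cint _ _ _ => /eqP; rewrite addr_eq0 => /eqP chv.
have nv : normc cv = normc ch.
  rewrite chv normc_opp Normc.normcM (_ : normc 'i%C = 1%R) ?mul1r//.
  by rewrite /= expr0n expr1n add0r sqrtr1.
have ng s y : (normc (g (s +i* y)%C) <= (sqmod f (s, y) + sqmod f ((2 * x - s)%R, y)) / 2)%R.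
  rewrite /g Normc.normcM normc_conj /sqmod /vreflect /=.
  set p := normc _; set q := normc _; have := sqr_ge0 (p - q)%R; rewrite sqrrB; lra.
have hl y : (rint a x (fun s => normc (g (s +i* y)%C)) <= rint a (x + t) (fun s => sqmod f (s, y)))%R.
  have c1 : rsegc a x (fun s => sqmod f (s, y)) by exact: sqmod_hcont.
  have c2 : rsegc a x (fun s => sqmod f ((2 * x - s)%R, y)) by apply: hcont_refl; lra.
  have c12 : rsegc a x (fun s => sqmod f (s, y) + sqmod f ((2 * x - s)%R, y))%R.
    by move=> s sax; apply: continuousD; [exact: c1|exact: c2].
  apply: (@le_trans _ _ (rint a x (fun s => 2^-1 * (sqmod f (s, y) + sqmod f ((2 * x - s)%R, y)))%R)).
    apply: rint_le; last by move=> s _; rewrite mulrC.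
    - move=> s sax; apply: (@continuous_comp R C R (fun s => g (s +i* y)%C) normc s).
        apply: (@continuous_comp R C C (fun s => (s +i* y)%C) g s); first exact: hline_continuous.
        by apply: cdiff_continuous; apply: dg; case/andP: sax => ? ? /=; apply/andP; split; lra.
      exact: normc_continuous.
    - exact: rsegcZ.
  rewrite rintZ// rintD//.
  have r1 : (rint a x (fun s => sqmod f (s, y)) <= rint a (x + t) (fun s => sqmod f (s, y)))%R.
    rewrite -lee_fin !rintE//; last exact: sqmod_hcont.
    apply: ge0_subset_integral => //.
    - by apply: measurable_funTS; exact: measurable_hline.
    - by move=> s; rewrite /= !in_itv /= => /andP[s1 s2]; apply/andP; split; lra.
  have r2 := rint_refl_le y tx'; rewrite -/a in r2; lra.
have hch : (normc ch <= 2 * (e / 2))%R.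
  have sc y : segc a x (fun s => g (s +i* y)%C).
    apply: hseg => s sax; apply: cdiff_continuous; apply: dg.
    by case/andP: sax => ? ? /=; apply/andP; split; lra.
  have nc y : rsegc a x (fun s => normc (g (s +i* y)%C)).
    move=> s sax; apply: (@continuous_comp R C R (fun s => g (s +i* y)%C) normc s); first exact: sc.
    exact: normc_continuous.
  apply: le_trans (cint_norm_le _) _; first exact: segcB.
  rewrite ler_pM2l//; apply: le_trans hT; rewrite addrC.
  apply: le_trans (lerD (hl (- T)%R) (hl T)).
  rewrite -rintD//; apply: rint_le.
  - move=> s sax.
    apply: (@continuous_comp R C R (fun s => g (s +i* - T)%C - g (s +i* T)%C)%R normc s).
      exact: (segcB (sc (- T)%R) (sc T) sax).
    exact: normc_continuous.
  - by move=> s sax; apply: continuousD; exact: nc.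
  - by move=> s _; apply: le_trans (normcD _ _) _; rewrite normc_opp.
have vc1 : rsegc (- T) T (fun y => sqmod f (x, y)) by exact: sqmod_vcont.
have vc2 : rsegc (- T) T (fun y => sqmod f (a, y)) by exact: sqmod_vcont.
have vc3 : rsegc (- T) T (fun y => sqmod f ((x + t)%R, y)) by exact: sqmod_vcont.
have vc23 : rsegc (- T) T (fun y => sqmod f (a, y) + sqmod f ((x + t)%R, y))%R.
  by move=> s sax; apply: continuousD; [exact: vc2|exact: vc3].
have vcs := segcB (@bcont_v2 R a x (- T) T ax g bg) (@bcont_v1 R a x (- T) T ax g bg).
have lower : (rint (- T) T (fun y => sqmod f (x, y)) -
    2^-1 * (rint (- T) T (fun y => sqmod f (a, y)) + rint (- T) T (fun y => sqmod f ((x + t)%R, y)))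
   <= normc ch)%R.
  rewrite -nv; apply: le_trans (Re_le_normc _); apply: le_trans (ler_norm _).
  rewrite -rintD// -rintZ// -rintB//; last exact: rsegcZ.
  apply: rint_le.
  - move=> s sax; apply: continuousB; first exact: vc1.
    exact: (rsegcZ (c := 2^-1%R) vc23 sax).
  - exact: segc_Re vcs.
  move=> y _; rewrite ReD ReN lerD//.
    rewrite /g /vreflect /= (_ : 2 * x - x = x)%R; last by ring.
    rewrite /sqmod /= sqr_normcE; case: (f _) => p q /=; rewrite mulrN opprK -!expr2//.
  rewrite lerN2 (le_trans (ler_norm _))// (le_trans (Re_le_normc _))// (le_trans (ng _ _))//.
  by rewrite mulrC (_ : 2 * x - a = x + t)%R//; rewrite /a; ring.
have ra := rint_le_vint T a0; have rb := rint_le_vint T xt0.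
rewrite (fin _ fa) lee_fin in ra; rewrite (fin _ fb) lee_fin in rb.
rewrite -/A in ra; rewrite -/B in rb; lra.
Qed.

(** Cauchy's formula for [f^2] on a rectangle centred at the abscissa of [s], of
    half-width [t] and of large height. The kernel is at most [1 / t] on the
    boundary, the vertical sides give the two square means, and the horizontal
    ones are negligible by [small_hint]. *)
Lemma pointwise_le (s : R[i]) (t : R) : (0 < t < Re s)%R ->
  (normc (f s) ^+ 2)%:E <= (2 / t)%:E * (vint f (Re s - t)%R + vint f (Re s + t)%R).
Proof.
move=> /andP[t0 ts]; set a := (Re s - t)%R; set b := (Re s + t)%R.
have a0 : (0 < a)%R by rewrite subr_gt0.
have b0 : (0 < b)%R by rewrite /b; lra.
have hs1 : (a < Re s < b)%R by rewrite /a /b; apply/andP; split; lra.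
have ab : (a <= b)%R by case/andP: hs1 => ? ?; lra.
have t2 : (0 < 2 / t)%R by rewrite divr_gt0.
have sum0 : 0 <= vint f a + vint f b by rewrite adde_ge0// vint_ge0.
have [fs|] := ltP (vint f a + vint f b) +oo; last first.
  by rewrite leye_eq => /eqP ->; rewrite gt0_muley ?lte_fin// leey.
have fin y : vint f y <= vint f a + vint f b -> vint f y = (fine (vint f y))%:E.
  by move=> h; rewrite fineK// ge0_fin_numE ?vint_ge0// (le_lt_trans h).
have fa := fin a (leeDl _ (vint_ge0 f b)); have fb := fin b (leeDr _ (vint_ge0 f a)).
rewrite fa fb; set A := fine _; set B := fine _.
rewrite -EFinD -EFinM lee_fin; apply/ler_addgt0Pr => e e0.
have e2 : (0 < e / (2 / t))%R by rewrite divr_gt0.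
have [T] := small_hint hf ffin b (`|Im s| + t)%R a0 e2.
rewrite !hintE// -EFinD lee_fin => hT hh.
have sT : (`|Im s| < T - t)%R by lra.
move: sT; rewrite ltr_norml => /andP[sT1 sT2].
have hs2 : (- T < Im s < T)%R by apply/andP; split; lra.
have TT : (- T <= T)%R by case/andP: hs2 => ? ?; lra.
pose g z := (f z * f z)%R.
have dr z : rect a b (- T) T z -> cdiff g z.
  case=> /andP[z1 z2] _; have d1 : cdiff f z by apply: hf.1; exact: lt_le_trans z1.
  exact: (@cdiffM R f f z d1 d1).
have CF := cauchy_formula hs1 hs2 dr.
have i1 := bcont_inv hs1 hs2.
have bg : bcont a b (- T) T g by move=> z zb; exact: (cdiff_continuous (dr z zb.1)).
have bq := bcontM bg i1.
have KB : (1 <= normc (ckernel a b (- T) T s))%R.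
  apply: le_trans (@ckernel_ge R a b (- T) T s hs1 hs2 t t0 _ _); [|lra|lra].
  have -> : (b - Re s = t)%R by rewrite /b; ring.
  have tt : (0 < t ^+ 2 + t ^+ 2)%R by rewrite addr_gt0// exprn_gt0.
  by rewrite mulrA ler_pdivlMr// mul1r le_eqVlt; apply/orP; left; apply/eqP; ring.
have h1 : (normc (f s) ^+ 2 <= normc (bint a b (- T) T (fun z => g z * (z - s)^-1)))%R.
  rewrite CF Normc.normcM /g Normc.normcM -expr2.
  by rewrite -[leLHS]mulr1 ler_wpM2l// sqr_ge0.
apply: le_trans h1 _; rewrite /bint.
have gE x y : normc (g (x +i* y)%C) = sqmod f (x, y) by rewrite /g Normc.normcM /sqmod expr2.
have dist_le z : (t <= normc (z - s))%R -> (normc (g z * (z - s)^-1) <= t^-1 * normc (g z))%R.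
  move=> tz; rewrite Normc.normcM Normc.normcV mulrC ler_wpM2r ?normc_ge0//.
  by rewrite lef_pV2 ?posrE// (lt_le_trans t0).
apply: le_trans (normcD _ _) _; rewrite Normc.normcM (_ : normc 'i%C = 1%R); last first.
  by rewrite /= expr0n expr1n add0r sqrtr1.
rewrite mul1r.
have hc1 := @sqmod_hcont R f hf (- T)%R a b a0; have hc2 := @sqmod_hcont R f hf T a b a0.
have hb : (normc (cint a b (fun x => g (x +i* - T)%C * ((x +i* - T)%C - s)^-1 - g (x +i* T)%C * ((x +i* T)%C - s)^-1))
   <= 2 * (t^-1 * (rint a b (fun x => sqmod f (x, - T)%R) + rint a b (fun x => sqmod f (x, T)))))%R.
  apply: le_trans (cint_norm_le _) _; first exact: (bcont_h TT bq).
  rewrite ler_pM2l// -rintD// -rintZ; last by move=> u uab; apply: continuousD; [exact: hc1|exact: hc2].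
  apply: rint_le.
  - move=> u uab; apply: (@continuous_comp R C R (fun x => g (x +i* - T)%C * ((x +i* - T)%C - s)^-1 - g (x +i* T)%C * ((x +i* T)%C - s)^-1)%R normc u).
      exact: (bcont_h TT bq).
    exact: normc_continuous.
  - by apply: rsegcZ => u uab; apply: continuousD; [exact: hc1|exact: hc2].
  move=> u _; apply: le_trans (normcD _ _) _; rewrite normc_opp -!gE mulrDr.
  apply: lerD; apply: dist_le; apply: le_trans (Im_le_normc _); rewrite ImD ImN /=.
  - by rewrite ler_normr; apply/orP; right; lra.
  - by rewrite ler_normr; apply/orP; left; lra.
have vc1 := @sqmod_vcont R f hf a (- T)%R T a0; have vc2 := @sqmod_vcont R f hf b (- T)%R T b0.
have vb : (normc (cint (- T) T (fun y => g (b +i* y)%C * ((b +i* y)%C - s)^-1 - g (a +i* y)%C * ((a +i* y)%C - s)^-1))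
   <= 2 * (t^-1 * (rint (- T) T (fun y => sqmod f (b, y)) + rint (- T) T (fun y => sqmod f (a, y)))))%R.
  apply: le_trans (cint_norm_le _) _; first exact: (bcont_v ab bq).
  rewrite ler_pM2l// -rintD// -rintZ; last by move=> u uab; apply: continuousD; [exact: vc2|exact: vc1].
  apply: rint_le.
  - move=> u uab; apply: (@continuous_comp R C R (fun y => g (b +i* y)%C * ((b +i* y)%C - s)^-1 - g (a +i* y)%C * ((a +i* y)%C - s)^-1)%R normc u).
      exact: (bcont_v ab bq).
    exact: normc_continuous.
  - by apply: rsegcZ => u uab; apply: continuousD; [exact: vc2|exact: vc1].
  move=> u _; apply: le_trans (normcD _ _) _; rewrite normc_opp -!gE mulrDr.
  apply: lerD; apply: dist_le; apply: le_trans (Re_le_normc _); rewrite ReD ReN /=.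
  - by rewrite ler_normr; apply/orP; left; rewrite /b; lra.
  - by rewrite ler_normr; apply/orP; right; rewrite /a; lra.
have ra := rint_le_vint T a0; have rb := rint_le_vint T b0.
rewrite fa lee_fin -/A in ra; rewrite fb lee_fin -/B in rb.
apply: le_trans (lerD hb vb) _.
apply: (@le_trans _ _ (2 / t * (A + B + e / (2 / t)))%R); last first.
  by rewrite mulrDr [X in (_ + X <= _)%R]mulrC divfK// gt_eqF.
rewrite !mulrA -mulrDr ler_pM2l//; lra.
Qed.

End Midpoint.
(** * Dilations in the Zen norm *)

Section ZenBounds.
Variable R : realType.
Local Notation leb := (@lebesgue_measure R).
Local Notation mR := (measurableTypeR R).
Local Open Scope ereal_scope.
Variable nu : {sigma_finite_measure set mR -> \bar R}.
Hypothesis hnu : forall t : R, (0 < t)%R -> 0 < initial_mass nu t < +oo.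

(** The square of the Zen norm, for functions in extended form ([zen_sqnormE]). *)
Definition norm2 (f : R[i] -> R[i]) : \bar R :=
  ereal_sup [set shifted nu (vint f) e | e in [set e : R | (0 < e)%R]].

Lemma shifted_le_norm2 f (e : R) : (0 < e)%R -> shifted nu (vint f) e <= norm2 f.
Proof. by move=> e0; apply: ereal_sup_ubound; exists e. Qed.

Lemma norm2_le f (B : \bar R) : (forall e : R, (0 < e)%R -> shifted nu (vint f) e <= B) ->
  norm2 f <= B.
Proof. by move=> H; apply: ge_ereal_sup => _ [e e0 <-]; exact: H. Qed.

Lemma norm2_ge0 f : 0 <= norm2 f.
Proof.
apply: le_trans (shifted_le_norm2 f ltr01).
by apply: integral_ge0 => x _; exact: vint_ge0.
Qed.

Section OneFunction.
Variable f : R[i] -> R[i].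
Hypothesis hf : hol f.
Hypothesis ff : norm2 f < +oo.

Let N : R := fine (norm2 f).

Lemma norm2E : norm2 f = N%:E.
Proof. by rewrite fineK// ge0_fin_numE// norm2_ge0. Qed.

Let MN e : (0 < e)%R -> shifted nu (vint f) e <= N%:E.
Proof. by move=> e0; rewrite -norm2E; exact: shifted_le_norm2. Qed.

Let mM := measurable_vint hf.
Let M0 := vint_ge0 f.

(** The convexity of [vint f] rests on heights where [f] is small in mean, hence on
    this integrability, which [strip_bound] gives for any profile. *)
Lemma strip_fin (a b : R) : (0 < a)%R -> \int[leb]_(x in `[a, b]) vint f x < +oo.
Proof.
move=> a0; have [ab|ba] := leP a b; last first.
  by rewrite set_itv_ge ?integral_set0// bnd_simp -ltNge.
have h0 : (0 < a / 2 < a)%R by apply/andP; split; lra.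
have := strip_bound mM M0 MN h0 ab.
have h1 : (0 < a / 2)%R by case/andP: h0.
rewrite (massE hnu h1) -EFinM => H; rewrite ltey; apply/eqP => E; move: H.
by rewrite E gt0_muley ?lte_fin ?mass_gt0// leye_eq.
Qed.

Let mid := vint_mid hf strip_fin.

Lemma vint_fin x : (0 < x)%R -> vint f x \is a fin_num.
Proof. exact: (mid_fin hnu mM M0 mid MN). Qed.

Lemma vint_nonincreasing (x y : R) : (0 < x)%R -> (x <= y)%R -> vint f y <= vint f x.
Proof. exact: (mid_nonincreasing hnu mM M0 mid MN). Qed.

(** Point evaluations are bounded, uniformly for [Re s >= a]: [pointwise_le] with
    [t = a / 2], and then [mid_bound] with [h = a / 8] at the two abscissas
    [Re s - t] and [Re s + t], which are at least [a / 2]. *)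
Lemma zen_pointwise (a : R) (s : R[i]) : (0 < a)%R -> (a <= Re s)%R ->
  (normc (f s) ^+ 2 <= 12 / (a * mass nu (a / 8)) * N)%R.
Proof.
move=> a0 as_; have h8 : (0 < a / 8)%R by lra.
have t0 : (0 < a / 2 < Re s)%R by apply/andP; split; lra.
have m0 := mass_gt0 hnu h8.
have b1 : vint f (Re s - a / 2)%R <= (3 / (2 * mass nu (a / 8)) * N)%:E.
  by apply: (mid_bound hnu mM M0 mid MN h8); lra.
have b2 : vint f (Re s + a / 2)%R <= (3 / (2 * mass nu (a / 8)) * N)%:E.
  by apply: (mid_bound hnu mM M0 mid MN h8); lra.
rewrite -lee_fin; apply: le_trans (pointwise_le hf strip_fin t0) _.
have c0 : 0 <= (2 / (a / 2))%:E by rewrite lee_fin divr_ge0// ltW// divr_gt0.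
apply: le_trans (lee_wpmul2l c0 (leeD b1 b2)) _.
rewrite -EFinD -EFinM lee_fin le_eqVlt; apply/orP; left; apply/eqP; field.
by rewrite !gt_eqF.
Qed.

Lemma dilate_hol (l : R) : (0 < l)%R -> hol (fun z => f (l%:C%C * z)%R).
Proof.
move=> l0; split => z z0; last first.
  by apply: hf.2; rewrite ReM /= mul0r subr0 mulr_ge0_le0// ltW.
have d1 : cdiff f (l%:C%C * z)%R by apply: hf.1; rewrite ReM /= mul0r subr0 mulr_gt0.
have /cdiffP[D H] := d1; apply/cdiffP; exists (D * l%:C%C)%R => e e0.
have [r r0 K] := H (e / l)%R (divr_gt0 e0 l0); exists (r / l)%R; first by rewrite divr_gt0.
move=> w wz; have nE : normc (l%:C%C * w - l%:C%C * z)%R = (l * normc (w - z))%R.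
  by rewrite -mulrBr Normc.normcM normcR gtr0_norm.
have := K (l%:C%C * w)%R; rewrite nE mulrC -ltr_pdivlMr// => /(_ wz).
rewrite -mulrBr !mulrA (_ : e / l * normc (w - z) * l = e * normc (w - z))%R//.
by rewrite mulrAC divfK// gt_eqF.
Qed.

Lemma vint_dilate (l x : R) : (0 < l)%R -> (0 < x)%R ->
  vint (fun z => f (l%:C%C * z)%R) x = (l^-1)%:E * vint f (l * x)%R.
Proof.
move=> l0 x0; have lx0 : (0 < l * x)%R by rewrite mulr_gt0.
have H := @ge0_integral_affine R l 0%R (fun y => (sqmod f ((l * x)%R, y))%:E) l0
  (measurable_vline hf (l * x)%R) (fun y => _).
rewrite /vint -H; last by move=> y; rewrite lee_fin sqmod_ge0.
rewrite muleA -EFinM mulVf ?gt_eqF// mul1e; apply: eq_integral => y _.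
rewrite /sqmod /= addr0; congr ((normc (f _) ^+ 2)%:E)%R.
by apply: ceqP => /=; ring.
Qed.

(** The main estimate: as [vint f] is nonincreasing, [dilation_integral_le] applies
    to it, and dilating by [l] divides the square means by [l]. *)
Lemma norm2_dilate (l k : R) : (0 < l)%R -> (0 <= k)%R ->
  (forall t : R, (0 < t)%R -> initial_mass nu (t / l) <= k%:E * initial_mass nu t) ->
  norm2 (fun z => f (l%:C%C * z)%R) <= (k / l)%:E * norm2 f.
Proof.
move=> l0 k0 lk; apply: norm2_le => e e0.
have le0 : (0 < l * e)%R by rewrite mulr_gt0.
have h := dilation_integral_le hnu l0 k0 lk mM M0 vint_fin vint_nonincreasing le0.
have -> : shifted nu (vint (fun z => f (l%:C%C * z)%R)) e =
   (l^-1)%:E * \int[nu]_(x in `[0%R, +oo[) vint f (l * x + l * e)%R.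
  rewrite -ge0_integralZl//.
  - apply: eq_integral => x; rewrite inE /= in_itv /= andbT => x0.
    by rewrite vint_dilate ?ltr_wpDl// mulrDr.
  - apply: measurable_funTS.
    have m1 : measurable_fun [set: mR] ((fun x => l * x)%R : mR -> mR) by exact: measurable_funM.
    exact: (measurable_comp_add mM m1).
  - by rewrite lee_fin invr_ge0 ltW.
have -> : (k / l)%:E * norm2 f = (l^-1)%:E * (k%:E * norm2 f) by rewrite muleA -EFinM mulrC.
apply: lee_wpmul2l; first by rewrite lee_fin invr_ge0 ltW.
apply: le_trans h _; apply: lee_wpmul2l; first by rewrite lee_fin.
exact: shifted_le_norm2.
Qed.

End OneFunction.

Lemma norm2_le_comb f g h (p q : R) : hol f -> hol g -> hol h -> (0 <= p)%R -> (0 <= q)%R ->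
  (forall z, normc (h z) ^+ 2 <= p * normc (f z) ^+ 2 + q * normc (g z) ^+ 2)%R ->
  norm2 h <= p%:E * norm2 f + q%:E * norm2 g.
Proof.
move=> hf hg hh p0 q0 H; apply: norm2_le => e e0.
have v x : vint h x <= p%:E * vint f x + q%:E * vint g x.
  rewrite /vint -!ge0_integralZl//; try (by move=> y _; rewrite lee_fin sqmod_ge0);
    try exact: measurable_vline.
  rewrite -ge0_integralD//; try (by move=> y _; rewrite -EFinM lee_fin mulr_ge0// sqmod_ge0);
    try (apply: measurable_funeM; exact: measurable_vline).
  apply: ge0_le_integral => //.
  - by move=> y _; rewrite lee_fin sqmod_ge0.
  - exact: measurable_vline.
  - by apply: emeasurable_funD; apply: measurable_funeM; exact: measurable_vline.
  - by move=> y _; rewrite -!EFinM -EFinD lee_fin; exact: H.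
have ms k : hol k -> measurable_fun (`[0%R, +oo[%classic : set mR) (fun x => vint k (x + e)%R).
  move=> hk; apply: measurable_funTS.
  exact: (@measurable_comp_add _ _ _ _ id (fun=> e) (measurable_vint hk)).
apply: (@le_trans _ _ (p%:E * shifted nu (vint f) e + q%:E * shifted nu (vint g) e)); last first.
  by apply: leeD; apply: lee_wpmul2l; rewrite ?lee_fin//; exact: shifted_le_norm2.
rewrite /shifted -!ge0_integralZl//; try (by move=> x _; exact: vint_ge0); try exact: ms.
rewrite -ge0_integralD//; try (by move=> x _; rewrite mule_ge0// vint_ge0);
  try (by apply: measurable_funeM; exact: ms).
apply: ge0_le_integral => //.
- by move=> x _; exact: vint_ge0.
- exact: ms.
- by apply: emeasurable_funD; apply: measurable_funeM; exact: ms.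
Qed.

End ZenBounds.
(** * Neumann series in a dilation *)

Section ComplexLimits.
Variable R : realType.

Lemma cauchy_rate (u r : nat -> R) :
  (forall n m, (n <= m)%N -> `|u m - u n| <= r n) ->
  (forall e, 0 < e -> exists n, r n < e) ->
  forall n, `|limn u - u n| <= r n.
Proof.
move=> ur r0.
have cu : cvgn u.
  apply/cauchy_cvgP; apply: cauchy_exP => e e0.
  have [n hn] := r0 e e0; exists (u n); exists n => // m /= nm.
  by rewrite /ball /= distrC; apply: le_lt_trans hn; exact: ur.
move=> n; apply/ler_addgt0Pr => e e0.
have /cvgrPdist_lt /(_ e e0) [N _ HN] := cu.
have := HN (maxn n N) (leq_maxr _ _) => /= h1.
have h2 := ur n (maxn n N) (leq_maxl _ _).
rewrite -[limn u - u n](subrKA (u (maxn n N))).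
by apply: le_trans (ler_normD _ _) _; rewrite addrC lerD// ltW.
Qed.

(** Convergence in terms of the real norm, which combines directly with the
    quantitative bounds on the partial sums. *)
Definition clim (u : nat -> R[i]) (L : R[i]) :=
  forall e, 0 < e -> exists N, forall n, (N <= n)%N -> normc (u n - L) <= e.

Lemma clim_unique u L L' : clim u L -> clim u L' -> L = L'.
Proof.
move=> h h'; apply/eqP; rewrite -subr_eq0 -normc_eq0 eq_le normc_ge0 andbT.
apply/ler_addgt0Pr => e e0; rewrite add0r.
have e2 : 0 < e / 2 by rewrite divr_gt0.
have [N HN] := h _ e2; have [N' HN'] := h' _ e2.
apply: le_trans (normc_dist3 (u (maxn N N')) _ _) _.
rewrite normcB [e]splitr; apply: lerD; [apply: HN|apply: HN'].
- exact: leq_maxl.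
- exact: leq_maxr.
Qed.

Lemma climD u v L L' : clim u L -> clim v L' -> clim (fun n => u n + v n) (L + L').
Proof.
move=> h h' e e0.
have e2 : 0 < e / 2 by rewrite divr_gt0.
have [N HN] := h _ e2; have [N' HN'] := h' _ e2.
exists (maxn N N') => n; rewrite geq_max => /andP[n1 n2].
rewrite opprD addrACA; apply: le_trans (normcD _ _) _.
by rewrite [e]splitr; apply: lerD; auto.
Qed.

Lemma climZ k u L : clim u L -> clim (fun n => k * u n) (k * L).
Proof.
move=> h e e0; have k1 : 0 < normc k + 1 by rewrite ltr_wpDl// normc_ge0.
have [N HN] := h _ (divr_gt0 e0 k1); exists N => n /HN H.
rewrite -mulrBr Normc.normcM; apply: le_trans (ler_wpM2l (normc_ge0 k) H) _.
by rewrite mulrA ler_pdivrMr// mulrC ler_pM2l// lerDl.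
Qed.

Lemma clim_cst L : clim (fun=> L) L.
Proof. by move=> e e0; exists 0%N => n _; rewrite subrr Normc.normc0 ltW. Qed.

Lemma clim_shift u L : clim u L -> clim (fun n => u n.+1) L.
Proof.
move=> h e e0; have [N HN] := h e e0; exists N => n Nn; apply: HN.
exact: leq_trans Nn (leqnSn _).
Qed.

(** Cauchy-Schwarz against a geometric weight, by induction on the number of
    terms: one step is
    [(x + y)^2 <= x^2 / (1 - q) + y^2 / q]. *)
Lemma weighted_square_sum (q : R) n (u : nat -> R[i]) : 0 < q < 1 ->
  normc (\sum_(i < n) u i) ^+ 2 <= (1 - q)^-1 * \sum_(i < n) q ^- i * normc (u i) ^+ 2.
Proof.
move=> /andP[q0 q1]; have q2 : 0 < 1 - q by rewrite subr_gt0.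
elim: n u => [u|n IH u]; first by rewrite !big_ord0 Normc.normc0 expr0n mulr0.
rewrite !big_ord_recl /= expr0 invr1 mul1r.
set a := u 0%N; set b := \sum_(i < n) u (bump 0 i).
have {}IH := IH (fun i => u (bump 0 i)); rewrite -/b in IH.
have -> : \sum_(i < n) q ^- bump 0 i * normc (u (bump 0 i)) ^+ 2 =
   q^-1 * \sum_(i < n) q ^- i * normc (u (bump 0 i)) ^+ 2.
  rewrite mulr_sumr; apply: eq_bigr => i _.
  by rewrite /bump /= add1n exprS invfM mulrA.
rewrite mulrDr [(1 - q)^-1 * (q^-1 * _)]mulrCA; apply: le_trans (_ : (1 - q)^-1 * normc a ^+ 2 + q^-1 * normc b ^+ 2 <= _); last first.
  by rewrite lerD2l ler_wpM2l// invr_ge0 ltW.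
have h : normc (a + b) ^+ 2 <= (normc a + normc b) ^+ 2.
  by rewrite ler_pXn2r ?nnegrE ?addr_ge0 ?normc_ge0// normcD.
apply: le_trans h _; set x := normc a; set y := normc b.
rewrite -subr_ge0.
have -> : (1 - q)^-1 * x ^+ 2 + q^-1 * y ^+ 2 - (x + y) ^+ 2 =
   (q * x - (1 - q) * y) ^+ 2 / (q * (1 - q)).
  by field; rewrite !gt_eqF.
by rewrite divr_ge0 ?sqr_ge0// mulr_ge0 ?ltW.
Qed.

Lemma geometric_small (C q : R) : 0 < q < 1 -> forall e, 0 < e -> exists n, C * q ^+ n < e.
Proof.
move=> /andP[q0 q1] e e0.
have := @cvg_geometric R C q; rewrite ger0_norm ?ltW// => /(_ q1) /cvgrPdist_lt /(_ e e0)[n _ /(_ n (leqnn n))] /=.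
rewrite sub0r normrN => K; exists n.
by apply: le_lt_trans K; rewrite /geometric /=; exact: ler_norm.
Qed.

End ComplexLimits.

Lemma measurable_nneseries d (T : measurableType d) (R : realType) (D : set T)
    (h : nat -> T -> \bar R) :
  (forall i, measurable_fun D (h i)) -> (forall i x, D x -> (0 <= h i x)%E) ->
  measurable_fun D (fun x => \sum_(0 <= i <oo) h i x)%E.
Proof.
by move=> mh h0; apply: (@ge0_emeasurable_sum _ _ _ _ h xpredT) => // i x Dx _; exact: h0.
Qed.

Section Neumann.
Variable R : realType.
Local Notation leb := (@lebesgue_measure R).
Local Notation mR := (measurableTypeR R).
Variable nu : {sigma_finite_measure set mR -> \bar R}.
Hypothesis hnu : forall t : R, 0 < t -> (0 < initial_mass nu t < +oo)%E.
Variables (c : R[i]) (l q K : R).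
Hypotheses (l0 : 0 < l) (q01 : 0 < q < 1) (K0 : 0 <= K).

(** For [c] and [l] with [D f z = f (l z)], this is [(c D)^i f]. The hypothesis
    [HK] below is stated for the square of the norm, so that the norms of these
    terms decay like [q^i]. *)
Definition neumann_term (f : R[i] -> R[i]) (i : nat) (z : R[i]) : R[i] :=
  c ^+ i * f ((l ^+ i)%:C%C * z).

Hypothesis HK : forall i f, hol f -> (norm2 nu f < +oo)%E ->
  (norm2 nu (neumann_term f i) <= (K * (q ^+ 2) ^+ i)%:E * norm2 nu f)%E.

Definition neumann_part f n z := \sum_(i < n) neumann_term f i z.

(** The sum of the series, the value of [(1 - c D)^-1] at [f]. *)
Definition neumann f z : R[i] :=
  Complex (limn (fun n => Re (neumann_part f n z))) (limn (fun n => Im (neumann_part f n z))).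

Lemma hol0 : hol (fun=> 0 : R[i]).
Proof. by split => // z _; exact: cdiff_cst. Qed.

Lemma holD (f g : R[i] -> R[i]) : hol f -> hol g -> hol (fun z => f z + g z).
Proof.
move=> [df f0] [dg g0]; split => z z0; last by rewrite f0// g0// addr0.
exact: (@cdiffD R f g z (df z z0) (dg z z0)).
Qed.

Lemma holZ k (f : R[i] -> R[i]) : hol f -> hol (fun z => k * f z).
Proof.
move=> [df f0]; split => z z0; last by rewrite f0// mulr0.
exact: (@cdiffM R (fun=> k) f z (@cdiff_cst R k z) (df z z0)).
Qed.

Lemma hol_term f i : hol f -> hol (neumann_term f i).
Proof. by move=> hf; apply: holZ; apply: dilate_hol => //; rewrite exprn_gt0. Qed.

Lemma hol_part f n : hol f -> hol (neumann_part f n).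
Proof.
move=> hf; elim: n => [|n IH].
  by rewrite (_ : neumann_part f 0 = fun=> 0); [exact: hol0|apply/funext => z; rewrite /neumann_part big_ord0].
rewrite (_ : neumann_part f n.+1 = fun z => neumann_part f n z + neumann_term f n z); last first.
  by apply/funext => z; rewrite /neumann_part big_ord_recr.
by apply: holD => //; exact: hol_term.
Qed.

Section Fixed.
Variable f : R[i] -> R[i].
Hypothesis hf : hol f.
Hypothesis ff : (norm2 nu f < +oo)%E.

Let q0 : 0 < q. Proof. by case/andP: q01. Qed.
Let q1 : 0 < 1 - q. Proof. by case/andP: q01 => _; rewrite subr_gt0. Qed.

Lemma norm2_term_fin i : (norm2 nu (neumann_term f i) < +oo)%E.
Proof.
apply: le_lt_trans (HK i hf ff) _.
by rewrite (norm2E ff) -EFinM ltry.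
Qed.

Lemma term_bound a : 0 < a -> exists2 C : R, 0 <= C &
  forall i z, a <= Re z -> normc (neumann_term f i z) <= C * q ^+ i.
Proof.
move=> a0; have m0 : 0 < mass nu (a / 8) by apply: (mass_gt0 hnu); lra.
set P := 12 / (a * mass nu (a / 8)).
have P0 : 0 <= P by rewrite divr_ge0// ltW// mulr_gt0.
set N := fine (norm2 nu f).
have N0 : 0 <= N by rewrite fine_ge0// norm2_ge0.
have PKN : 0 <= P * (K * N) by apply: mulr_ge0 => //; exact: mulr_ge0.
exists (Num.sqrt (P * (K * N))); first exact: sqrtr_ge0.
move=> i z az; rewrite -ler_sqr ?nnegrE ?normc_ge0 ?mulr_ge0 ?sqrtr_ge0 ?exprn_ge0 ?(ltW q0)//.
rewrite exprMn sqr_sqrtr//.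
apply: le_trans (zen_pointwise hnu (hol_term i hf) (norm2_term_fin i) a0 az) _.
rewrite -/P (_ : P * (K * N) * (q ^+ i) ^+ 2 = P * (K * N * (q ^+ i) ^+ 2)); last by rewrite !mulrA.
rewrite ler_wpM2l//.
have E1 := norm2E (norm2_term_fin i); have E2 := norm2E ff.
have := HK i hf ff; rewrite E1 E2 -EFinM lee_fin => H; apply: le_trans H _.
by rewrite exprAC [leLHS]mulrAC.
Qed.

(** Uniformity in [Re z >= a] is what makes the limit analytic, and the geometric
    rate is what [neumann_clim] and [hol_neumann] use. *)
Lemma part_cauchy a : 0 < a -> exists2 C : R, 0 <= C &
  forall z, a <= Re z -> forall n m, (n <= m)%N ->
    normc (neumann_part f m z - neumann_part f n z) <= C * q ^+ n.
Proof.
move=> a0; have [C C0 HC] := term_bound a0.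
exists (C / (1 - q)); first by rewrite divr_ge0// ltW.
move=> z az n m /subnK <-; set k := (m - n)%N.
have : normc (neumann_part f (k + n) z - neumann_part f n z) <= C / (1 - q) * (q ^+ n - q ^+ (k + n)).
  elim: k => [|k IH]; first by rewrite add0n !subrr mulr0 Normc.normc0.
  rewrite addSn {1}/neumann_part big_ord_recr /= -/(neumann_part f (k + n) z) addrAC.
  apply: le_trans (normcD _ _) _; apply: le_trans (lerD IH (HC _ _ az)) _.
  rewrite exprS le_eqVlt; apply/orP; left; apply/eqP; field.
  by rewrite gt_eqF.
move/le_trans; apply; have C1 : 0 <= C / (1 - q) by rewrite divr_ge0// ltW.
by rewrite ler_wpM2l// gerBl exprn_ge0// ltW.
Qed.

Lemma neumann_approx a : 0 < a -> exists2 C : R, 0 <= C &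
  forall z, a <= Re z -> forall n, normc (neumann f z - neumann_part f n z) <= C * q ^+ n.
Proof.
move=> a0; have [C C0 HC] := part_cauchy a0.
exists (2 * C); first by rewrite mulr_ge0.
move=> z az n; apply: le_trans (normc_le _) _.
rewrite mulr2n mulrDl mul1r mulrDl ReD ReN ImD ImN /=.
apply: lerD.
- apply: (@cauchy_rate _ (fun n => Re (neumann_part f n z)) (fun n => C * q ^+ n)) => [j m jm|].
    by have := HC z az j m jm; rewrite -ReN -ReD; apply: le_trans; exact: Re_le_normc.
  exact: geometric_small.
- apply: (@cauchy_rate _ (fun n => Im (neumann_part f n z)) (fun n => C * q ^+ n)) => [j m jm|].
    by have := HC z az j m jm; rewrite -ImN -ImD; apply: le_trans; exact: Im_le_normc.
  exact: geometric_small.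
Qed.

Lemma part_eq0 n z : Re z <= 0 -> neumann_part f n z = 0.
Proof. exact: (hol_part n hf).2. Qed.

Lemma neumann_eq0 z : Re z <= 0 -> neumann f z = 0.
Proof.
move=> z0; rewrite /neumann; apply: ceqP => /=.
- by under eq_fun do rewrite part_eq0//; rewrite lim_cst.
- by under eq_fun do rewrite part_eq0//; rewrite lim_cst.
Qed.

Lemma neumann_clim z : clim (fun n => neumann_part f n z) (neumann f z).
Proof.
move=> e e0; have [z0|z0] := leP (Re z) 0.
  by exists 0%N => n _; rewrite part_eq0// neumann_eq0// subrr Normc.normc0 ltW.
have [C C0 HC] := neumann_approx z0.
have [N HN] := geometric_small C q01 e0.
exists N => n Nn; rewrite normcB; apply: le_trans (HC z (lexx _) n) _.
apply: le_trans (ltW HN); rewrite ler_wpM2l//.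
by apply: ler_wiXn2l => //; case/andP: q01 => ? ?; rewrite ltW.
Qed.

Lemma hol_neumann : hol (neumann f).
Proof.
split; last exact: neumann_eq0.
apply: (@weierstrass R (neumann_part f)).
  by move=> n z z0; apply: (hol_part n hf).1.
move=> a b c' d a0 e e0; have [C C0 HC] := neumann_approx a0.
have [n hn] := geometric_small C q01 e0.
exists n => z [/andP[az _] _]; rewrite normcB.
exact: le_trans (HC z az n) (ltW hn).
Qed.

Lemma neumann_fix z : neumann f z = f z + c * neumann f (l%:C%C * z).
Proof.
apply: clim_unique (clim_shift (neumann_clim z)) _.
rewrite (_ : (fun n => neumann_part f n.+1 z) = fun n => f z + c * neumann_part f n (l%:C%C * z)).
  by apply: climD; [exact: clim_cst|apply: climZ; exact: neumann_clim].
apply/funext => n; rewrite /neumann_part big_ord_recl /=; congr (_ + _).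
  by rewrite /neumann_term !expr0 !mul1r.
rewrite mulr_sumr; apply: eq_bigr => i _; rewrite /neumann_term /bump /= add1n (exprS c) -mulrA.
by rewrite (exprSr l) rmorphM /= -mulrA.
Qed.

(** The bound of [weighted_square_sum] is integrated term by term: the weights
    [q^-i] cost one of the two factors [q^i] in [HK], and the remaining one is
    summed. *)
Lemma norm2_neumann : (norm2 nu (neumann f) <= (K / (1 - q) ^+ 2)%:E * norm2 nu f)%E.
Proof.
set N := fine (norm2 nu f).
have N0 : 0 <= N by rewrite fine_ge0// norm2_ge0.
pose w i z : \bar R := ((q ^- i) * normc (neumann_term f i z) ^+ 2)%:E.
have w0 i z : (0 <= w i z)%E by rewrite lee_fin mulr_ge0 ?sqr_ge0// invr_ge0 exprn_ge0// ltW.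
have pw z : ((normc (neumann f z) ^+ 2)%:E <= ((1 - q)^-1)%:E * \sum_(0 <= i <oo) w i z)%E.
  have S0 : (0 <= \sum_(0 <= i <oo) w i z)%E by apply: nneseries_ge0.
  have [Sf|] := ltP (\sum_(0 <= i <oo) w i z)%E +oo%E; last first.
    by rewrite leye_eq => /eqP ->; rewrite gt0_muley ?leey// lte_fin invr_gt0.
  have SE : (\sum_(0 <= i <oo) w i z = (fine (\sum_(0 <= i <oo) w i z))%:E)%E.
    by rewrite fineK// ge0_fin_numE.
  rewrite SE; set S := fine _; rewrite -EFinM lee_fin.
  have hp n : normc (neumann_part f n z) ^+ 2 <= (1 - q)^-1 * S.
    apply: le_trans (weighted_square_sum n (fun i => neumann_term f i z) q01) _.
    rewrite ler_pM2l ?invr_gt0// -lee_fin -SE.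
    have := @nneseries_lim_ge R (fun i => w i z) xpredT 0%N n (fun i _ _ => w0 i z).
    by rewrite big_mkord sumEFin.
  have SS : 0 <= (1 - q)^-1 * S by apply: le_trans (hp 0%N); exact: sqr_ge0.
  rewrite -[leRHS]sqr_sqrtr// ler_pXn2r ?nnegrE ?normc_ge0 ?sqrtr_ge0//.
  apply/ler_addgt0Pr => e e0; have [n /(_ n (leqnn n)) hn] := neumann_clim z e0.
  rewrite -[neumann f z](subrK (neumann_part f n z)) addrC.
  apply: le_trans (normcD _ _) _; apply: lerD; last by rewrite normcB.
  by rewrite -ler_sqr ?nnegrE ?normc_ge0 ?sqrtr_ge0// sqr_sqrtr.
have qi i : 0 <= q ^- i by rewrite invr_ge0 exprn_ge0// ltW.
have s0 : (0 <= ((1 - q)^-1)%:E)%E by rewrite lee_fin invr_ge0 ltW.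
have ht i := hol_term i hf.
pose W i x : \bar R := ((q ^- i)%:E * vint (neumann_term f i) x)%E.
have W0 i x : (0 <= W i x)%E by rewrite mule_ge0 ?lee_fin// vint_ge0.
have mW i : measurable_fun [set: mR] (W i) by apply: measurable_funeM; exact: measurable_vint.
have pv x : (vint (neumann f) x <= ((1 - q)^-1)%:E * \sum_(0 <= i <oo) W i x)%E.
  have mw i : measurable_fun [set: mR] (fun y : mR => w i (x +i* y)%C).
    rewrite /w; under eq_fun do rewrite EFinM.
    by apply: measurable_funeM; exact: (measurable_vline (ht i) x).
  have -> : (\sum_(0 <= i <oo) W i x = \int[leb]_y \sum_(0 <= i <oo) w i (x +i* y)%C)%E.
    rewrite integral_nneseries//; apply: eq_eseriesr => i _.
    rewrite /W /vint -ge0_integralZl//.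
    - exact: (measurable_vline (ht i) x).
    - by move=> y _; rewrite lee_fin sqmod_ge0.
    - by rewrite lee_fin.
  rewrite -ge0_integralZl//; last 2 first.
  - exact: measurable_nneseries.
  - by move=> y _; apply: nneseries_ge0.
  apply: ge0_le_integral => //.
  - by move=> y _; rewrite lee_fin sqmod_ge0.
  - exact: (measurable_vline hol_neumann x).
  - by apply: measurable_funeM; exact: measurable_nneseries.
  - by move=> y _; exact: pw.
apply: norm2_le => e e0.
have mWe i : measurable_fun (`[0%R, +oo[%classic : set mR) (fun x => W i (x + e)).
  apply: measurable_funTS; exact: (@measurable_comp_add _ _ _ _ id (fun=> e) (mW i)).
apply: (@le_trans _ _ (((1 - q)^-1)%:E * \sum_(0 <= i <oo) ((q ^- i)%:E * shifted nu (vint (neumann_term f i)) e))%E).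
  have -> : (\sum_(0 <= i <oo) ((q ^- i)%:E * shifted nu (vint (neumann_term f i)) e) =
     \int[nu]_(x in `[0%R, +oo[) \sum_(0 <= i <oo) W i (x + e)%R)%E.
    rewrite integral_nneseries//; apply: eq_eseriesr => i _.
    rewrite /W /shifted -ge0_integralZl//.
    - apply: measurable_funTS; exact: (@measurable_comp_add _ _ _ _ id (fun=> e) (measurable_vint (ht i))).
    - by move=> x _; exact: vint_ge0.
    - by rewrite lee_fin.
  rewrite -ge0_integralZl//; last 2 first.
  - exact: measurable_nneseries.
  - by move=> y _; apply: nneseries_ge0.
  apply: ge0_le_integral => //.
  - by move=> x _; exact: vint_ge0.
  - apply: measurable_funTS; exact: (@measurable_comp_add _ _ _ _ id (fun=> e) (measurable_vint hol_neumann)).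
  - by apply: measurable_funeM; exact: measurable_nneseries.
have b i : ((q ^- i)%:E * shifted nu (vint (neumann_term f i)) e <= (K * N * q ^+ i)%:E)%E.
  apply: le_trans (lee_wpmul2l _ (le_trans (shifted_le_norm2 nu _ e0) (HK i hf ff))) _.
    by rewrite lee_fin.
  rewrite (norm2E ff) -!EFinM lee_fin -/N le_eqVlt; apply/orP; left; apply/eqP.
  by rewrite -exprM mul2n -addnn exprD; field; rewrite expf_neq0// gt_eqF.
have -> : ((K / (1 - q) ^+ 2)%:E * norm2 nu f = ((1 - q)^-1)%:E * (K * N / (1 - q))%:E)%E.
  by rewrite (norm2E ff) -!EFinM; congr (_%:E); rewrite -/N; field; rewrite gt_eqF.
apply: lee_wpmul2l => //.
apply: lime_le.
  by apply: is_cvg_nneseries => i _ _; rewrite mule_ge0 ?lee_fin//; apply: integral_ge0 => x _; exact: vint_ge0.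
apply: nearW => n.
apply: (@le_trans _ _ (\sum_(0 <= i < n) (K * N * q ^+ i)%:E)%E); first by apply: lee_sum => i _.
rewrite sumEFin lee_fin big_mkord -mulr_sumr ler_wpM2l ?mulr_ge0//.
rewrite -[leRHS]mul1r ler_pdivlMr// mulrC -opprB mulNr -subrX1 opprB.
by rewrite gerBl exprn_ge0// ltW.
Qed.

End Fixed.
End Neumann.

Section NeumannAlgebra.
Variable R : realType.
Local Notation mR := (measurableTypeR R).
Variable nu : {sigma_finite_measure set mR -> \bar R}.
Hypothesis hnu : forall t : R, 0 < t -> (0 < initial_mass nu t < +oo)%E.
Variables (c : R[i]) (l q K : R).
Hypotheses (l0 : 0 < l) (q01 : 0 < q < 1) (K0 : 0 <= K).
Hypothesis HK : forall i f, hol f -> (norm2 nu f < +oo)%E ->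
  (norm2 nu (neumann_term c l f i) <= (K * (q ^+ 2) ^+ i)%:E * norm2 nu f)%E.

Local Notation neumann := (neumann c l).
Local Notation neumann_part := (neumann_part c l).

Lemma hol_comb k (f g : R[i] -> R[i]) : hol f -> hol g -> hol (fun z => k * f z + g z).
Proof. by move=> hf hg; apply: holD => //; exact: holZ. Qed.

Lemma normc_comb_le (k a b : R[i]) :
  normc (k * a + b) ^+ 2 <= 2 * normc k ^+ 2 * normc a ^+ 2 + 2 * normc b ^+ 2.
Proof.
have h : normc (k * a + b) ^+ 2 <= (normc (k * a) + normc b) ^+ 2.
  by rewrite ler_pXn2r ?nnegrE ?addr_ge0 ?normc_ge0// normcD.
apply: le_trans h _; rewrite Normc.normcM; set x := normc k; set y := normc a; set w := normc b.
have := sqr_ge0 (x * y - w); nra.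
Qed.

Lemma norm2_comb k (f g : R[i] -> R[i]) : hol f -> hol g ->
  (norm2 nu (fun z => k * f z + g z)%R <= (2 * normc k ^+ 2)%:E * norm2 nu f + 2%:E * norm2 nu g)%E.
Proof.
move=> hf hg; apply: norm2_le_comb => //.
- exact: hol_comb.
- by rewrite mulr_ge0// sqr_ge0.
- by move=> z; exact: normc_comb_le.
Qed.

Lemma norm2_comb_fin k (f g : R[i] -> R[i]) : hol f -> hol g ->
  (norm2 nu f < +oo)%E -> (norm2 nu g < +oo)%E -> (norm2 nu (fun z => k * f z + g z)%R < +oo)%E.
Proof.
move=> hf hg ff fg; apply: le_lt_trans (norm2_comb k hf hg) _.
by rewrite (norm2E ff) (norm2E fg) -!EFinM -EFinD ltry.
Qed.

Lemma neumann_comb k (f g : R[i] -> R[i]) z : hol f -> hol g ->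
  (norm2 nu f < +oo)%E -> (norm2 nu g < +oo)%E ->
  neumann (fun z => k * f z + g z) z = k * neumann f z + neumann g z.
Proof.
move=> hf hg ff fg.
have hh := hol_comb k hf hg; have fh := norm2_comb_fin k hf hg ff fg.
apply: clim_unique (neumann_clim hnu l0 q01 K0 HK hh fh z) _.
have -> : (fun n => neumann_part (fun z => k * f z + g z) n z) = (fun n => k * neumann_part f n z + neumann_part g n z).
  apply/funext => n; rewrite /neumann_part mulr_sumr -big_split; apply: eq_bigr => i _ /=.
  by rewrite /neumann_term mulrDr !mulrA [c ^+ i * k]mulrC.
apply: climD; first apply: climZ; exact: (neumann_clim hnu l0 q01 K0 HK).
Qed.

(** The partial sums telescope: for [(1 - c D) f] they are [f - (c D)^n f]. *)
Lemma neumann_left (f : R[i] -> R[i]) z : hol f -> (norm2 nu f < +oo)%E ->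
  neumann (fun z => - c * f (l%:C%C * z) + f z) z = f z.
Proof.
move=> hf ff.
pose Df z := f (l%:C%C * z).
have hD : hol Df by exact: dilate_hol.
have tE : neumann_term c l f 1 = fun z => c * Df z.
  by apply/funext => w; rewrite /neumann_term !expr1.
have fh : (norm2 nu (fun z => - c * Df z + f z)%R < +oo)%E.
  have := norm2_comb_fin (-1) (hol_term c l0 1 hf) hf (norm2_term_fin HK hf ff 1) ff.
  rewrite (_ : (fun z => -1 * neumann_term c l f 1 z + f z) = (fun z => - c * Df z + f z))//.
  by apply/funext => w; rewrite tE mulN1r mulNr.
have hh : hol (fun z => - c * Df z + f z) by exact: hol_comb.
apply: clim_unique (neumann_clim hnu l0 q01 K0 HK hh fh z) _.
have -> : (fun n => neumann_part (fun z => - c * Df z + f z) n z) =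
   (fun n => f z + -1 * (neumann_part f n.+1 z + -1 * neumann_part f n z)).
  apply/funext => n; rewrite {2}/neumann_part big_ord_recr /= -/(neumann_part f n z).
  rewrite (_ : neumann_part f n z + neumann_term c l f n z + -1 * neumann_part f n z = neumann_term c l f n z); last by ring.
  elim: n => [|n IH]; first by rewrite /neumann_part big_ord0 /neumann_term !expr0 !mul1r mulN1r subrr.
  rewrite /neumann_part big_ord_recr /= -/(neumann_part _ n z) IH /neumann_term /Df !exprSr rmorphM /=.
  rewrite [(l ^+ n)%:C%C * l%:C%C]mulrC -!mulrA [l%:C%C * _]mulrCA.
  ring.
have L := neumann_clim hnu l0 q01 K0 HK hf ff z.
have := climD (clim_cst (f z)) (@climZ _ (-1) _ _ (climD (clim_shift L) (@climZ _ (-1) _ _ L))).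
by rewrite [X in f z + -1 * (_ + X)]mulN1r subrr mulr0 addr0.
Qed.

End NeumannAlgebra.
(** * Roots of submultiplicative sequences *)

Section Fekete.
Variable R : realType.

(** Subadditive sequences bounded below by a linear one: with [m] chosen so that
    [u m / m] is close to the infimum, division of [n] by [m] bounds [u n / n] by
    [u m / m] up to a term of order [1 / n]. *)
Lemma fekete (u : nat -> R) (b : R) :
  (forall m n, u (m + n)%N <= u m + u n) ->
  (forall n, b * n%:R <= u n) -> cvgn (fun n => u n / n%:R).
Proof.
move=> usub ub.
pose E := [set u n.+1 / n.+1%:R | n in setT].
have lE : has_lbound E by exists b => _ [n _ <-]; rewrite ler_pdivlMr.
have nE : E !=set0 by exists (u 1%N / 1), 0%N.
apply/cvg_ex; exists (inf E); apply/cvgrPdist_le => e e0.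
have e2 : 0 < e / 2 by rewrite divr_gt0.
have [_ [m' _ <-] hm] := inf_adherent e2 (conj nE lE).
set m := m'.+1 in hm; have m0 : 0 < m%:R :> R by rewrite ltr0n.
(* Bounds the value of [u] at any remainder modulo [m]. *)
pose B := \sum_(r < m) `|u r|.
have mult k r : u (k * m + r)%N <= k%:R * u m + u r.
  elim: k => [|k IH]; first by rewrite mul0n mul0r add0r.
  rewrite mulSn -addnA; apply: le_trans (usub _ _) _.
  by rewrite -natr1 mulrDl mul1r; lra.
pose N := (Num.bound `|(B + `|u m|) / (e / 2)|).+1.
exists N => // n /= Nn.
have n0 : (0 < n)%N by apply: leq_trans Nn.
have n0' : 0 < n%:R :> R by rewrite ltr0n.
have lo : inf E <= u n / n%:R.
  by apply: (ge_inf lE); exists n.-1 => //; rewrite prednK.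
rewrite distrC ger0_norm ?subr_ge0// lerBlDr.
set k := (n %/ m)%N; set r := (n %% m)%N.
have nE' : n = (k * m + r)%N by exact: divn_eq.
have rm : (r < m)%N by rewrite ltn_mod.
have ur : u r <= B.
  apply: le_trans (ler_norm _) _; rewrite /B (bigD1 (Ordinal rm))//= lerDl.
  by apply: sumr_ge0 => i _; exact: normr_ge0.
have h1 : u n <= k%:R * u m + B by rewrite {1}nE'; apply: le_trans (mult k r) _; rewrite lerD2l.
have h2 : k%:R * u m <= n%:R * (u m / m%:R) + `|u m|.
  have -> : n%:R * (u m / m%:R) = k%:R * u m + r%:R / m%:R * u m.
    by rewrite {1}nE' natrD natrM; field; rewrite gt_eqF.
  rewrite -addrA lerDl -[_ / _ * u m]opprK addrC subr_ge0.
  apply: le_trans (ler_norm _) _; rewrite normrN normrM ger0_norm ?divr_ge0//.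
  by rewrite -[leRHS]mul1r ler_wpM2r// ler_pdivrMr// mul1r ler_nat ltnW.
have h3 : (B + `|u m|) / n%:R <= e / 2.
  rewrite ler_pdivrMr// mulrC -ler_pdivrMr//; apply: le_trans (_ : N%:R <= _); last by rewrite ler_nat.
  rewrite (le_trans (ler_norm _))//; apply: ltW; apply: lt_trans (archi_boundP (normr_ge0 _)) _.
  by rewrite /N ltr_nat.
have h4 : u n / n%:R <= u m / m%:R + (B + `|u m|) / n%:R.
  rewrite ler_pdivrMr// mulrDl divfK ?gt_eqF// mulrC; lra.
apply: le_trans h4 _; lra.
Qed.

(** Fekete's lemma for the logarithms. At [n = 0] the exponent is [0^-1 = 0] and
    the value is [1], which does not affect the limit. *)
Lemma root_cvg (a : nat -> R) (d : R) : 0 < d -> (forall n, 0 < a n) ->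
  (forall m n, a (m + n)%N <= a m * a n) -> (forall n, d ^+ n <= a n) ->
  exists2 L : R, 0 < L & (fun n => a n `^ ((2 * n)%:R)^-1) @ \oo --> L.
Proof.
move=> d0 a0 am ad.
have sub m n : ln (a (m + n)%N) <= ln (a m) + ln (a n).
  by rewrite -lnM ?posrE// ler_ln ?posrE// mulr_gt0.
have low n : ln d * n%:R <= ln (a n).
  by rewrite mulr_natr -lnXn// ler_ln ?posrE// exprn_gt0.
have [L HL] := (cvg_ex _).1 (fekete sub low).
exists (expR (L / 2)); first exact: expR_gt0.
have -> : (fun n => a n `^ ((2 * n)%:R)^-1) = (fun n => expR (ln (a n) / n%:R / 2)).
  apply/funext => n; rewrite /powR gt_eqF//; congr expR.
  by rewrite natrM invfM; ring.
have H2 : (fun n => ln (a n) / n%:R / 2) @ \oo --> L / 2.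
  exact: (@cvgM R _ _ _ _ (fun=> 2^-1) _ _ HL (@cvg_cst _ _ _ _ _)).
exact: (cvg_comp _ _ H2 (@continuous_expR R (L / 2))).
Qed.

(** Beyond some rank the root is at most [B], and the constant takes care of the
    finitely many other terms. *)
Lemma root_upper (x : nat -> R) (L B : R) : (forall n, 0 <= x n) ->
  (fun n => x n `^ ((2 * n)%:R)^-1) @ \oo --> L -> 0 < B -> L < B ->
  exists2 K : R, 0 <= K & forall n, x n <= K * (B ^+ 2) ^+ n.
Proof.
move=> x0 /cvgrPdist_lt H B0 LB.
have dB : 0 < B - L by rewrite subr_gt0.
have [N _ HN] := H _ dB.
have Bn n : 0 < (B ^+ 2) ^+ n by rewrite !exprn_gt0.
exists (1 + \sum_(i < N.+1) x i / (B ^+ 2) ^+ i).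
  by rewrite addr_ge0// sumr_ge0// => i _; rewrite divr_ge0// ltW.
move=> n; have s0 : 0 <= \sum_(i < N.+1) x i / (B ^+ 2) ^+ i.
  by apply: sumr_ge0 => i _; rewrite divr_ge0// ltW.
rewrite -ler_pdivrMr//; have [nN|Nn] := leqP n N.
  rewrite (bigD1 (Ordinal (nN : (n < N.+1)%N)))//= addrCA lerDl addr_ge0//.
  by apply: sumr_ge0 => i _; rewrite divr_ge0// ltW.
apply: (@le_trans _ _ 1); last by rewrite lerDl.
rewrite ler_pdivrMr// mul1r.
have n0 : (2 * n)%:R != 0 :> R by rewrite pnatr_eq0 muln_eq0 /= -lt0n (leq_ltn_trans _ Nn).
have := HN n (ltnW Nn) => /=; rewrite distrC => h.
have {}h : x n `^ ((2 * n)%:R)^-1 <= B by have := le_lt_trans (ler_norm _) h; lra.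
have xE : x n = (x n `^ ((2 * n)%:R)^-1) ^+ (2 * n).
  by rewrite -powR_mulrn ?powR_ge0// -powRrM mulVf// powRr1.
by rewrite {}[leLHS]xE -exprM ler_pXn2r ?nnegrE ?powR_ge0 ?muln_gt0 ?(leq_ltn_trans _ Nn)// ltW.
Qed.

End Fekete.
(** * The weight and the masses of initial intervals *)

Section Weight.
Variable R : realType.
Local Notation mR := (measurableTypeR R).
Variable nu : {sigma_finite_measure set mR -> \bar R}.
Hypothesis hz : doubling nu.

Let hnu : forall t : R, 0 < t -> (0 < initial_mass nu t < +oo)%E := hz.1.
Local Notation mass := (mass nu).

Lemma doubling_mass : exists2 D : R, 1 <= D & forall t, 0 < t -> mass (2 * t) <= D * mass t.
Proof.
have [_ hs] := hz; set S := ereal_sup _ in hs.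
exists (Num.max 1 (fine S)); first by rewrite le_max lexx.
move=> t t0; have t20 : 0 < 2 * t by rewrite mulr_gt0.
have m0 := mass_gt0 hnu t0; have m20 := mass_gt0 hnu t20.
have h : ((mass (2 * t) / mass t)%:E <= S)%E.
  apply: ereal_sup_ubound; exists t => //.
  by rewrite (massE hnu t0) (massE hnu t20) inver gt_eqF.
have Sf : S = (fine S)%:E.
  by rewrite fineK// ge0_fin_numE// (le_trans _ h)// lee_fin divr_ge0// ltW.
rewrite Sf lee_fin ler_pdivrMr// in h.
apply: le_trans h _; apply: ler_wpM2r; first exact: ltW.
by rewrite le_max lexx orbT.
Qed.

Lemma mass_le (s t : R) : 0 < s -> s <= t -> mass s <= mass t.
Proof.
move=> s0 st; have t0 := lt_le_trans s0 st.
rewrite -lee_fin -(massE hnu s0) -(massE hnu t0).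
apply: le_measure; rewrite ?inE; try exact: measurable_itv.
by apply: subset_itvl; rewrite bnd_simp.
Qed.

Lemma mass_pow D : 0 <= D -> (forall t, 0 < t -> mass (2 * t) <= D * mass t) ->
  forall k t, 0 < t -> mass (2 ^+ k * t) <= D ^+ k * mass t.
Proof.
move=> D0 HD; elim=> [|k IH] t t0; first by rewrite !expr0 !mul1r.
rewrite exprS -mulrA; apply: le_trans (HD _ _) _; first by rewrite mulr_gt0// exprn_gt0.
by rewrite exprS -mulrA ler_wpM2l// IH.
Qed.

Definition lint (t : R) : \bar R := \int[nu]_(r in `[0, +oo[) (expR (- 2 * r * t))%:E.

Let measurable_kernel t : measurable_fun [set: mR] (fun r : mR => (expR (- 2 * r * t))%:E).
Proof.
apply/measurable_EFinP.
have h : measurable_fun [set: mR] ((fun r => - 2 * r * t) : mR -> mR).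
  by apply: measurable_funM => //; exact: measurable_funM.
exact: (measurableT_comp (@measurable_expR R) h).
Qed.

(** The left-hand side bounds the part of the integral [lint] on the [k]-th dyadic
    shell, [D^k] accounting for its mass. *)
Lemma exp_pow2_le (D : R) : 1 <= D -> exists2 B : R, 0 <= B &
  forall k, expR (1 - 2 ^+ k) * D ^+ k <= B * (2^-1) ^+ k.
Proof.
move=> D1.
(* With [p = m + 1], [(2 D)^k <= (2^k)^p], and the exponential of [2^k] is at
   least [(2^k / p)^p]. *)
have [m hm] : exists m : nat, 2 * D <= 2 ^+ m.+1.
  exists (Num.bound D); rewrite exprS ler_wpM2l//.
  apply: ltW; apply: lt_le_trans (archi_boundP (le_trans ler01 D1)) _.
  by rewrite -natrX ler_nat ltnW// ltn_expl.
pose p : R := m.+1%:R.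
have p0 : 0 < p by rewrite ltr0n.
exists (expR 1 * p ^+ m.+1); first by rewrite mulr_ge0 ?expR_ge0// exprn_ge0// ltW.
move=> k.
have e1 : (2 ^+ k / p) ^+ m.+1 <= expR (2 ^+ k).
  have -> : expR (2 ^+ k) = expR (2 ^+ k / p) ^+ m.+1.
    by rewrite -expRM_natl -/p mulrC divfK// gt_eqF.
  have hx : 0 <= 2 ^+ k / p by rewrite divr_ge0 ?exprn_ge0// ltW.
  apply: lerXn2r; rewrite ?nnegrE ?expR_ge0//.
  by apply: le_trans (expR_ge1Dx _); rewrite lerDr.
have e2 : (2 * D) ^+ k <= p ^+ m.+1 * expR (2 ^+ k).
  apply: le_trans (_ : (2 ^+ m.+1) ^+ k <= _).
    by apply: lerXn2r => //; rewrite nnegrE ?exprn_ge0// mulr_ge0// (le_trans ler01).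
  by rewrite exprAC -ler_pdivrMl ?exprn_gt0// mulrC -expr_div_n.
rewrite expRD expRN -!mulrA ler_pM2l ?expR_gt0// ler_pdivrMl ?expR_gt0//.
rewrite exprVn mulrCA mulrA ler_pdivlMr ?exprn_gt0// mulrC -exprMn.
by apply: le_trans e2 _; rewrite mulrC.
Qed.

(** The integrand is at most [exp (1 - 2^k)] where [2^(k-1) u <= r < 2^k u] with
    [u = 1 / t], and the doubling condition gives
    [mass (2^k u) <= D^k mass u]. *)
Lemma lint_upper : exists2 B : R, 0 < B & forall t, 0 < t -> (lint t <= (B * mass t^-1)%:E)%E.
Proof.
have [D D1 HD] := doubling_mass.
have [B B0 HB] := exp_pow2_le D1.
exists (2 * B + 1); first by rewrite ltr_wpDl// mulr_ge0.
move=> t t0; set u := t^-1; have u0 : 0 < u by rewrite invr_gt0.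
pose A k : set mR := `[0, (2 ^+ k * u)[%classic.
pose h k (r : mR) : \bar R := ((expR (1 - 2 ^+ k))%:E * (\1_(A k) r : R)%:E)%E.
have h0 k r : (0 <= h k r)%E by rewrite mule_ge0 ?lee_fin ?expR_ge0.
have mA k : measurable (A k) by exact: measurable_itv.
have mh k : measurable_fun [set: mR] (h k).
  by apply: measurable_funeM; apply/measurable_EFinP; exact: measurable_indic.
apply: (@le_trans _ _ (\int[nu]_r \sum_(0 <= k <oo) h k r)%E).
  rewrite /lint integral_mkcond; apply: ge0_le_integral => //.
  - by move=> r _; rewrite patchE; case: ifP => // _; rewrite lee_fin expR_ge0.
  - apply/(measurable_restrictT _ _).1 => //; exact: (measurable_funTS (measurable_kernel t)).
  - exact: measurable_nneseries.
  move=> r _; rewrite patchE; case: ifPn => [|_]; last by apply: nneseries_ge0.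
  rewrite inE /= in_itv /= andbT => r0.
  have ex : exists k, r < 2 ^+ k * u.
    exists (Num.bound (r / u)); rewrite -ltr_pdivrMr//.
    apply: lt_le_trans (archi_boundP _) _; first by rewrite divr_ge0// ltW.
    by rewrite -natrX ler_nat ltnW// ltn_expl.
  pose k := ex_minn ex; have : r < 2 ^+ k * u /\ (forall j, r < 2 ^+ j * u -> (k <= j)%N).
    by rewrite /k; case: ex_minnP.
  case=> rk kmin; apply: (@le_trans _ _ (h k r)).
    rewrite /h indicE mem_set ?mule1; last by rewrite /A /= in_itv /= r0.
    rewrite lee_fin ler_expR.
    case: k rk kmin => [|k] rk kmin.
      by rewrite expr0 subrr -mulrA mulNr oppr_le0 !mulr_ge0// ltW.
    have rk' : 2 ^+ k * u <= r.
      by rewrite leNgt; apply/negP => /kmin; rewrite ltnn.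
    have : 2 ^+ k <= r * t by rewrite -ler_pdivrMr.
    by rewrite exprS; lra.
  apply: le_trans (nneseries_lim_ge k.+1 (fun i _ _ => h0 i r)).
  by rewrite big_mkord big_ord_recr /= leeDr// sume_ge0.
rewrite integral_nneseries//.
have hE k : (\int[nu]_r h k r = (expR (1 - 2 ^+ k) * mass (2 ^+ k * u))%:E)%E.
  rewrite ge0_integralZl//; last by apply/measurable_EFinP; exact: measurable_indic.
  rewrite integral_indic// setIT EFinM; congr (_ * _)%E.
  by apply: (massE hnu); rewrite mulr_gt0// exprn_gt0.
apply: lime_le; first by apply: is_cvg_nneseries => k _ _; apply: integral_ge0.
apply: nearW => n; under eq_bigr do rewrite hE.
rewrite sumEFin lee_fin big_mkord.
have m0 := mass_gt0 hnu u0.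
apply: (@le_trans _ _ (\sum_(k < n) B * mass u * 2^-1 ^+ k)).
  apply: ler_sum => k _; have D0 : 0 <= D by apply: le_trans D1.
  apply: le_trans (_ : expR (1 - 2 ^+ k) * (D ^+ k * mass u) <= _).
    by rewrite ler_wpM2l ?expR_ge0// mass_pow.
  by rewrite mulrA [leRHS]mulrAC ler_wpM2r ?HB// ltW.
rewrite -mulr_sumr.
have hs : \sum_(k < n) (2^-1 : R) ^+ k <= 2.
  have := subrX1 (2^-1 : R) n; have : 0 <= (2^-1 : R) ^+ n by rewrite exprn_ge0.
  set S := \sum_(i < n) _; lra.
apply: le_trans (_ : B * mass u * 2 <= _).
  by rewrite ler_wpM2l// mulr_ge0// ltW.
nra.
Qed.

(** Where [r < 1/t] the integrand is at least [exp (- 2)]. *)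
Lemma lint_lower t : 0 < t -> ((expR (- 2) * mass t^-1)%:E <= lint t)%E.
Proof.
move=> t0; set u := t^-1; have u0 : 0 < u by rewrite invr_gt0.
pose A : set mR := `[0, u[%classic.
have mA : measurable A by exact: measurable_itv.
rewrite EFinM -(massE hnu u0).
have -> : ((expR (- 2))%:E * initial_mass nu u = \int[nu]_(r in A) (expR (- 2))%:E)%E.
  by rewrite integral_cst.
apply: (@le_trans _ _ (\int[nu]_(r in A) (expR (- 2 * r * t))%:E)%E).
  apply: ge0_le_integral => //.
  - by apply: measurable_funTS; exact: measurable_kernel.
  move=> r; rewrite /A /= in_itv /= => /andP[r0 ru].
  rewrite lee_fin ler_expR; have : r * t <= 1 by rewrite -ler_pdivlMr// mul1r ltW.
  lra.
apply: ge0_subset_integral => //.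
- by apply: measurable_funTS; exact: measurable_kernel.
- by move=> r; rewrite /A /= !in_itv /= andbT => /andP[].
Qed.

Local Notation w := (zen_weight nu).

Lemma lint_fin t : 0 < t -> lint t \is a fin_num.
Proof.
move=> t0; have [B B0 HB] := lint_upper.
rewrite ge0_fin_numE ?(le_lt_trans (HB t t0)) ?ltry//.
by apply: integral_ge0 => r _; rewrite lee_fin expR_ge0.
Qed.

Lemma weightE t : w t = 2 * pi * fine (lint t).
Proof. by []. Qed.

(** The Laplace transform of a doubling measure at [t] is comparable to the mass
    of the points below [1/t]; this turns ratios of weights into ratios of masses. *)
Lemma weight_bounds : exists a b : R, [/\ 0 < a, 0 < b &
  forall t, 0 < t -> a * mass t^-1 <= w t <= b * mass t^-1].
Proof.
have [B B0 HB] := lint_upper; have p0 : 0 < 2 * pi :> R by rewrite mulr_gt0// pi_gt0.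
exists (2 * pi * expR (- 2)), (2 * pi * B); split; rewrite ?mulr_gt0 ?expR_gt0 ?pi_gt0//.
move=> t t0; have lf := lint_fin t0; rewrite weightE.
have := HB t t0; have := lint_lower t0; rewrite -(fineK lf) !lee_fin => h1 h2.
by rewrite -[_ * mass _]mulrA -[X in _ <= _ <= X]mulrA !(ler_pM2l p0) h1.
Qed.

Lemma weight_gt0 t : 0 < t -> 0 < w t.
Proof.
move=> t0; have [a [b [a0 b0 H]]] := weight_bounds; have /andP[h _] := H t t0.
by apply: lt_le_trans h; rewrite mulr_gt0// (mass_gt0 hnu)// invr_gt0.
Qed.

Lemma weight_nonincreasing s t : 0 < s -> s <= t -> w t <= w s.
Proof.
move=> s0 st; have t0 := lt_le_trans s0 st.
rewrite !weightE ler_pM2l ?mulr_gt0 ?pi_gt0//.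
rewrite -lee_fin !fineK ?lint_fin//; apply: ge0_le_integral => //.
- by apply: measurable_funTS; exact: measurable_kernel.
- by apply: measurable_funTS; exact: measurable_kernel.
move=> r; rewrite /= in_itv /= andbT => r0.
by rewrite lee_fin ler_expR -!mulrA !mulNr lerN2 ler_pM2l// ler_wpM2l.
Qed.

End Weight.
(** * Extremal ratios of the weight *)

Section Ratios.
Variable R : realType.
Local Notation mR := (measurableTypeR R).
Variable nu : {sigma_finite_measure set mR -> \bar R}.
Hypothesis hz : doubling nu.
Variable mu : R.
Hypothesis hmu : 1 < mu.

Local Notation w := (zen_weight nu).
Let w0 t : 0 < t -> 0 < w t. Proof. exact: weight_gt0. Qed.
Let mu0 : 0 < mu. Proof. exact: lt_trans hmu. Qed.
Let mun n : 0 < mu ^+ n. Proof. by rewrite exprn_gt0. Qed.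
Let hnu : forall t : R, 0 < t -> (0 < initial_mass nu t < +oo)%E := hz.1.
Local Notation mass := (mass nu).
Local Notation E := (weight_ratios w mu).
Local Notation S n := (sup (E n)).
Local Notation I n := (inf (E n)).

(** The doubling condition, transferred to the weight: [w] does not decrease
    faster than a power. *)
Lemma ratio_one_ge : exists2 d : R, 0 < d & forall t, 0 < t -> d <= w (mu * t) / w t.
Proof.
have [a [b [a0 b0 H]]] := weight_bounds hz.
have [D D1 HD] := doubling_mass hz.
have D0 : 0 < D by apply: lt_le_trans D1.
have [k hk] : exists k : nat, mu <= 2 ^+ k.
  exists (Num.bound mu); apply: ltW; apply: lt_le_trans (archi_boundP (ltW mu0)) _.
  by rewrite -natrX ler_nat ltnW// ltn_expl.
have Dk : 0 < D ^+ k by rewrite exprn_gt0.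
exists (a / (b * D ^+ k)); first by rewrite divr_gt0// mulr_gt0.
move=> t t0; have mt0 : 0 < mu * t by rewrite mulr_gt0.
have /andP[h1 _] := H _ mt0; have /andP[_ h2] := H _ t0.
rewrite ler_pdivlMr ?w0//; apply: le_trans h1.
rewrite mulrAC ler_pdivrMr ?mulr_gt0// -mulrA ler_pM2l//.
apply: le_trans h2 _; rewrite [leRHS]mulrCA ler_pM2l// [leRHS]mulrC.
have i0 : 0 < (mu * t)^-1 by rewrite invr_gt0.
apply: le_trans (mass_pow (ltW D0) HD k i0).
apply: mass_le => //; first by rewrite invr_gt0.
by rewrite invfM mulrA -[leLHS]mul1r ler_pM2r ?invr_gt0// ler_pdivlMr// mul1r.
Qed.

Lemma ratio_in n t : 0 < t -> E n (w (mu ^+ n * t) / w t).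
Proof. by exists t. Qed.

Lemma E_nonempty n : E n !=set0.
Proof. by exists (w (mu ^+ n * 1) / w 1); apply: ratio_in. Qed.

Lemma E_ub n : ubound (E n) 1.
Proof.
move=> _ [t /= t0 <-]; rewrite ler_pdivrMr ?w0// mul1r.
apply: (weight_nonincreasing hz) => //.
by rewrite ler_peMl ?(ltW t0)// exprn_ege1// ltW.
Qed.

Lemma E_lb n : lbound (E n) 0.
Proof. by move=> _ [t /= t0 <-]; rewrite divr_ge0// ltW// w0// mulr_gt0. Qed.

Lemma ratio_le_sup n t : 0 < t -> w (mu ^+ n * t) / w t <= S n.
Proof. by move=> t0; apply: ub_le_sup; [exists 1; exact: E_ub|exact: ratio_in]. Qed.

Lemma ratio_ge_inf n t : 0 < t -> I n <= w (mu ^+ n * t) / w t.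
Proof. by move=> t0; apply: ge_inf; [exists 0; exact: E_lb|exact: ratio_in]. Qed.

Lemma ratioM m n t : 0 < t -> w (mu ^+ (m + n) * t) / w t =
  (w (mu ^+ m * (mu ^+ n * t)) / w (mu ^+ n * t)) * (w (mu ^+ n * t) / w t).
Proof.
move=> t0; have h : 0 < w (mu ^+ n * t) by apply: w0; rewrite mulr_gt0.
by rewrite exprD -[in LHS]mulrA [RHS]mulrA divfK// gt_eqF.
Qed.

Lemma ratio_ge0 n t : 0 < t -> 0 <= w (mu ^+ n * t) / w t.
Proof. by move=> t0; exact: E_lb (ratio_in n t0). Qed.

Lemma supM m n : S (m + n)%N <= S m * S n.
Proof.
apply: ge_sup; first exact: E_nonempty.
move=> _ [t /= t0 <-]; rewrite ratioM//; have h : 0 < mu ^+ n * t by rewrite mulr_gt0.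
by apply: ler_pM; rewrite ?ratio_ge0// ratio_le_sup.
Qed.

Lemma inf_ge0 n : 0 <= I n.
Proof. apply: lb_le_inf; [exact: E_nonempty|exact: E_lb]. Qed.

Lemma infM m n : I m * I n <= I (m + n)%N.
Proof.
apply: lb_le_inf; first exact: E_nonempty.
move=> _ [t /= t0 <-]; rewrite ratioM//; have h : 0 < mu ^+ n * t by rewrite mulr_gt0.
by apply: ler_pM; rewrite ?inf_ge0// ratio_ge_inf.
Qed.

Lemma inf1_gt0 : 0 < I 1%N.
Proof.
have [d d0 H] := ratio_one_ge; apply: lt_le_trans d0 _.
apply: lb_le_inf; first exact: E_nonempty.
by move=> _ [t /= t0 <-]; rewrite expr1; exact: H.
Qed.

Lemma inf_ge_pow n : I 1%N ^+ n <= I n.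
Proof.
elim: n => [|n IH].
  apply: lb_le_inf; first exact: E_nonempty.
  by move=> _ [t /= t0 <-]; rewrite !expr0 mul1r divff// gt_eqF// w0.
rewrite exprS; exact: (le_trans (ler_wpM2l (inf_ge0 1%N) IH) (infM 1%N n)).
Qed.

Lemma inf_gt0 n : 0 < I n.
Proof. by apply: lt_le_trans (inf_ge_pow n); rewrite exprn_gt0// inf1_gt0. Qed.

Lemma inf_le_sup n : I n <= S n.
Proof. exact: le_trans (ratio_ge_inf n ltr01) (ratio_le_sup n ltr01). Qed.

Lemma inf_le1 n : I n <= 1.
Proof. exact: le_trans (ratio_ge_inf n ltr01) (E_ub (ratio_in n ltr01)). Qed.

(** The suprema are submultiplicative because [w (mu^(m+n) t) / w t] is a product
    of two ratios. *)
Lemma outer_cvg : exists2 L : R, 0 < L & outer_seq w mu @ \oo --> L.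
Proof.
apply: (@root_cvg R (fun n => S n) (I 1%N) inf1_gt0).
- by move=> n; exact: lt_le_trans (inf_gt0 n) (inf_le_sup n).
- exact: supM.
- by move=> n; apply: le_trans (inf_ge_pow n) (inf_le_sup n).
Qed.

(** The infima are supermultiplicative, so it is their inverses that fall under
    [root_cvg]; they are positive thanks to [ratio_one_ge]. *)
Lemma inner_inv_cvg : exists2 L : R, 0 < L &
  (fun n => (I n)^-1 `^ ((2 * n)%:R)^-1) @ \oo --> L.
Proof.
apply: (@root_cvg R (fun n => (I n)^-1) 1 ltr01).
- by move=> n; rewrite invr_gt0 inf_gt0.
- move=> m n; rewrite -invfM lef_pV2 ?posrE ?mulr_gt0 ?inf_gt0// mulrC.
  by rewrite mulrC infM.
- by move=> n; rewrite expr1n invf_ge1 ?inf_gt0// inf_le1.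
Qed.

Lemma inner_seqE : inner_seq w mu = fun n => ((I n)^-1 `^ ((2 * n)%:R)^-1)^-1.
Proof.
apply/funext => n; rewrite /inner_seq /powR !gt_eqF ?invr_gt0 ?inf_gt0//.
by rewrite lnV ?posrE ?inf_gt0// mulrN expRN invrK.
Qed.

(** The constant [B] is independent of [n], which makes it disappear when [n]-th
    roots are taken. *)
Lemma mass_ratio : exists2 B : R, 0 < B & forall n t, 0 < t ->
  mass (t / mu ^+ n) <= B * S n * mass t /\ mass (mu ^+ n * t) <= B / I n * mass t.
Proof.
have [a [b [a0 b0 H]]] := weight_bounds hz.
exists (b / a); first by rewrite divr_gt0.
move=> n t t0; split.
- have s0 : 0 < t^-1 by rewrite invr_gt0.
  have ms0 : 0 < mu ^+ n * t^-1 by rewrite mulr_gt0.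
  have /andP[h1 _] := H _ ms0; have /andP[_ h2] := H _ s0.
  rewrite invfM invrK in h1; rewrite invrK in h2.
  have h3 := ratio_le_sup n s0; rewrite ler_pdivrMr ?w0// in h3.
  have S0 : 0 <= S n by exact: le_trans (inf_ge0 n) (inf_le_sup n).
  have h4 := le_trans h1 (le_trans h3 (ler_wpM2l S0 h2)).
  rewrite -(ler_pM2l a0) [t / _]mulrC; apply: le_trans h4 _.
  rewrite le_eqVlt; apply/orP; left; apply/eqP; field.
  by rewrite gt_eqF.
- have mt0 : 0 < mu ^+ n * t by rewrite mulr_gt0.
  have s0 : 0 < (mu ^+ n * t)^-1 by rewrite invr_gt0.
  have sE : mu ^+ n * (mu ^+ n * t)^-1 = t^-1.
    by field; rewrite !gt_eqF.
  have ti0 : 0 < t^-1 by rewrite invr_gt0.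
  have /andP[h1 _] := H _ s0; rewrite invrK in h1.
  have /andP[_ h2] := H _ ti0; rewrite invrK in h2.
  have h3 := ratio_ge_inf n s0; rewrite sE ler_pdivlMr ?w0// in h3.
  have h4 := le_trans h3 h2.
  have h5 := le_trans (ler_wpM2l (inf_ge0 n) h1) h4.
  rewrite -(ler_pM2l (mulr_gt0 (inf_gt0 n) a0)) -mulrA; apply: le_trans h5 _.
  rewrite le_eqVlt; apply/orP; left; apply/eqP; field.
  by rewrite !gt_eqF// inf_gt0.
Qed.

End Ratios.
(** * Operators on the Zen space *)

Section Transfer.
Variable R : realType.
Local Notation mR := (measurableTypeR R).
Variable nu : {sigma_finite_measure set mR -> \bar R}.
Implicit Types (F G : right_half_plane R -> (R[i])^o) (f g : R[i] -> R[i]).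
Implicit Types Phi Psi : (R[i] -> R[i]) -> R[i] -> R[i].

(** The Zen space in extended form ([zen_spaceP]). *)
Definition zen_function f : Prop := hol f /\ (norm2 nu f < +oo)%E.

(** A bounded operator of the Zen space, in extended form, with the bound stated
    for the square of the norm. *)
Definition zen_bounded Phi : Prop :=
  [/\ forall f, zen_function f -> hol (Phi f),
      forall k f g, zen_function f -> zen_function g ->
        Phi (fun z => k * f z + g z) = (fun z => k * Phi f z + Phi g z)
    & exists2 K : R, 0 <= K & forall f, zen_function f ->
        (norm2 nu (Phi f) <= K%:E * norm2 nu f)%E].

Lemma zen_bounded_function Phi f : zen_bounded Phi -> zen_function f -> zen_function (Phi f).
Proof.
move=> [h _ [K K0 HK]] hf; split; first exact: h.
by apply: le_lt_trans (HK _ hf) _; rewrite (norm2E hf.2) -EFinM ltry.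
Qed.

Lemma zen_bounded_id : zen_bounded id.
Proof. by split => // [f []//|]; exists 1 => // f _; rewrite mul1e. Qed.

Lemma zen_bounded_comp Phi Psi : zen_bounded Phi -> zen_bounded Psi -> zen_bounded (Phi \o Psi).
Proof.
move=> bP bS; have [hP lP [K K0 HK]] := bP; have [hS lS [L L0 HL]] := bS.
split => [f zf|k f g zf zg|].
- by apply: hP; exact: zen_bounded_function.
- rewrite /comp (lS k f g zf zg).
  exact: (lP k _ _ (zen_bounded_function bS zf) (zen_bounded_function bS zg)).
- exists (K * L); first by rewrite mulr_ge0.
  move=> f zf; apply: le_trans (HK _ (zen_bounded_function bS zf)) _.
  by rewrite EFinM -muleA lee_wpmul2l// ?lee_fin// HL.
Qed.

Lemma zen_bounded_comb a Phi Psi : zen_bounded Phi -> zen_bounded Psi ->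
  zen_bounded (fun f z => a * Phi f z + Psi f z).
Proof.
move=> bP bS; have [hP lP [K K0 HK]] := bP; have [hS lS [L L0 HL]] := bS.
split => [f zf|k f g zf zg|].
- by apply: hol_comb; [exact: hP|exact: hS].
- by apply/funext => z; rewrite (lP k f g zf zg) (lS k f g zf zg); ring.
- exists (2 * normc a ^+ 2 * K + 2 * L).
    by rewrite addr_ge0// mulr_ge0// mulr_ge0// sqr_ge0.
  move=> f zf; apply: le_trans (norm2_comb _ _ (hP f zf) (hS f zf)) _.
  have a0 : (0 <= (2 * normc a ^+ 2)%:E)%E by rewrite lee_fin mulr_ge0// sqr_ge0.
  have b0 : ((0 : \bar R) <= 2%:E)%E by rewrite lee_fin.
  apply: le_trans (leeD (lee_wpmul2l a0 (HK f zf)) (lee_wpmul2l b0 (HL f zf))) _.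
  rewrite (norm2E zf.2) -!EFinM -EFinD lee_fin le_eqVlt; apply/orP; left; apply/eqP.
  by ring.
Qed.

Lemma zen_bounded_scale a : zen_bounded (fun f z => a * f z).
Proof.
split => [f [hf _]|k f g _ _|].
- exact: holZ.
- by apply/funext => z; ring.
- exists (normc a ^+ 2); first exact: sqr_ge0.
  move=> f [hf _]; apply: le_trans (@norm2_le_comb R nu f (fun=> 0) (fun z => a * f z) (normc a ^+ 2) 0 hf (hol0 R) (holZ a hf) (sqr_ge0 _) (lexx 0) _) _.
    by move=> z; rewrite mul0r addr0 Normc.normcM exprMn.
  by rewrite mul0e adde0.
Qed.

Lemma hol_extendK f : hol f -> extend (fun s => f (val s)) = f.
Proof.
move=> [_ f0]; apply/funext => z; rewrite /extend; case: insubP => [u _ <-//|] /=.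
by rewrite -leNgt => /f0.
Qed.

Lemma extend_val F (s : right_half_plane R) : extend F (val s) = F s.
Proof. by rewrite /extend valK. Qed.

Lemma zen_spaceP F : zen_space nu F <-> zen_function (extend F).
Proof.
have out z : Re z <= 0 -> extend F z = 0.
  by move=> z0; rewrite /extend insubF// ltNge z0.
split=> [[hF fF]|[hF fF]].
- have h : hol (extend F) by split.
  by split => //; rewrite /norm2 -zen_sqnormE.
- by split; [exact: hF.1|rewrite zen_sqnormE].
Qed.

Lemma extend_comb a F G :
  extend (a *: F + G : right_half_plane R -> (R[i])^o) = fun z => a * extend F z + extend G z.
Proof.
apply/funext => z; rewrite /extend; case: insubP => [u _ _//|_] /=.
by rewrite mulr0 addr0.
Qed.

Lemma zen_normE F : zen_function (extend F) ->
  zen_norm nu F = Num.sqrt (fine (norm2 nu (extend F))).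
Proof. by move=> [hF _]; rewrite /zen_norm zen_sqnormE. Qed.

Definition transfer Phi F : right_half_plane R -> (R[i])^o :=
  fun s => Phi (extend F) (val s).

Lemma extend_transfer Phi F : zen_bounded Phi -> zen_space nu F ->
  extend (transfer Phi F) = Phi (extend F).
Proof. by move=> [hP _ _] /zen_spaceP zF; apply: hol_extendK; exact: hP. Qed.

Lemma fine_le_scale (x y : \bar R) (K : R) : (0 <= x)%E -> (0 <= y)%E ->
  (x < +oo)%E -> (y < +oo)%E -> (x <= K%:E * y)%E -> fine x <= K * fine y.
Proof.
by case: x => [x| |]// x0; case: y => [y| |]// y0 _ _; rewrite -EFinM lee_fin.
Qed.

Lemma bounded_transfer Phi : zen_bounded Phi ->
  bounded_operator (zen_space nu) (zen_norm nu) (transfer Phi).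
Proof.
move=> bP; have [hP lP [K K0 HK]] := bP; split => [F zF|a F G zF zG|].
- apply/zen_spaceP; rewrite (extend_transfer bP zF).
  exact: (zen_bounded_function bP ((zen_spaceP F).1 zF)).
- apply/funext => s; rewrite /transfer extend_comb.
  by rewrite (lP a _ _ ((zen_spaceP F).1 zF) ((zen_spaceP G).1 zG)).
- exists (Num.sqrt K) => F zF; have /zen_spaceP zF' := zF.
  have E := extend_transfer bP zF.
  have zP := zen_bounded_function bP zF'; have zT := zP; rewrite -E in zT.
  rewrite (zen_normE zT) (zen_normE zF') E -sqrtrM//; apply: ler_wsqrtr.
  exact: (fine_le_scale (norm2_ge0 _ _) (norm2_ge0 _ _) zP.2 zF'.2 (HK _ zF')).
Qed.

Lemma invertible_transfer Phi Psi T : zen_bounded Phi -> zen_bounded Psi ->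
  (forall f, zen_function f -> Psi (Phi f) = f) ->
  (forall f, zen_function f -> Phi (Psi f) = f) ->
  T = transfer Phi -> invertible_operator (zen_space nu) (zen_norm nu) T.
Proof.
move=> bP bS SP PS ->; split; first exact: bounded_transfer.
exists (transfer Psi); split => [|F zF|F zF]; first exact: bounded_transfer.
- have zF' := (zen_spaceP F).1 zF; apply/funext => s.
  by rewrite {1}/transfer (extend_transfer bP zF) (SP _ zF') extend_val.
- have zF' := (zen_spaceP F).1 zF; apply/funext => s.
  by rewrite {1}/transfer (extend_transfer bS zF) (PS _ zF') extend_val.
Qed.

End Transfer.
(** * The resolvent of the composition operator *)

Section Resolvent.
Variable R : realType.
Local Notation mR := (measurableTypeR R).
Variable nu : {sigma_finite_measure set mR -> \bar R}.
Hypothesis hz : doubling nu.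
Let hnu : forall t : R, 0 < t -> (0 < initial_mass nu t < +oo)%E := hz.1.

Section Series.
Variables (c : R[i]) (l q K : R) (k : nat -> R).
Hypotheses (l0 : 0 < l) (q01 : 0 < q < 1) (K0 : 0 <= K).
Hypothesis Hk : forall i f, zen_function nu f ->
  (norm2 nu (fun z => f ((l ^+ i)%:C%C * z))%R <= (k i)%:E * norm2 nu f)%E.
Hypothesis HK : forall i, (normc c ^+ 2) ^+ i * k i <= K * (q ^+ 2) ^+ i.

Lemma dilation_term_le i f : hol f -> (norm2 nu f < +oo)%E ->
  (norm2 nu (neumann_term c l f i) <= (K * (q ^+ 2) ^+ i)%:E * norm2 nu f)%E.
Proof.
move=> hf ff; have li : 0 < l ^+ i by rewrite exprn_gt0.
have hd := dilate_hol hf li.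
apply: (@le_trans _ _ ((normc (c ^+ i) ^+ 2)%:E * norm2 nu (fun z => f ((l ^+ i)%:C%C * z))%R)%E).
  apply: le_trans (@norm2_le_comb R nu _ (fun=> 0) _ (normc (c ^+ i) ^+ 2) 0 hd (hol0 R) (holZ (c ^+ i) hd) (sqr_ge0 _) (lexx 0) _) _.
    by move=> z; rewrite mul0r addr0 Normc.normcM exprMn.
  by rewrite mul0e adde0.
apply: le_trans (lee_wpmul2l _ (Hk i (conj hf ff))) _; first by rewrite lee_fin sqr_ge0.
rewrite muleA -EFinM; apply: lee_wpmul2r; first exact: norm2_ge0.
by rewrite lee_fin normcX exprAC HK.
Qed.

Lemma zen_bounded_neumann : zen_bounded nu (neumann c l).
Proof.
split => [f [hf ff]|a f g [hf ff] [hg fg]|].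
- exact: (hol_neumann hnu l0 q01 K0 dilation_term_le).
- by apply/funext => z; exact: (neumann_comb hnu l0 q01 K0 dilation_term_le).
- exists (K / (1 - q) ^+ 2); first by rewrite divr_ge0// sqr_ge0.
  by move=> f [hf ff]; exact: (norm2_neumann hnu l0 q01 K0 dilation_term_le).
Qed.

Lemma zen_neumann_fix f z : zen_function nu f ->
  neumann c l f z = f z + c * neumann c l f (l%:C%C * z).
Proof. by move=> [hf ff]; exact: (neumann_fix hnu l0 q01 K0 dilation_term_le). Qed.

Lemma zen_neumann_left f z : zen_function nu f ->
  neumann c l (fun z => - c * f (l%:C%C * z) + f z) z = f z.
Proof. by move=> [hf ff]; exact: (neumann_left hnu l0 q01 K0 dilation_term_le). Qed.

End Series.

Variable mu : R.
Hypothesis hmu : 1 < mu.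
Let mu0 : 0 < mu. Proof. exact: lt_trans hmu. Qed.
Local Notation S n := (sup (weight_ratios (zen_weight nu) mu n)).
Local Notation I n := (inf (weight_ratios (zen_weight nu) mu n)).

(** The square norms of the powers of the composition operator and of its inverse. *)
Lemma dilation_powers : exists2 B : R, 0 < B & forall i f, zen_function nu f ->
  (norm2 nu (fun z => f ((mu ^+ i)%:C%C * z))%R <= (B * S i / mu ^+ i)%:E * norm2 nu f)%E /\
  (norm2 nu (fun z => f ((mu^-1 ^+ i)%:C%C * z))%R <= (B / I i * mu ^+ i)%:E * norm2 nu f)%E.
Proof.
have [B B0 HB] := mass_ratio hz hmu; exists B => // i f [hf ff].
have mi : 0 < mu ^+ i by rewrite exprn_gt0.
have I0 : 0 < I i by exact: (inf_gt0 hz hmu).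
have S0 : 0 <= S i by apply: le_trans (ltW I0) (inf_le_sup hz hmu i).
split.
- apply: (norm2_dilate hnu hf ff mi); first by rewrite mulr_ge0// ltW.
  move=> t t0; rewrite !massE ?divr_gt0// -EFinM lee_fin; exact: (HB i t t0).1.
(* The dilation by [1 / mu^i] compares [mass (mu^i t)] to
   [mass t]. *)
- rewrite -[X in (_ * X)%:E]invrK -exprVn; apply: (norm2_dilate hnu hf ff).
  + by rewrite exprn_gt0// invr_gt0.
  + by rewrite divr_ge0// ltW.
  + move=> t t0; rewrite exprVn invrK mulrC !massE ?mulr_gt0// -EFinM lee_fin.
    exact: (HB i t t0).2.
Qed.

(** The operator [C - z], in extended form. *)
Definition resolvent_map (z : R[i]) (f : R[i] -> R[i]) w := - z * f w + f (mu%:C%C * w).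

Lemma resolvent_mapE z :
  (fun F => composition (dilation hmu) F - z *: F) = transfer (resolvent_map z).
Proof.
apply/funext => F; apply/funext => s.
rewrite /transfer /resolvent_map -[mu%:C%C * val s]/(val (dilation hmu s)) !extend_val mulNr.
by rewrite [RHS]addrC.
Qed.

Lemma zen_bounded_mu : zen_bounded nu (fun f z => f (mu%:C%C * z)).
Proof.
have [B B0 HB] := dilation_powers.
split => [f [hf _]|//|]; first exact: dilate_hol.
exists (B * S 1 / mu ^+ 1); last by move=> f zf; have [+ _] := HB 1%N f zf; rewrite expr1.
rewrite divr_ge0 ?expr1 ?(ltW mu0)// mulr_ge0 ?(ltW B0)//.
exact: le_trans (ltW (inf_gt0 hz hmu 1)) (inf_le_sup hz hmu 1).
Qed.

Lemma zen_bounded_mu_inv : zen_bounded nu (fun f z => f (mu^-1%:C%C * z)).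
Proof.
have [B B0 HB] := dilation_powers.
split => [f [hf _]|//|]; first by apply: dilate_hol => //; rewrite invr_gt0.
exists (B / I 1 * mu ^+ 1); last by move=> f zf; have [_ +] := HB 1%N f zf; rewrite expr1.
by rewrite mulr_ge0 ?expr1 ?(ltW mu0)// divr_ge0 ?(ltW B0)// ltW// (inf_gt0 hz hmu).
Qed.

Lemma zen_bounded_resolvent_map z : zen_bounded nu (resolvent_map z).
Proof. exact: (zen_bounded_comb (- z) (zen_bounded_id nu) zen_bounded_mu). Qed.

(** With [c = 1/z] and [D = C], [(C - z)^-1 = - c (1 - c D)^-1]. The square norm of
    [(c D)^n] is at most a constant times [sup w(mu^n t)/w(t)] divided by
    [(mu |z|^2)^n], so it decays as soon as [L < sqrt mu |z|]. *)
Lemma outer_invertible (z : R[i]) (L : R) : 0 < L ->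
  outer_seq (zen_weight nu) mu @ \oo --> L -> L < Num.sqrt mu * normc z ->
  invertible_operator (zen_space nu) (zen_norm nu)
    (fun F => composition (dilation hmu) F - z *: F).
Proof.
move=> L0 HL; set y := _ * _ => Ly.
have y0 : 0 < y by exact: lt_trans Ly.
have y2 : y ^+ 2 = mu * normc z ^+ 2 by rewrite exprMn sqr_sqrtr// ltW.
have z0 : 0 < normc z.
  by rewrite lt_def normc_ge0 andbT; apply/eqP => E; move: y0; rewrite /y E mulr0 ltxx.
have zn0 : z != 0 by rewrite -normc_gt0.
(* Any value strictly between [L] and [y] would do. *)
pose B := (L + y) / 2.
have B0 : 0 < B by rewrite /B; lra.
have LB : L < B by rewrite /B; lra.
have By : B < y by rewrite /B; lra.
have S0 n : 0 <= S n by apply: le_trans (ltW (inf_gt0 hz hmu n)) (inf_le_sup hz hmu n).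
have [K1 K10 HK1] := root_upper S0 HL B0 LB.
have [B1 B10 HB1] := dilation_powers.
pose c := z^-1; pose q := B / y; pose K := B1 * K1.
have q01 : 0 < q < 1 by rewrite divr_gt0//= ltr_pdivrMr// mul1r.
have K0 : 0 <= K by rewrite mulr_ge0// ltW.
pose k i := B1 * S i / mu ^+ i.
have Hk i f : zen_function nu f ->
    (norm2 nu (fun z => f ((mu ^+ i)%:C%C * z))%R <= (k i)%:E * norm2 nu f)%E.
  by move=> zf; exact: (HB1 i f zf).1.
have nc : normc c * normc z = 1 by rewrite -Normc.normcM mulVf// Normc.normc1.
have HK i : (normc c ^+ 2) ^+ i * k i <= K * (q ^+ 2) ^+ i.
  have -> : normc c = (normc z)^-1 by rewrite -[LHS]mulr1 -(divff (lt0r_neq0 z0)) mulrA nc mul1r.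
  have -> : K * (q ^+ 2) ^+ i = (normc z)^-1 ^+ 2 ^+ i * (B1 * (K1 * (B ^+ 2) ^+ i) / mu ^+ i).
    have -> : q ^+ 2 = B ^+ 2 * ((normc z)^-1 ^+ 2 / mu).
      by rewrite /q exprMn [y^-1 ^+ 2]exprVn y2 invfM exprVn [mu^-1 * _]mulrC.
    by rewrite !exprMn [mu^-1 ^+ i]exprVn /K; ring.
  rewrite /k ler_wpM2l ?exprn_ge0 ?invr_ge0 ?normc_ge0//.
  rewrite ler_wpM2r ?invr_ge0 ?exprn_ge0 ?(ltW mu0)//.
  by rewrite ler_wpM2l ?(ltW B10)// HK1.
have bN := zen_bounded_neumann mu0 q01 K0 Hk HK.
have bc := zen_bounded_scale nu (- c).
apply: (@invertible_transfer _ _ (resolvent_map z) (neumann c mu \o (fun f w => - c * f w))).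
- exact: zen_bounded_resolvent_map.
- exact: zen_bounded_comp.
- move=> f zf; apply/funext => w; rewrite /=.
  apply: etrans (zen_neumann_left mu0 q01 K0 Hk HK w zf); congr (neumann _ _ _ w).
  by apply/funext => v; rewrite /resolvent_map mulrDr mulrA mulrNN mulVf// mul1r addrC.
- move=> f zf; apply/funext => w; rewrite /resolvent_map /=.
  have zc := zen_bounded_function bc zf.
  rewrite (zen_neumann_fix mu0 q01 K0 Hk HK w zc) mulrDr mulrA mulrNN mulfV// mul1r.
  by rewrite mulrA mulNr mulfV// mulN1r addrNK.
- exact: resolvent_mapE.
Qed.

(** With [D] the inverse of [C], [(C - z)^-1 = D (1 - z D)^-1], and the square norm
    of [(z D)^n] is at most a constant times [(mu |z|^2)^n] divided by
    [inf w(mu^n t)/w(t)]. *)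
Lemma inner_invertible (z : R[i]) (L : R) : 0 < L ->
  (fun n => (I n)^-1 `^ ((2 * n)%:R)^-1) @ \oo --> L -> Num.sqrt mu * normc z * L < 1 ->
  invertible_operator (zen_space nu) (zen_norm nu)
    (fun F => composition (dilation hmu) F - z *: F).
Proof.
move=> L0 HL; set y := Num.sqrt mu * normc z => yL.
have y0 : 0 <= y by rewrite mulr_ge0 ?sqrtr_ge0 ?normc_ge0.
have y2 : y ^+ 2 = mu * normc z ^+ 2 by rewrite exprMn sqr_sqrtr// ltW.
have yL0 : 0 <= y * L by rewrite mulr_ge0// ltW.
have d0 : 0 < 1 + y * L by lra.
(* Larger than [L], and still such that [y * B < 1]. *)
pose B := 2 * L / (1 + y * L).
have B0 : 0 < B by rewrite divr_gt0// mulr_gt0.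
have LB : L < B by rewrite ltr_pdivlMr// mulrC ltr_pM2r//; lra.
have yB : y * B < 1 by rewrite /B mulrA ltr_pdivrMr//; lra.
have I0 n : 0 <= (I n)^-1 by rewrite invr_ge0 ltW// (inf_gt0 hz hmu).
have [K1 K10 HK1] := root_upper I0 HL B0 LB.
have [B1 B10 HB1] := dilation_powers.
have yB0 : 0 <= y * B by rewrite mulr_ge0// ltW.
(* A ratio above [y * B] that is positive even when [z = 0]. *)
pose q := (1 + y * B) / 2; pose K := B1 * K1.
have q01 : 0 < q < 1 by rewrite /q; apply/andP; split; lra.
have K0 : 0 <= K by rewrite mulr_ge0// ltW.
have mi0 : 0 < mu^-1 by rewrite invr_gt0.
pose k i := B1 / I i * mu ^+ i.
have Hk i f : zen_function nu f ->
    (norm2 nu (fun z => f ((mu^-1 ^+ i)%:C%C * z))%R <= (k i)%:E * norm2 nu f)%E.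
  by move=> zf; exact: (HB1 i f zf).2.
have HK i : (normc z ^+ 2) ^+ i * k i <= K * (q ^+ 2) ^+ i.
  apply: (@le_trans _ _ ((normc z ^+ 2) ^+ i * (B1 * (K1 * (B ^+ 2) ^+ i) * mu ^+ i))).
    rewrite /k ler_wpM2l ?exprn_ge0 ?normc_ge0//.
    by rewrite ler_wpM2r ?exprn_ge0 ?(ltW mu0)// ler_wpM2l ?(ltW B10)// HK1.
  have -> : (normc z ^+ 2) ^+ i * (B1 * (K1 * (B ^+ 2) ^+ i) * mu ^+ i) = K * ((y * B) ^+ 2) ^+ i.
    by rewrite [(y * B) ^+ 2]exprMn y2 !exprMn /K; ring.
  by rewrite ler_wpM2l// -!exprM; apply: lerXn2r; rewrite ?nnegrE /q; lra.
have bN := zen_bounded_neumann mi0 q01 K0 Hk HK.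
have muK w : mu^-1%:C%C * (mu%:C%C * w) = w.
  by rewrite mulrA -rmorphM /= mulVf ?gt_eqF// mul1r.
have mu'K w : mu%:C%C * (mu^-1%:C%C * w) = w.
  by rewrite mulrA -rmorphM /= mulfV ?gt_eqF// mul1r.
apply: (@invertible_transfer _ _ (resolvent_map z) ((fun f w => f (mu^-1%:C%C * w)) \o neumann z mu^-1)).
- exact: zen_bounded_resolvent_map.
- exact: zen_bounded_comp zen_bounded_mu_inv bN.
- move=> f zf; apply/funext => w; rewrite /=.
  have zf1 := zen_bounded_function zen_bounded_mu zf.
  have -> : resolvent_map z f =
      (fun v => - z * f (mu%:C%C * (mu^-1%:C%C * v)) + f (mu%:C%C * v)).
    by apply/funext => v; rewrite mu'K.
  exact: etrans (zen_neumann_left mi0 q01 K0 Hk HK (mu^-1%:C%C * w) zf1) (congr1 f (mu'K w)).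
- move=> f zf; apply/funext => w; rewrite /resolvent_map /= muK.
  rewrite (zen_neumann_fix mi0 q01 K0 Hk HK w zf) addrCA mulNr addNr addr0//.
- exact: resolvent_mapE.
Qed.

End Resolvent.

Theorem theorem3p3 (R : realType)
    (nu : {measure set (measurableTypeR R) -> \bar R})
    (hnu : zen_measure nu) (mu : R) (hmu : 1 < mu) :
  let w := zen_weight nu in
  let r := (Num.sqrt mu)^-1 * limn (inner_seq w mu) in
  let R' := (Num.sqrt mu)^-1 * limn (outer_seq w mu) in
  [/\ cvgn (inner_seq w mu), cvgn (outer_seq w mu)
    & spectrum (zen_space nu) (zen_norm nu) (composition (dilation hmu))
      `<=` [set z : R[i] | r <= Normc.normc z <= R']].
Proof.
have [m mE] := zen_sigma_finite hnu.
move: hnu; rewrite -mE => -[_ _ hz] w r R'.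
have [LS LS0 HS] := outer_cvg hz hmu.
have [LI LI0 HI] := inner_inv_cvg hz hmu.
have HI' : inner_seq w mu @ \oo --> LI^-1.
  by rewrite /w inner_seqE//; apply: cvgV => //; rewrite gt_eqF.
have rE : r = (Num.sqrt mu)^-1 * LI^-1 by rewrite /r (cvg_lim _ HI').
have RE : R' = (Num.sqrt mu)^-1 * LS by rewrite /R' (cvg_lim _ HS).
split; [by apply/cvg_ex; exists LI^-1|by apply/cvg_ex; exists LS|].
have s0 : 0 < Num.sqrt mu by rewrite sqrtr_gt0 (lt_trans _ hmu).
move=> z /= nz; apply/andP; split; rewrite leNgt; apply/negP => h; apply: nz.
- apply: (inner_invertible hz hmu LI0 HI); move: h.
  by rewrite rE mulrC ltr_pdivlMr// -[LI^-1]mul1r ltr_pdivlMr// [normc z * _]mulrC.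
- apply: (outer_invertible hz hmu LS0 HS); move: h.
  by rewrite RE mulrC ltr_pdivrMr// mulrC.
Qed.
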